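(* In the setting described in the context (in particular $b\neq 0$), for $W=f(Y)$ and $Z\sim N(0,1)$, $$d_{\mathrm{Wass}}(W,Z)\le \frac{C}{|b|}(\delta_1+\delta_2+\delta_3),\qquad d_{\mathrm{Kol}}(W,Z)\le \frac{C}{|b|}(\delta_1'+\delta_2+\delta_3),$$ where $C$ is an absolute constant.
   Context: Let $N\ge1$ be an integer, $X=(X_1,\dots,X_N)$ a vector of independent real random variables, $g:\mathbb{R}^N\to\mathbb{R}$ measurable, and $h(x)=\exp\{g(x)\}>0$ with $a:=\mathbb{E}h(X)<\infty$. Let $Y=(Y_1,\dots,Y_N)$ be a random vector with law $\mathbb{P}(Y=dy)=\frac{h(y)}{\mathbb{E}h(X)}\mathbb{P}(X=dy)$, $y\in\mathbb{R}^N$. Let $f:\mathbb{R}^N\to\mathbb{R}$ be a function with $\mathbb{E}f(Y)=0$, and put $W:=f(Y)$. ($W$ is thought of, without loss of generality, as appropriately normalized to have variance close to 1.) The expectations, conditional expectations and variances appearing below are understood to be well defined. Let $X'=(X_1',\dots,X_N')$ be an independent copy of $X$, and let $X^{[i]}=(X_1,\dots,X_i,X_{i+1}',\dots,X_N')$ for $0\le i\le N$ (so $X^{[0]}=X'$, $X^{[N]}=X$) and $X^{(i)}=(X_1,\dots,X_{i-1},X_i',X_{i+1},\dots,X_N)$ for $1\le i\le N$. Define functions $\Delta_{1,i},\Delta_{2,i}$ on $\mathbb{R}^N$ by $$\Delta_{1,i}(X)=\tfrac12\mathbb{E}\big[(f(X)-f(X^{(i)}))(f(X^{[i]})-f(X^{[i-1]}))\,\big|\,X\big],$$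 $$\Delta_{2,i}(X)=\tfrac12\mathbb{E}\big[(g(X)-g(X^{(i)}))(f(X^{[i]})-f(X^{[i-1]}))\,\big|\,X\big];$$ $\Delta_{1,i}(Y),\Delta_{2,i}(Y)$ denote these functions evaluated at $Y$. For each $i$ let $D_i^*(X,X')$ be any symmetric function of $X$ and $X'$ such that $$D_i^*(X,X')=D_i^*(X',X)\ge |f(X^{[i]})-f(X^{[i-1]})|.$$ Let $b=\mathbb{E}\big[\sum_{i=1}^N\Delta_{1,i}(Y)\big]$, assumed to satisfy $b\ne0$. Let $$T=\frac1a\sum_{i=1}^N\mathbb{E}\big\{h(X)e^{|g(X)-g(X^{(i)})|}(g(X)-g(X^{(i)}))^2\big(|g(X)-g(X^{(i)})|+|f(X)-f(X^{(i)})|\big)|f(X^{[i]})-f(X^{[i-1]})|\big\},$$ $$\delta_1=\frac1a\sum_{i=1}^N\mathbb{E}\big\{h(X)(f(X)-f(X^{(i)}))^2|f(X^{[i]})-f(X^{[i-1]})|\big\}+T,$$ $$\delta_1'=\frac1a\sum_{i=1}^N\mathbb{E}\big\{h(X)e^{|g(X)-g(X^{(i)})|}D_i^*(X,X')|f(X)-f(X^{(i)})||g(X)-g(X^{(i)})|\big\}+\frac1a\mathbb{E}\Big\{h(X)\Big|\sum_{i=1}^N\mathbb{E}[D_i^*(X,X')(f(X)-f(X^{(i)}))|X]\Big|\Big\}+T,$$ $$\delta_2=\sqrt{\mathrm{Var}\Big(\sum_{i=1}^N\Delta_{1,i}(Y)\Big)},\qquad \delta_3=\sqrt{\mathrm{Var}\Big\{\sum_{i=1}^N\Delta_{2,i}(Y)-(1-b)f(Y)\Big\}}.$$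 Distances: $d_{\mathrm{Kol}}(W,Z)=\sup_{x\in\mathbb{R}}|\mathbb{P}(W\le x)-\mathbb{P}(Z\le x)|$ and $d_{\mathrm{Wass}}(W,Z)=\sup_\psi|\mathbb{E}\psi(W)-\mathbb{E}\psi(Z)|$, the sup over absolutely continuous $\psi:\mathbb{R}\to\mathbb{R}$ with $\|\psi'\|_\infty\le1$.
   Formalization: D_i^* is additionally assumed invariant (a.s.) under exchanging the single pair X_i and X_i', besides D_i^*(X,X') = D_i^*(X',X); with only the latter symmetry the Kolmogorov bound fails already for N = 2, g = 0. *)

(* Defs.v *)
From HB Require Import structures.
From mathcomp Require Import all_boot all_order all_algebra.
From mathcomp Require Import all_classical all_reals all_analysis.

Set Implicit Arguments.
Unset Strict Implicit.
Unset Printing Implicit Defensive.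

Import Order.TTheory GRing.Theory Num.Theory.
Import numFieldNormedType.Exports.

Local Open Scope classical_set_scope.
Local Open Scope ring_scope.

Section independence.
Local Open Scope ereal_scope.
Context {d d1 d2 : measure_display} {T : measurableType d}
  {T1 : measurableType d1} {T2 : measurableType d2} {R : realType}
  (P : probability T R).

Definition independent_RV2 (U : T -> T1) (V : T -> T2) : Prop :=
  forall (A : set T1) (B : set T2), measurable A -> measurable B ->
    P ((U @^-1` A) `&` (V @^-1` B)) = P (U @^-1` A) * P (V @^-1` B).

Definition mutually_independent (n : nat) (U : 'I_n -> T -> T1) : Prop :=
  forall (J : {set 'I_n}) (A : 'I_n -> set T1),
    (forall i, measurable (A i)) ->
    P (\bigcap_(i in [set i | i \in J]) (U i @^-1` A i)) =
    \prod_(i in J) P (U i @^-1` A i).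

(* [phi \o U] is a version of E[xi | U], with xi integrable. *)
Definition is_cond_exp (U : T -> T1) (xi : T -> R) (phi : T1 -> R) : Prop :=
  [/\ P.-integrable [set: T] (EFin \o xi),
      measurable_fun [set: T1] phi,
      P.-integrable [set: T] (EFin \o (phi \o U)) &
      forall A : set T1, measurable A ->
        \int[P]_(w in U @^-1` A) (phi (U w))%:E =
        \int[P]_(w in U @^-1` A) (xi w)%:E].

End independence.

Section distances.
Local Open Scope ereal_scope.
Context {R : realType}.

(* Absolute continuity on every compact interval. *)
Definition absolutely_continuous (psi : R -> R) : Prop :=
  forall l r e : R, (0 < e)%R -> exists2 dl : R, (0 < dl)%R &
    forall (n : nat) (u v : 'I_n -> R),
      (forall i, l <= u i /\ u i <= v i /\ v i <= r)%R ->
      trivIset [set: 'I_n] (fun i => `]u i, v i[%classic) ->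
      (\sum_(i < n) (v i - u i) < dl)%R ->
      (\sum_(i < n) `|psi (v i) - psi (u i)| < e)%R.

(* Almost everywhere derivability follows from absolute continuity; it is
   spelled out because [derive1] is total, hence carries no information at the
   points where [psi] is not derivable. *)
Definition wass_test (psi : R -> R) : Prop :=
  [/\ absolutely_continuous psi,
      {ae @lebesgue_measure R, forall x, derivable psi x 1%R} &
      Lnorm (@lebesgue_measure R) +oo (EFin \o derive1 psi) <= 1].

Context {d d' : measure_display} {T : measurableType d} {T' : measurableType d'}
  {P : probability T R} {P' : probability T' R}.

Definition dKol (W : {RV P >-> R}) (Z : {RV P' >-> R}) : \bar R :=
  ereal_sup [set `|cdf W x - cdf Z x| | x in [set: R]].

Definition dWass (W : {RV P >-> R}) (Z : {RV P' >-> R}) : \bar R :=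
  ereal_sup [set `|'E_P[psi \o W] - 'E_P'[psi \o Z]| | psi in wass_test].

End distances.

Section resampling.
Context {R : realType} {N : nat}.

(* x^[k] = (x_1, ..., x_k, x'_(k+1), ..., x'_N), for 0 <= k <= N; the 1-based
   coordinate x_j is [tnth x] at the ordinal j - 1. *)
Definition interp (x x' : N.-tuple R) (k : nat) : N.-tuple R :=
  [tuple if (j < k)%N then tnth x j else tnth x' j | j < N].

(* x^(i): the i-th coordinate of x is replaced by that of x'. *)
Definition resample (x x' : N.-tuple R) (i : 'I_N) : N.-tuple R :=
  [tuple if j == i then tnth x' j else tnth x j | j < N].

(* u(x^[i]) - u(x^[i-1]) in 1-based indexing *)
Definition interp_diff (u : N.-tuple R -> R) (x x' : N.-tuple R)
    (i : 'I_N) : R :=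
  u (interp x x' i.+1) - u (interp x x' i).

(* u(x) - u(x^(i)) *)
Definition resample_diff (u : N.-tuple R -> R) (x x' : N.-tuple R)
    (i : 'I_N) : R :=
  u x - u (resample x x' i).

End resampling.

Section quantities.
Local Open Scope ereal_scope.
Context {R : realType} {N : nat} {d d' : measure_display}
  {T : measurableType d} {T' : measurableType d'}
  (P : probability T R) (Q : probability T' R)
  (X X' : T -> N.-tuple R) (Y : T' -> N.-tuple R)
  (f g : N.-tuple R -> R).

Let df i w := resample_diff f (X w) (X' w) i.
Let dg i w := resample_diff g (X w) (X' w) i.
Let If i w := interp_diff f (X w) (X' w) i.
Let h w : R := expR (g (X w)).

Definition weight_mean : R := fine 'E_P[h].
Let a := weight_mean.

(* [u := f] gives Delta_{1,i} and [u := g] gives Delta_{2,i}. *)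
Definition Delta_spec (u : N.-tuple R -> R) (i : 'I_N)
    (Delta : N.-tuple R -> R) : Prop :=
  exists2 c : N.-tuple R -> R,
    is_cond_exp P X (fun w => resample_diff u (X w) (X' w) i * If i w)%R c &
    forall x, Delta x = (2^-1 * c x)%R.

(* [D] plays the role of D_i^*. Symmetry covers the exchange of the vectors X and
   X' as well as the exchange of the single pair (X_i, X'_i), under which
   |f(X^[i]) - f(X^[i-1])| is invariant. The second does not follow from the
   first, and the Kolmogorov bound is false without it. *)
Definition sym_dominating (i : 'I_N)
    (D : N.-tuple R -> N.-tuple R -> R) : Prop :=
  [/\ measurable_fun [set: N.-tuple R * N.-tuple R] (fun p => D p.1 p.2),
      {ae P, forall w, D (X w) (X' w) = D (X' w) (X w)},
      {ae P, forall w, D (resample (X w) (X' w) i) (resample (X' w) (X w) i) =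
                       D (X w) (X' w)} &
      {ae P, forall w, (`|If i w| <= D (X w) (X' w))%R}].

Definition Tquant : \bar R :=
  (a^-1)%:E * \sum_(i < N)
    'E_P[fun w => (h w * expR `|dg i w| * dg i w ^+ 2 *
                   (`|dg i w| + `|df i w|) * `|If i w|)%R].

Definition delta1 : \bar R :=
  (a^-1)%:E * \sum_(i < N) 'E_P[fun w => (h w * df i w ^+ 2 * `|If i w|)%R]
  + Tquant.

(* [c i] is a version of E[D_i^*(X, X') (f(X) - f(X^(i))) | X]. *)
Definition delta1' (D : 'I_N -> N.-tuple R -> N.-tuple R -> R)
    (c : 'I_N -> N.-tuple R -> R) : \bar R :=
  (a^-1)%:E * \sum_(i < N)
    'E_P[fun w => (h w * expR `|dg i w| * D i (X w) (X' w) *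
                   `|df i w| * `|dg i w|)%R]
  + (a^-1)%:E * 'E_P[fun w => (h w * `|\sum_(i < N) c i (X w)|)%R]
  + Tquant.

Definition bquant (Delta1 : 'I_N -> N.-tuple R -> R) : R :=
  fine 'E_Q[fun w => (\sum_(i < N) Delta1 i (Y w))%R].

Definition delta2 (Delta1 : 'I_N -> N.-tuple R -> R) : \bar R :=
  sqrte 'V_Q[fun w => (\sum_(i < N) Delta1 i (Y w))%R].

Definition delta3 (b : R) (Delta2 : 'I_N -> N.-tuple R -> R) : \bar R :=
  sqrte 'V_Q[fun w =>
    (\sum_(i < N) Delta2 i (Y w) - (1 - b) * f (Y w))%R].

End quantities.

(* Main.v *)
(** Stein's method. Let [F] solve [F' x = x F x + psi x - E psi(Z)], write
    [h_c = logis c \o g] for a smooth bounded version of [h = exp g], and let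
    [f_K] be [f] clamped at level [K]. The increment [f_K(X) - f_K(X')]
    telescopes along the interpolations [X^[i]]; exchanging [X_i] and [X'_i]
    preserves the law of [(X, X')] and changes the sign of the [i]-th increment
    [I_i], so [E u(X) (f_K(X) - f_K(X'))] is half the sum of
    [E (u(X) - u(X^(i))) I_i]. With [u = h_c(X) F(f(X))] the product rule and the
    trapezoidal rule for [h_c], whose error is cubic in the increment of [g],
    produce [Delta_1] and [Delta_2] up to the quantity [T]. The case [F = 1]
    eliminates [E f_K(X')]. Letting [K], then [c], tend to infinity gives
    [E F(W)W = E F'(W) sum Delta_1 + E F(W) (sum Delta_2 - E sum Delta_2)] up to
    [T] and a Taylor remainder. Replacing [sum Delta_1] by its mean [b], and [sum Delta_2] minus
    its mean by [(1 - b) W], bounds [|b| |E (F(W)W - F'(W))|].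

    The remainder [F x - F y - F' x (x - y)] is quadratic for Lipschitz [psi].
    For the indicator of a half-line it is at most [(x - y) (M x - M y)] with [M]
    bounded and nondecreasing; since [D_i] is symmetric, one more exchange of
    [X_i] and [X'_i] turns this into [E M(f(X)) D_i (f(X) - f(X^(i)))]. *)

Require Import Defs.
From HB Require Import structures.
From mathcomp Require Import all_boot all_order all_algebra.
From mathcomp Require Import all_classical all_reals all_analysis.
From mathcomp Require Import measurable_realfun ess_sup_inf ring lra.

Import Order.TTheory GRing.Theory Num.Theory.
Import numFieldNormedType.Exports.

Local Open Scope classical_set_scope.
Local Open Scope ring_scope.

(** * Absolutely continuous test functions are Lipschitz *)

(** Integrability dictates the order of the limits. The hypotheses concern [h(X)], [h(X) f(X)],
    [h(X)] times the sums of [Delta_1] and [Delta_2], and the products [(f(X) - f(X^(i))) I_i] and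
    [(g(X) - g(X^(i))) I_i] without weight; integrability of [f(X)] is not assumed, nor that of
    [h(X)] times a single product. So a bounded weight stands for [h] until the conditional
    expectations have been taken, and since the derivatives of [logis c] that occur are bounded by
    [expR] uniformly in [c], the error terms survive the limit in [c]. The clamp acts on [f] only in
    the increments [I_i], never inside [F]. As [E f_K(X')] is not known to converge, it has to
    disappear before [K] grows: the case [F = 1], scaled by the weighted mean of [F], is subtracted.
    Because [E f(Y) = 0], what this leaves behind is exactly the product of means that centres
    [sum Delta_2], which is why a variance suffices in [delta_3]. Integrability of the integrand of
    [T] and of the Taylor remainders comes from finiteness of the bound itself; an infinite bound is
    trivial. *)

Section absolutely_continuous_lipschitz.
Context {R : realType}.
Implicit Types (psi : R -> R) (a b c e x y : R) (s : seq (R * R)).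

(** Listed from right to left: the argument below pushes the right endpoint [x] forward, and a new
    interval is then a cons. Only the intervals lie in [U]; the gaps between them are
    unconstrained. *)
Fixpoint interval_chain (U : set R) a x s : Prop :=
  if s is p :: s' then
    [/\ p.1 <= p.2, p.2 <= x, `]p.1, p.2[%classic `<=` U &
        interval_chain U a p.1 s']
  else a <= x.

Definition variation psi s := \sum_(p <- s) `|psi p.2 - psi p.1|.

Lemma interval_chain_le U a x y s :
  x <= y -> interval_chain U a x s -> interval_chain U a y s.
Proof.
case: s => [|p s] xy /=; first by move/le_trans; apply.
by case=> ? px ? ?; split=> //; exact: le_trans xy.
Qed.

Lemma interval_chain_ge U a x s : interval_chain U a x s -> a <= x.
Proof.
elim: s x => //= p s IH x [pp px _ /IH ap].
by rewrite (le_trans ap)// (le_trans pp).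
Qed.

Lemma interval_chain_mem U a x s (p : R * R) : interval_chain U a x s ->
  p \in s -> a <= p.1 /\ p.1 <= p.2 /\ p.2 <= x.
Proof.
elim: s x => //= q s IH x [qq qx _ cs]; rewrite inE => /predU1P[->|].
  by split=> //; exact: interval_chain_ge cs.
move=> /(IH _ cs)[? [? ?]]; do 2 split => //.
by rewrite (le_trans _ qx)// (le_trans _ qq).
Qed.

Lemma interval_chain_pairwise U a x s : interval_chain U a x s ->
  pairwise (fun p q : R * R => q.2 <= p.1) s.
Proof.
elim: s x => //= p s IH x [_ _ _ cs]; rewrite (IH _ cs) andbT.
by apply/allP => q /(interval_chain_mem _ _ _ _ _ cs)[_ []].
Qed.

Lemma interval_chain_measure U a x s : measurable U -> interval_chain U a x s ->
  ((\sum_(p <- s) (p.2 - p.1))%:E <=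
   lebesgue_measure (U `&` `]a, x[%classic))%E.
Proof.
move=> mU; elim: s x => /= [|p s IH] x; first by rewrite big_nil.
move=> [pp px pU cs]; rewrite big_cons EFinD.
have mI : measurable (U `&` `]a, p.1[%classic).
  by apply: measurableI => //; exact: measurable_itv.
rewrite (@le_trans _ _ (lebesgue_measure
   (`]p.1, p.2[%classic `|` (U `&` `]a, p.1[%classic))))//.
  rewrite measureU//=; last first.
  - apply/seteqP; split=> // z [+ [_]]; rewrite /= !in_itv/=.
    by move=> /andP[pz _] /andP[_ zp]; move: (lt_trans pz zp); rewrite ltxx.
  - apply: leeD; last exact: IH.
    rewrite lebesgue_measure_itv/= lte_fin; case: ltP => [_|p21].
      by rewrite EFinB.
    by rewrite (_ : p.2 - p.1 = 0)//; apply/eqP; rewrite subr_eq0 eq_le pp p21.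
have sub : ((`]p.1, p.2[ `|` (U `&` `]a, p.1[)) : set R) `<=` (U `&` `]a, x[).
  move=> z [zp|[Uz]].
    split; first exact: pU.
    move: zp; rewrite /= !in_itv/= => /andP[pz zp].
    by rewrite (le_lt_trans (interval_chain_ge _ _ _ _ cs) pz) (lt_le_trans zp px).
  rewrite /= !in_itv/= => /andP[az zp]; split => //.
  by rewrite az/= (lt_le_trans zp)// (le_trans pp px).
apply: le_measure; rewrite ?inE//.
- by apply: measurableU => //; exact: measurable_itv.
- by apply: measurableI => //; exact: measurable_itv.
Qed.

Lemma derivable_increment psi c e : derivable psi c 1 -> 0 < e ->
  exists2 r, 0 < r & forall y, `|y - c| < r ->
    `|psi y - psi c| <= (`|derive1 psi c| + e) * `|y - c|.
Proof.
move=> dc e0.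
have /cvgrPdist_lt/(_ _ e0)[r /= r0 Hr] :
    (fun h => h^-1 *: (psi (h *: 1 + c) - psi c)) @ 0^' --> derive1 psi c.
  by rewrite derive1E; exact: dc.
exists r => // y yc; have [->|ycn] := eqVneq y c.
  by rewrite !subrr normr0 mulr0.
have yc0 : y - c != 0 by rewrite subr_eq0.
have := Hr (y - c); rewrite /= sub0r normrN => /(_ yc yc0).
rewrite /GRing.scale/= mulr1 subrK => H.
rewrite -[X in `|X| <= _](mulVKf yc0) normrM mulrC ler_pM2r ?normr_gt0//.
rewrite -[X in `|X|](subrK (derive1 psi c)) (le_trans (ler_normD _ _))//.
by rewrite addrC lerD2l// distrC ltW.
Qed.

(** Continuation from [a] to [b], without integrating the derivative. The exceptional null set sits
    in an open [U] of measure below [dl]. Near a good point the slope is at most [M + e]; near an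
    exceptional one a whole interval of [U] enters the chain, and absolute continuity bounds the
    total variation over the chain by [e]. *)
Lemma absolutely_continuous_lipschitz psi (M : R) : 0 <= M ->
  absolutely_continuous psi ->
  {ae @lebesgue_measure R, forall x, derivable psi x 1 /\ `|derive1 psi x| <= M} ->
  forall x y, `|psi x - psi y| <= M * `|x - y|.
Proof.
move=> M0 ac [N [mN N0 subN]].
suff H a b : a <= b -> `|psi b - psi a| <= M * (b - a).
  move=> x y; wlog xy : x y / x <= y.
    by move=> W; have [/W//|/ltW/W] := leP x y; rewrite distrC (distrC y).
  by rewrite distrC (distrC x) (ger0_norm (_ : 0 <= y - x)) ?subr_ge0// H.
move=> ab; apply/ler_addgt0Pr => eps eps0.
(* Chosen so that [e * (b - a) + e = eps]. *)
pose e := eps / (b - a + 1).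
have ba1 : 0 < b - a + 1 by rewrite ltr_wpDl// subr_ge0.
have e0 : 0 < e by rewrite divr_gt0.
suff : `|psi b - psi a| <= (M + e) * (b - a) + e.
  move/le_trans; apply.
  rewrite mulrDl -addrA lerD2l -[X in _ + X <= _]mulr1 -mulrDr.
  by rewrite /e mulfVK// gt_eqF.
have [dl dl0 Hdl] := ac a b e e0.
have N0y : (lebesgue_measure N < +oo)%E by rewrite N0 ltry.
have [U [oU NU UN]] := lebesgue_regularity_outer mN N0y dl0.
have mU : measurable U by exact: open_measurable.
have Udl : (lebesgue_measure U < dl%:E)%E.
  rewrite -(setDUK NU) measureU//.
  - by rewrite [X in (X + _)%E](_ : _ = 0%E) ?add0e.
  - exact: measurableD.
  - by rewrite setDIK.
pose C : set R := [set x | a <= x <= b /\ exists2 s, interval_chain U a x s &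
  `|psi x - psi a| <= (M + e) * (x - a) + variation psi s].
(* One radius serves both to reach [c] from a point of [C] on its left and to go on to its right.
   Hence [sup C] lies in [C] if it equals [b], and is exceeded inside [C] otherwise. *)
have step c : exists2 r, 0 < r & forall x y, C x -> c - r < x -> x <= c ->
    c <= y -> y < c + r -> y <= b -> C y.
  have [Nc|Nc] := pselect (N c).
    have /nbhs_ballP[r /= r0 rU] : nbhs c U by apply: open_nbhs_nbhs; split=> //; exact: NU.
    exists r => // x y [/andP[ax xb] [s sc sV]] cx xc cy yc yb.
    have xy := le_trans xc cy.
    split; first by rewrite (le_trans ax xy).
    exists ((x, y) :: s).
      split => //= z /=; rewrite in_itv/= => /andP[xz zy]; apply: rU.
      by rewrite /ball/= ltr_distlC (lt_trans cx xz) (lt_trans zy yc).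
    rewrite /variation big_cons/= -/(variation psi s).
    rewrite -(subrKA (psi x)) (le_trans (ler_normD _ _))// addrCA lerD2l.
    rewrite (le_trans sV)// lerD2r ler_wpM2l ?addr_ge0 ?(ltW e0)// lerB//.
  have [dc pc] : derivable psi c 1 /\ `|derive1 psi c| <= M.
    by apply: contrapT => /subN.
  have [r r0 Hr] := derivable_increment psi c e dc e0.
  exists r => // x y [/andP[ax xb] [s sc sV]] cx xc cy yc yb.
  have xy := le_trans xc cy.
  split; first by rewrite (le_trans ax xy).
  exists s; first exact: interval_chain_le xy sc.
  have Hx : `|psi x - psi c| <= (M + e) * (c - x).
    rewrite (le_trans (Hr x _))//.
      by rewrite distrC ltr_distlC; apply/andP; split; lra.
    by rewrite distrC (ger0_norm (_ : 0 <= c - x)) ?subr_ge0// ler_wpM2r ?subr_ge0// lerD2r.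
  have Hy : `|psi y - psi c| <= (M + e) * (y - c).
    rewrite (le_trans (Hr y _))//.
      by rewrite distrC ltr_distlC; apply/andP; split; lra.
    by rewrite (ger0_norm (_ : 0 <= y - c)) ?subr_ge0// ler_wpM2r ?subr_ge0// lerD2r.
  have -> : psi y - psi a = (psi y - psi c) - (psi x - psi c) + (psi x - psi a).
    by ring.
  rewrite (le_trans (ler_normD _ _))// (le_trans (lerD (ler_normB _ _) (lexx _)))//.
  move: Hx Hy sV.
  have -> : (M + e) * (c - x) = (M + e) * (c - a) - (M + e) * (x - a) by ring.
  have -> : (M + e) * (y - c) = (M + e) * (y - a) - (M + e) * (c - a) by ring.
  lra.
have Ca : C a.
  split; first by rewrite lexx.
  by exists [::] => //=; rewrite /variation big_nil !subrr normr0 mulr0 addr0.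
have supC : has_sup C.
  by split; [exists a | exists b => x [/andP[]]].
pose c := sup C.
have cb : c <= b by apply: ge_sup; [exists a | move=> x [/andP[]]].
have ac' : a <= c by apply: ub_le_sup => //; case: supC.
have [r r0 Hr] := step c.
have [x Cx cx] := sup_adherent r0 supC.
have xc : x <= c by apply: ub_le_sup => //; case: supC.
have Cb : C b.
  have [<-|cnb] := eqVneq c b.
    by apply: (Hr x) => //; rewrite ltrDl.
  have cb' : c < b by rewrite lt_neqAle cnb.
  have : C (Num.min b (c + r / 2)).
    apply: (Hr x) => //.
    - by rewrite le_min cb lerDl divr_ge0// ltW.
    - by rewrite gt_min ltrD2l gtr_pMr// invf_lt1// ltr1n orbT.
    - by rewrite ge_min lexx.
  move/(ub_le_sup (proj2 supC)); rewrite -/c ge_min leNgt cb'/=.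
  by rewrite gerDl leNgt divr_gt0.
case: Cb => _ [s sc sV]; apply: (le_trans sV); rewrite lerD2l ltW//.
have szs (i : 'I_(size s)) : nth (0, 0) s i \in s by exact: mem_nth.
have -> : variation psi s = \sum_(i < size s)
    `|psi (nth (0, 0) s i).2 - psi (nth (0, 0) s i).1|.
  by rewrite /variation (big_nth (0, 0)) big_mkord.
apply: (Hdl _ (fun i => (nth (0, 0) s i).1) (fun i => (nth (0, 0) s i).2)).
- by move=> i; have [? [? ?]] := interval_chain_mem _ _ _ _ _ sc (szs i).
- have Hlt (i j : 'I_(size s)) z : (i < j)%N ->
      `](nth (0, 0) s i).1, (nth (0, 0) s i).2[%classic z ->
      `](nth (0, 0) s j).1, (nth (0, 0) s j).2[%classic z -> False.
    move=> ij /=; rewrite !in_itv/= => /andP[iz _] /andP[_ zj].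
    have /(pairwiseP (0, 0))/(_ i j) := interval_chain_pairwise _ _ _ _ sc.
    rewrite !inE => /(_ (ltn_ord _) (ltn_ord _) ij) /= ji.
    by move: (lt_le_trans (lt_trans iz zj) ji); rewrite ltxx.
  move=> i j _ _ [z [iz jz]]; apply/val_inj => /=.
  by have [/Hlt/(_ iz jz)|/Hlt/(_ jz iz)|] := ltngtP i j.
- have /= := interval_chain_measure _ _ _ _ mU sc.
  rewrite (big_nth (0, 0)) big_mkord => sumle.
  rewrite -lte_fin (le_lt_trans sumle)// (le_lt_trans _ Udl)//.
  by apply: le_measure; rewrite ?inE//; apply: measurableI => //; exact: measurable_itv.
Qed.

Lemma wass_test_lipschitz psi : wass_test psi ->
  forall x y, `|psi x - psi y| <= `|x - y|.
Proof.
(* The norm of exponent [+oo] unfolds to an essential supremum only when the whole space has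
   positive measure. *)
have mu0 : (0 < @lebesgue_measure R [set: R])%E.
  by rewrite -set_itvNyy lebesgue_measure_itv/= ltry.
move=> [ac dae]; rewrite unlock /= mu0.
move=> /ess_supP pae x y; rewrite -[leRHS]mul1r.
apply: absolutely_continuous_lipschitz => //.
move: dae pae; apply: filterS2; first exact: (ae_filter_ringOfSetsType (@lebesgue_measure R)).
by move=> z dz; rewrite /= lee_fin.
Qed.

End absolutely_continuous_lipschitz.

(** * Solutions of the Stein equation *)

Section calculus.
Context {R : realType}.
Implicit Types (f df D : R -> R) (a b x y : R).

Lemma is_derive_continuous f x v : is_derive x 1 f v -> {for x, continuous f}.
Proof.
by move=> [dfx _]; apply: differentiable_continuous; apply/derivable1_diffP.
Qed.

Lemma mean_value f df a b : a < b ->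
  (forall x, a <= x <= b -> is_derive x 1 f (df x)) ->
  exists2 c, a < c < b & f b - f a = df c * (b - a).
Proof.
move=> ab fdf.
have [c cab fab] : exists2 c, c \in `]a, b[%R & f b - f a = df c * (b - a).
  apply: MVT => //.
    by move=> x; rewrite in_itv/= => /andP[/ltW ax /ltW xb]; apply: fdf; rewrite ax.
  apply: continuous_in_subspaceT => x; rewrite inE/= in_itv/= => xab.
  exact: is_derive_continuous (fdf _ xab).
by exists c => //; rewrite in_itv/= in cab.
Qed.

Lemma derive_bounded_lipschitz f df (M : R) :
  (forall x, is_derive x 1 f (df x)) -> (forall x, `|df x| <= M) ->
  forall x y, `|f x - f y| <= M * `|x - y|.
Proof.
move=> fdf dfM x y; wlog xy : x y / y <= x.
  by move=> W; have [/W//|/ltW/W] := leP y x; rewrite distrC (distrC x y).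
have [->|ne] := eqVneq y x; first by rewrite !subrr normr0 mulr0.
have yx : y < x by rewrite lt_neqAle ne.
have [c _ ->] := mean_value f df y x yx (fun z _ => fdf z).
by rewrite normrM ler_wpM2r.
Qed.

Lemma derive_ge0_le f df a b : a <= b ->
  (forall x, a <= x <= b -> is_derive x 1 f (df x)) ->
  (forall x, a <= x <= b -> 0 <= df x) -> f a <= f b.
Proof.
move=> ab fdf df0; have [->//|ne] := eqVneq a b.
have ltab : a < b by rewrite lt_neqAle ne.
have [c /andP[ac cb] fab] := mean_value f df a b ltab fdf.
by rewrite -subr_ge0 fab mulr_ge0 ?subr_ge0// df0// (ltW ac) ltW.
Qed.

(** Comparison principle at [+oo]: two tail functions that both vanish there are ordered as soon as
    their derivatives are. Every bound on the Mills ratio below is an instance. *)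
Lemma derive_le0_cvg0_ge0 D dD a :
  (forall x, a <= x -> is_derive x 1 D (dD x)) ->
  (forall x, a <= x -> dD x <= 0) ->
  D x @[x --> +oo] --> 0 -> 0 <= D a.
Proof.
move=> DdD dD0 Dy; apply/ler_addgt0Pr => e e0; rewrite -lerBlDr sub0r.
move/cvgrPdist_lt : Dy => /(_ e e0)[M [_ HM]].
pose x := Num.max a (M + 1).
have ax : a <= x by rewrite le_max lexx.
have := HM x; rewrite /= sub0r normrN => /(_ _)/[!ltr_norml] H.
have /H/andP[Dx _] : M < x by rewrite lt_max ltrDl ltr01 orbT.
have : (- D) a <= (- D) x.
  apply: (@derive_ge0_le _ (fun z => - dD z)) => // z /andP[az _].
    by have := DdD z az => ?; exact: is_deriveN.
  by rewrite oppr_ge0 dD0.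
by rewrite /GRing.opp/= lerN2; apply: le_trans; exact: ltW.
Qed.

End calculus.

Section integral_rays.
Context {R : realType}.
Notation mu := (@lebesgue_measure R).

Lemma cvg_Rintegral_rays (u : R -> R) (A : nat -> set R) (B : set R) :
  mu.-integrable [set: R] (EFin \o u) ->
  (forall n, measurable (A n)) -> measurable B ->
  (forall x, \forall n \near \oo, A n x <-> B x) ->
  \int[mu]_(t in A n) u t @[n --> \oo] --> \int[mu]_(t in B) u t.
Proof.
move=> iu mA mB AB.
have mu' : measurable_fun [set: R] (EFin \o u) by case/integrableP : iu.
have mr C : measurable C -> measurable_fun [set: R] ((EFin \o u) \_ C).
  move=> mC; apply/(measurable_restrict _ mC measurableT).
  by rewrite setTI; exact: measurable_funS mu'.
have E (C : set R) : (\int[mu]_x ((EFin \o u) \_ C) x = \int[mu]_(t in C) (u t)%:E)%E.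
  by rewrite -integral_mkcond.
have [] := @dominated_convergence _ _ _ mu [set: R] measurableT
  (fun n => (EFin \o u) \_ (A n)) ((EFin \o u) \_ B) (abse \o (EFin \o u)).
- by move=> n; exact: mr.
- exact: mr.
- apply: aeW => /= x _; apply: cvg_near_cst.
  apply: filterS (AB x) => n ABx; rewrite !patchE.
  by rewrite (_ : (x \in A n) = (x \in B))//; apply/idP/idP; rewrite !inE => /ABx.
- exact: integrable_abse.
- apply: aeW => /= x n _; rewrite patchE; case: ifPn => //= _.
  by rewrite normr0 lee_fin.
have fB : (\int[mu]_(t in B) (u t)%:E)%E \is a fin_num.
  by apply: integrable_fin_num => //; exact: integrableS iu.
move=> _ _ H.
suff : (\int[mu]_(t in A n) (u t)%:E)%E @[n --> \oo] -->
    (fine (\int[mu]_(t in B) (u t)%:E)%E)%:E by move/fine_cvg.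
rewrite fineK// -E.
rewrite (_ : (fun n => \int[mu]_(t in A n) (u t)%:E)%E =
  (fun n => \int[mu]_x ((EFin \o u) \_ (A n)) x)%E)//.
by apply/funext => n; rewrite E.
Qed.

End integral_rays.

(** * The standard normal density *)

Section normal_density.
Context {R : realType}.
Notation mu := (@lebesgue_measure R).
Notation p := (@normal_pdf R 0 1).
Implicit Types (x t : R).

Lemma std_normal_pdfE x : p x = normal_peak 1 * expR (- (x ^+ 2 / 2)).
Proof.
by rewrite normal_pdfE ?oner_neq0// /normal_fun subr0 expr1n mulNr.
Qed.

Lemma std_normal_pdf_gt0 x : 0 < p x.
Proof. by rewrite std_normal_pdfE mulr_gt0 ?expR_gt0// normal_peak_gt0// oner_neq0. Qed.

Lemma std_normal_pdfN x : p (- x) = p x.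
Proof. by rewrite !std_normal_pdfE sqrrN. Qed.

Lemma is_derive_std_normal_pdf x : is_derive x 1 p (- x * p x).
Proof.
rewrite (_ : p = fun x => normal_peak 1 * expR (- (x ^+ 2 / 2))); last first.
  by apply/funext => y; exact: std_normal_pdfE.
have d : is_derive x 1 (fun x : R => - (x ^+ 2 / 2)) (- x).
  by apply: is_derive_eq; rewrite /GRing.scale/=; field.
apply: is_derive_eq; rewrite /GRing.scale/=; ring.
Qed.

Lemma cvg_std_normal_pdf : p x @[x --> +oo] --> 0.
Proof.
apply: (@squeeze_cvgr _ _ _ _ (cst 0) (fun x => normal_peak 1 * expR 1 * expR (- x))).
- near=> x; rewrite ltW ?std_normal_pdf_gt0//= std_normal_pdfE -mulrA -expRD.
  rewrite ler_wpM2l ?normal_peak_ge0// ler_expR.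
  have : 0 <= (x - 1) ^+ 2 by rewrite sqr_ge0.
  lra.
- exact: cvg_cst.
- rewrite -[X in _ --> X](mulr0 (normal_peak 1 * expR 1)).
  by apply: cvgM; [exact: cvg_cst|exact: cvgr_expR].
Unshelve. all: by end_near. Qed.

(** The linear factor is absorbed by the density of standard deviation 2: as
    [t^2 / 2 = t^2 / 8 + (3 / 8) t^2], it remains to see that [|t| + K] is at most
    [(2 + K) (1 + (3 / 8) t^2)], hence at most [2 + K] times the exponential of [(3 / 8) t^2]. *)
Lemma integrable_linear_std_normal_pdf (u : R -> R) (K : R) :
  measurable_fun [set: R] u -> (forall t, `|u t| <= `|t| + K) ->
  mu.-integrable [set: R] (fun t => (u t * p t)%:E).
Proof.
move=> mu' uK.
have K0 : 0 <= K by have := le_trans (normr_ge0 _) (uK 0); rewrite normr0 add0r.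
pose q := @normal_pdf R 0 2.
have qE x : q x = normal_peak 2 * expR (- (x ^+ 2 / 8)).
  rewrite /q normal_pdfE ?pnatr_eq0// /normal_fun subr0 mulNr.
  by congr (_ * expR (- (_ / _))); rewrite -natrX -mulrnA.
have pk2 : 0 < normal_peak (2 : R) by rewrite normal_peak_gt0// pnatr_eq0.
pose c := (2 + K) * normal_peak 1 / normal_peak (2 : R).
have iq : mu.-integrable [set: R] (fun t => (c * q t)%:E).
  exact: (integrableZl measurableT c (integrable_normal_pdf 0 2)).
apply: le_integrable iq => //.
  apply/measurable_EFinP; apply: measurable_funM => //.
  exact: measurable_normal_pdf.
move=> t _ /=; rewrite lee_fin normrM (ger0_norm (ltW (std_normal_pdf_gt0 t))).
rewrite (@ger0_norm _ (c * q t)); last first.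
  by rewrite !mulr_ge0 ?normal_pdf_ge0 ?invr_ge0 ?normal_peak_ge0 ?addr_ge0.
rewrite (le_trans (ler_wpM2r (ltW (std_normal_pdf_gt0 t)) (uK t)))//.
have -> : c * q t = (2 + K) * (normal_peak 1 * expR (- (t ^+ 2 / 8))).
  by rewrite qE /c; field; rewrite gt_eqF.
rewrite std_normal_pdfE mulrCA [leRHS]mulrCA ler_wpM2l ?normal_peak_ge0//.
have -> : - (t ^+ 2 / 2) = - (t ^+ 2 / 8) - (3 / 8) * t ^+ 2 by field.
rewrite expRD mulrCA [leRHS]mulrC ler_wpM2l ?expR_ge0//.
rewrite expRN ler_pdivrMr ?expR_gt0//.
have e1 := expR_ge1Dx ((3 / 8) * t ^+ 2).
have tt : `|t| <= (1 + t ^+ 2) / 2.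
  have : 0 <= (`|t| - 1) ^+ 2 by rewrite sqr_ge0.
  by rewrite sqrrB expr1n mulr1 real_normK ?num_real//; lra.
have t2 : 0 <= t ^+ 2 by rewrite sqr_ge0.
apply: (@le_trans _ _ ((2 + K) * (1 + 3 / 8 * t ^+ 2))); last first.
  by rewrite ler_wpM2l ?addr_ge0.
have : 0 <= K * t ^+ 2 by rewrite mulr_ge0.
lra.
Qed.

Lemma normal_integral_antiderivative (k : R -> R) : continuous k ->
  mu.-integrable [set: R] (fun t => (k t * p t)%:E) ->
  let Q x := \int[mu]_(t in `]-oo, x]) (k t * p t) in
  [/\ forall x, is_derive x 1 Q (k x * p x), Q x @[x --> -oo] --> 0 &
    Q x @[x --> +oo] --> \int[mu]_t (k t * p t)].
Proof.
move=> ck ik Q; split.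
- move=> x.
  have [|||| dQ <-] := @continuous_FTC1 R (fun t => k t * p t) -oo%O x (x + 1).
  + by rewrite ltrDl.
  + exact: integrableS ik.
  + by rewrite ltNyr.
  + apply: cvgM; first exact: ck.
    by apply: continuous_normal_pdf; rewrite oner_neq0.
  by rewrite derive1E; exact: derivableP.
- apply/cvg_ninftyP => u uNy.
  rewrite [X in _ --> X](_ : 0 = \int[mu]_(t in set0) (k t * p t)); last by rewrite Rintegral_set0.
  apply: (cvg_Rintegral_rays (fun t => k t * p t) (fun n => `]-oo, u n]%classic) set0 ik).
  + by move=> n; exact: measurable_itv.
  + exact: measurable0.
  + move=> x; move/cvgrNyPlt : uNy => /(_ x); apply: filterS => n unx; split => //.
    by rewrite /= in_itv/= => /(lt_le_trans unx); rewrite ltxx.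
- apply/cvg_pinftyP => u uy.
  apply: (cvg_Rintegral_rays (fun t => k t * p t) (fun n => `]-oo, u n]%classic) [set: R] ik).
  + by move=> n; exact: measurable_itv.
  + exact: measurableT.
  + move=> x; move/cvgryPge : uy => /(_ x); apply: filterS => n unx; split => //; rewrite /= in_itv/=.
Qed.

End normal_density.

(** * Bounds on the Mills ratio *)

Section mills_ratio.
Context {R : realType}.
Notation p := (@normal_pdf R 0 1).
Implicit Types (x t w : R).

Lemma is_derive_quotient (f g : R -> R) (df dg : R) x :
  is_derive x 1 f df -> is_derive x 1 g dg -> g x != 0 ->
  is_derive x 1 (fun t => f t / g t) ((df * g x - f x * dg) / g x ^+ 2).
Proof.
move=> hf hg gx; have hV := is_deriveV gx hg.
have := is_deriveM hf hV; rewrite /GRing.scale/= => H.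
by apply: is_derive_eq; field.
Qed.

Lemma is_derive_times_pdf (r : R -> R) (dr : R) x : is_derive x 1 r dr ->
  is_derive x 1 (fun t => r t * p t) ((dr - x * r x) * p x).
Proof.
move=> hr; have hp := is_derive_std_normal_pdf x.
have := is_deriveM hr hp; rewrite /GRing.scale/= => H.
by apply: is_derive_eq; ring.
Qed.

(** This is the Stein equation: an antiderivative of [u p], divided by [p], solves
    [F' = x F + u]. *)
Lemma is_derive_div_pdf (Q : R -> R) (u : R) x : is_derive x 1 Q (u * p x) ->
  is_derive x 1 (fun t => Q t / p t) (u + x * (Q x / p x)).
Proof.
move=> hQ; have p0 : p x != 0 by rewrite gt_eqF// std_normal_pdf_gt0.
have H := is_derive_quotient _ _ _ _ x hQ (is_derive_std_normal_pdf x) p0.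
by apply: is_derive_eq; field.
Qed.

Lemma cvg_bounded_times_pdf (r : R -> R) (B : R) : (forall x, 0 <= x -> `|r x| <= B) ->
  r x * p x @[x --> +oo] --> 0.
Proof.
move=> rB; apply: norm_cvg0.
apply: (@squeeze_cvgr _ _ _ _ (cst 0) (fun x => B * p x)).
- near=> x; rewrite normr_ge0/= normrM (gtr0_norm (std_normal_pdf_gt0 x)).
  by rewrite ler_wpM2r ?rB// ltW// std_normal_pdf_gt0.
- exact: cvg_cst.
- rewrite -[X in _ --> X](mulr0 B).
  by apply: cvgM; [exact: cvg_cst|exact: cvg_std_normal_pdf].
Unshelve. all: by end_near. Qed.

(** The upper Gaussian tail, known only through its derivative and its limit, so that the bounds
    apply equally to the reflected tail [1 - M (- w)]. *)
Variable M : R -> R.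
Hypothesis dM : forall x, is_derive x 1 M (- p x).
Hypothesis My : M x @[x --> +oo] --> 0.

Lemma mills_ge0 w : 0 <= M w.
Proof.
apply: (@derive_le0_cvg0_ge0 _ M (fun x => - p x)) => // x _.
by rewrite oppr_le0 ltW// std_normal_pdf_gt0.
Qed.

Lemma mills_mul_le w : w * M w <= p w.
Proof.
rewrite -subr_ge0.
(* The factor [w] stays frozen at the endpoint, so the derivative is [(w - t) p t]. *)
apply: (@derive_le0_cvg0_ge0 _ (fun t => p t - w * M t)
  (fun t => - t * p t - w * - p t)).
- move=> x _; by apply: is_deriveB; first exact: is_derive_std_normal_pdf.
- move=> x wx; rewrite -mulrN opprK mulNr addrC -mulrBl.
  by rewrite mulr_le0_ge0 ?subr_le0// ltW// std_normal_pdf_gt0.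
- rewrite [X in _ --> X](_ : 0 = 0 - w * 0); last by rewrite mulr0 subr0.
  apply: cvgB; first exact: cvg_std_normal_pdf.
  by apply: cvgM => //; exact: cvg_cst.
Qed.

(** Gordon's bound. It holds for [w] of either sign, and is used in that generality: it is the
    monotonicity of [w * F w] for the half-line solution. The difference [M - t / (1 + t^2) p] has
    derivative [- 2 / (1 + t^2)^2 p]. *)
Lemma mills_lower w : w * p w <= (1 + w ^+ 2) * M w.
Proof.
have pos x : 0 < 1 + x ^+ 2 by rewrite ltr_pwDl// sqr_ge0.
have e : (1 + w ^+ 2) * M w - w * p w = (1 + w ^+ 2) * (M w - w / (1 + w ^+ 2) * p w).
  by field; rewrite gt_eqF.
rewrite -subr_ge0 e pmulr_rge0//.
have dr x : is_derive x 1 (fun t => t / (1 + t ^+ 2)) ((1 - x ^+ 2) / (1 + x ^+ 2) ^+ 2).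
  have nz : 1 + x ^+ 2 != 0 by rewrite gt_eqF.
  have d2 : is_derive x 1 (fun t : R => 1 + t ^+ 2) (2 * x).
    by apply: is_derive_eq; rewrite /GRing.scale/=; ring.
  have H := is_derive_quotient _ _ _ _ x (is_derive_id x 1) d2 nz.
  by apply: is_derive_eq; field.
apply: (@derive_le0_cvg0_ge0 _ (fun t => M t - t / (1 + t ^+ 2) * p t)
  (fun t => - p t - ((1 - t ^+ 2) / (1 + t ^+ 2) ^+ 2 - t * (t / (1 + t ^+ 2))) * p t)).
- move=> x _; apply: is_deriveB => //; exact: is_derive_times_pdf.
- move=> x _.
  have -> : - p x - ((1 - x ^+ 2) / (1 + x ^+ 2) ^+ 2 - x * (x / (1 + x ^+ 2))) * p x
      = - (2 / (1 + x ^+ 2) ^+ 2 * p x).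
    by field; rewrite gt_eqF.
  by rewrite oppr_le0 mulr_ge0 ?divr_ge0 ?sqr_ge0// ltW// std_normal_pdf_gt0.
- rewrite -[X in _ --> X](subrr 0); apply: cvgB => //.
  apply: (@cvg_bounded_times_pdf _ 1) => x x0.
  rewrite ger0_norm ?divr_ge0 ?(ltW (pos x))// ler_pdivrMr// mul1r.
  have : 0 <= (x - 1) ^+ 2 by rewrite sqr_ge0.
  rewrite sqrrB expr1n mulr1; lra.
Qed.

(** Another form is [(1 + w) ((1 + w^2) M - w p) <= 3 p]: the gap left by [mills_lower] decays like
    [1 / (1 + w)], just enough to absorb the linear growth of a Lipschitz function. With the
    constant 3 the derivative to be signed has a numerator with positive coefficients only. *)
Lemma mills_upper w : 0 <= w ->
  (1 + w) * (1 + w ^+ 2) * M w <= (w ^+ 2 + w + 3) * p w.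
Proof.
have pos x : 0 <= x -> 0 < (1 + x) * (1 + x ^+ 2).
  by move=> x0; rewrite mulr_gt0// ltr_pwDl// sqr_ge0.
move=> w0.
have e : (w ^+ 2 + w + 3) * p w - (1 + w) * (1 + w ^+ 2) * M w =
    (1 + w) * (1 + w ^+ 2) *
    ((w ^+ 2 + w + 3) / ((1 + w) * (1 + w ^+ 2)) * p w - M w).
  by field; rewrite andbC -negb_or -mulf_eq0 gt_eqF ?pos//.
rewrite -subr_ge0 e pmulr_rge0 ?pos//.
pose D t : R := (1 + t) * (1 + t ^+ 2).
pose r t : R := (t ^+ 2 + t + 3) / D t.
have dr x : 0 <= x -> is_derive x 1 r
    (((2 * x + 1) * D x - (x ^+ 2 + x + 3) * (1 + 2 * x + 3 * x ^+ 2)) / D x ^+ 2).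
  move=> x0; have nz : D x != 0 by rewrite gt_eqF// pos.
  have d1 : is_derive x 1 (fun t : R => t ^+ 2 + t + 3) (2 * x + 1).
    by apply: is_derive_eq; rewrite /GRing.scale/=; ring.
  have d2 : is_derive x 1 D (1 + 2 * x + 3 * x ^+ 2).
    by apply: is_derive_eq; rewrite /GRing.scale/=; ring.
  exact: is_derive_quotient d1 d2 nz.
apply: (@derive_le0_cvg0_ge0 _ (fun t => r t * p t - M t)
  (fun x => (((2 * x + 1) * D x - (x ^+ 2 + x + 3) * (1 + 2 * x + 3 * x ^+ 2))
      / D x ^+ 2 - x * r x) * p x - - p x)).
- move=> x wx; have x0 := le_trans w0 wx; apply: is_deriveB => //.
  by apply: is_derive_times_pdf; exact: dr.
- move=> x wx; have x0 := le_trans w0 wx.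
  have -> : (((2 * x + 1) * D x - (x ^+ 2 + x + 3) * (1 + 2 * x + 3 * x ^+ 2))
      / D x ^+ 2 - x * r x) * p x - - p x =
     - ((1 + 5 * x + 10 * x ^+ 2 + 3 * x ^+ 3 + 3 * x ^+ 4) / D x ^+ 2 * p x).
    by rewrite /r /D; field; rewrite andbC -negb_or -mulf_eq0 gt_eqF ?pos.
  rewrite oppr_le0 mulr_ge0 ?(ltW (std_normal_pdf_gt0 _))// divr_ge0 ?sqr_ge0//.
  by rewrite !addr_ge0 ?mulr_ge0 ?exprn_ge0.
- rewrite -[X in _ --> X](subrr 0); apply: cvgB => //.
  apply: (@cvg_bounded_times_pdf _ 3) => x x0.
  rewrite ger0_norm; last by rewrite divr_ge0 ?(ltW (pos x x0))// !addr_ge0 ?sqr_ge0.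
  rewrite ler_pdivrMr ?pos// /D.
  have x2 : 0 <= x ^+ 2 by rewrite sqr_ge0.
  have x3 : 0 <= x ^+ 2 * x by rewrite mulr_ge0.
  nra.
Qed.

Lemma mills_ratio_le3 w : 0 <= w -> M w <= 3 * p w.
Proof.
move=> w0; have H := mills_upper w w0.
have pos : 0 < (1 + w) * (1 + w ^+ 2) by rewrite mulr_gt0// ltr_pwDl// sqr_ge0.
rewrite -(ler_pM2l pos) (le_trans H)// mulrA ler_wpM2r ?(ltW (std_normal_pdf_gt0 _))//.
have x2 : 0 <= w ^+ 2 by rewrite sqr_ge0.
have x3 : 0 <= w ^+ 2 * w by rewrite mulr_ge0.
nra.
Qed.

(* Freezing the 1-Lipschitz [k] at [w] traps it between two affine functions,
   whose Gaussian tail integrals are explicit in [M] and [p]. *)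
Lemma lipschitz_tail_bounds (k q : R -> R) w :
  (forall x y, `|k x - k y| <= `|x - y|) ->
  (forall x, is_derive x 1 q (- (k x * p x))) -> q x @[x --> +oo] --> 0 ->
  `|q w - k w * M w| <= p w - w * M w.
Proof.
move=> kL dq qy.
have kw t : w <= t -> `|k t - k w| <= t - w.
  by move=> wt; rewrite (le_trans (kL _ _))// ger0_norm// subr_ge0.
rewrite ler_norml; apply/andP; split.
- rewrite -subr_ge0.
  have -> : q w - k w * M w - - (p w - w * M w) = q w - ((k w + w) * M w - p w) by ring.
  apply: (@derive_le0_cvg0_ge0 _ (fun t => q t - ((k w + w) * M t - p t))
    (fun t => - (k t * p t) - ((k w + w) * - p t - - t * p t))).
  + move=> x _; apply: is_deriveB => //; apply: is_deriveB. exact: is_derive_std_normal_pdf.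
  + move=> x wx; move: (kw x wx); rewrite ler_norml => /andP[+ _].
    have -> : - (k x * p x) - ((k w + w) * - p x - - x * p x) =
      (k w - k x + w - x) * p x by ring.
    move=> ?; rewrite mulr_le0_ge0 ?(ltW (std_normal_pdf_gt0 _))//; lra.
  + rewrite -[X in _ --> X](subrr 0); apply: cvgB => //.
    rewrite [X in _ --> X](_ : 0 = (k w + w) * 0 - 0); last by rewrite mulr0 subr0.
    apply: cvgB.
      by apply: cvgM => //; exact: cvg_cst.
    exact: cvg_std_normal_pdf.
- rewrite -subr_ge0.
  have -> : p w - w * M w - (q w - k w * M w) = (k w - w) * M w + p w - q w by ring.
  apply: (@derive_le0_cvg0_ge0 _ (fun t => (k w - w) * M t + p t - q t)
    (fun t => (k w - w) * - p t + - t * p t - - (k t * p t))).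
  + move=> x _; apply: is_deriveB => //; apply: is_deriveD. exact: is_derive_std_normal_pdf.
  + move=> x wx; move: (kw x wx); rewrite ler_norml => /andP[_].
    have -> : (k w - w) * - p x + - x * p x - - (k x * p x) =
      (k x - k w + w - x) * p x by ring.
    move=> ?; rewrite mulr_le0_ge0 ?(ltW (std_normal_pdf_gt0 _))//; lra.
  + rewrite -[X in _ --> X](subrr 0); apply: cvgB => //.
    rewrite [X in _ --> X](_ : 0 = (k w - w) * 0 + 0); last by rewrite mulr0 addr0.
    apply: cvgD.
      by apply: cvgM => //; exact: cvg_cst.
    exact: cvg_std_normal_pdf.
Qed.

(** For the Stein solution [F = - q / p] the three quantities are [F], [F'] and the derivative of
    [w F]. The last one equals [F''] minus [k'], and so makes sense for [k] merely Lipschitz. *)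
Lemma stein_half_line_bounds (k q : R -> R) (K w : R) :
  (forall x y, `|k x - k y| <= `|x - y|) -> (forall x, `|k x| <= `|x| + K) ->
  (forall x, is_derive x 1 q (- (k x * p x))) -> q x @[x --> +oo] --> 0 ->
  0 <= w -> 0 <= K ->
  let F := - (q w / p w) in
  [/\ `|F| <= 4 + 3 * K, `|w * F + k w| <= 4 + 3 * K &
      `|(1 + w ^+ 2) * F + w * k w| <= 4 + 3 * K].
Proof.
move=> kL kK dq qy w0 K0 F.
have p0 := std_normal_pdf_gt0 w.
have kw : `|k w| <= w + K by rewrite (le_trans (kK w))// ger0_norm.
have [m mE] : exists m, M w = m * p w by exists (M w / p w); rewrite divfK// gt_eqF.
have FE : q w = - F * p w by rewrite /F opprK divfK// gt_eqF.
move: F FE => F FE.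
have := lipschitz_tail_bounds k q w kL dq qy.
have := mills_lower w; have := mills_upper w w0.
have := mills_ratio_le3 w w0; have := mills_mul_le w; have := mills_ge0 w.
rewrite FE mE.
rewrite pmulr_lge0// => m0.
rewrite mulrA -[X in _ <= X -> _]mul1r ler_pM2r// => wm1.
rewrite ler_pM2r// => m3.
rewrite !mulrA !ler_pM2r// => mup mlo.
have -> : - F * p w - k w * m * p w = - (F + k w * m) * p w by ring.
have -> : p w - w * m * p w = (1 - w * m) * p w by ring.
rewrite normrM normrN (gtr0_norm p0) ler_pM2r//.
(* [s] is the error of freezing [k] at [w], of modulus at most [be]. The growth [w + K] of [k] is
   paid for by [(1 + w ^+ 2) * be <= 1] and, for the gap [e] of [mills_lower], by
   [(1 + w) * e <= 3]. The third bound fixes the constant: 1 comes from [s] and [3 + 3 * K] from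
   [e]. *)
set s := F + k w * m; set be := 1 - w * m => sb.
have be0 : 0 <= be by rewrite subr_ge0.
have be1 : (1 + w ^+ 2) * be <= 1.
  have -> : (1 + w ^+ 2) * be = 1 + w ^+ 2 - w * ((1 + w ^+ 2) * m) by rewrite /be; ring.
  have := ler_wpM2l w0 mlo; rewrite -expr2; lra.
set e := (1 + w ^+ 2) * m - w.
have e0 : 0 <= e by rewrite subr_ge0.
have we : (1 + w) * e <= 3.
  have -> : (1 + w) * e = (1 + w) * (1 + w ^+ 2) * m - (1 + w) * w by rewrite /e; ring.
  by rewrite lerBlDr (le_trans mup)//; lra.
have w2 : 0 <= w ^+ 2 by rewrite sqr_ge0.
have bel : be <= 1 by rewrite gerBl mulr_ge0.
have Km : K * m <= 3 * K by rewrite mulrC ler_wpM2r.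
have Kbe : K * be <= K by rewrite ler_piMr.
have wmge : 0 <= w * m by rewrite mulr_ge0.
split.
- have -> : F = s - k w * m by rewrite /s; ring.
  rewrite (le_trans (ler_normB _ _))// normrM (ger0_norm m0).
  have : `|k w| * m <= (w + K) * m by rewrite ler_wpM2r.
  rewrite mulrDl => ?; rewrite /be in sb *; lra.
- have -> : w * F + k w = w * s + k w * be by rewrite /s /be; ring.
  rewrite (le_trans (ler_normD _ _))// !normrM (ger0_norm w0) (ger0_norm be0).
  have h1 : w * `|s| <= w * be by rewrite ler_wpM2l.
  have : `|k w| * be <= (w + K) * be by rewrite ler_wpM2r.
  have : 0 <= (1 - w) ^+ 2 * be by rewrite mulr_ge0// sqr_ge0.
  have -> : (1 - w) ^+ 2 * be = (1 + w ^+ 2) * be - 2 * (w * be) by ring.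
  rewrite mulrDl => ? ?; lra.
- have -> : (1 + w ^+ 2) * F + w * k w = (1 + w ^+ 2) * s - k w * e.
    by rewrite /s /e; ring.
  rewrite (le_trans (ler_normB _ _))// !normrM (ger0_norm e0).
  rewrite (ger0_norm (_ : 0 <= 1 + w ^+ 2)) ?addr_ge0//.
  have h1 : (1 + w ^+ 2) * `|s| <= (1 + w ^+ 2) * be by rewrite ler_wpM2l// addr_ge0.
  have h2 : `|k w| * e <= (w + K) * e by rewrite ler_wpM2r.
  have h3 : K * e <= K * 3.
    rewrite ler_wpM2l// (le_trans _ we)// ler_peMl// lerDl//.
  have : (w + K) * e = (1 + w) * e + K * e - e by ring.
  lra.
Qed.

End mills_ratio.

(** * Stein solutions for Lipschitz test functions *)

Section stein_equation.
Context {R : realType}.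
Notation mu := (@lebesgue_measure R).
Implicit Types (x y t w z : R).
Notation p := (@normal_pdf R 0 1).

Lemma lipschitz_continuous (k : R -> R) (L : R) :
  (forall x y, `|k x - k y| <= L * `|x - y|) -> continuous k.
Proof.
move=> kL x; apply/cvgrPdist_lt => e e0.
have L1 : 0 < `|L| + 1 by rewrite ltr_wpDl.
near=> y; rewrite (le_lt_trans (kL x y))//.
rewrite (@le_lt_trans _ _ ((`|L| + 1) * `|x - y|))//.
  by rewrite ler_wpM2r// (le_trans (ler_norm _))// lerDl.
rewrite mulrC -ltr_pdivlMr//; near: y.
by apply/nbhs_ballP; exists (e / (`|L| + 1)); rewrite /= ?divr_gt0.
Unshelve. all: by end_near. Qed.

Lemma is_derive_reflect (f : R -> R) (df x : R) : is_derive (- x) 1 f df ->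
  is_derive x 1 (fun t => f (- t)) (- df).
Proof.
move=> hf; have hN : is_derive x 1 (fun t : R => - t) (-1).
  by apply: is_derive_eq.
have := @is_derive1_comp _ f (fun t : R => - t) x _ _ hf hN.
by rewrite mulrN1.
Qed.

Lemma std_normal_tail_antiderivative :
  let M x := 1 - \int[mu]_(t in `]-oo, x]) p t in
  [/\ forall x : R, is_derive x 1 M (- p x), M x @[x --> +oo] --> 0 &
      M x @[x --> -oo] --> (1 : R)].
Proof.
have i1 : mu.-integrable [set: R] (fun t => (1 * p t)%:E).
  by under eq_fun do rewrite mul1r; exact: integrable_normal_pdf.
pose Q x := \int[mu]_(t in `]-oo, x]) (1 * p t).
have [dQ QNy Qy] : [/\ forall x, is_derive x 1 Q (1 * p x), Q x @[x --> -oo] --> 0 &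
    Q x @[x --> +oo] --> \int[mu]_t (1 * p t)].
  exact: (normal_integral_antiderivative (cst 1) (fun=> cvg_cst _) i1).
have I1 : \int[mu]_t (1 * p t) = 1.
  under eq_Rintegral do rewrite mul1r.
  by rewrite /Rintegral integral_normal_pdf.
move=> M; have -> : M = fun x => 1 - Q x.
  by apply/funext => x; rewrite /Q; under [in RHS]eq_Rintegral do rewrite mul1r.
split.
- move=> x; have := dQ x; rewrite mul1r => ?.
  by apply: is_derive_eq; rewrite add0r mul1r.
- rewrite [X in _ --> X](_ : 0 = 1 - 1); last by rewrite subrr.
  by apply: cvgB; [exact: cvg_cst|rewrite -[X in _ --> X]I1].
- rewrite [X in _ --> X](_ : 1 = 1 - 0); last by rewrite subr0.
  by apply: cvgB; [exact: cvg_cst|].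
Qed.

(** As [Q] vanishes at both ends, that is, as [k] is centred, [- Q] is a tail integral to the right
    and [Q] becomes one under reflection. The negative half-line thus reduces to the positive one
    with [k] composed with the sign change. *)
Lemma stein_solution_bounds (M k Q : R -> R) (K w : R) :
  (forall x, is_derive x 1 M (- p x)) -> M x @[x --> +oo] --> 0 ->
  (forall x y, `|k x - k y| <= `|x - y|) -> (forall x, `|k x| <= `|x| + K) ->
  (forall x, is_derive x 1 Q (k x * p x)) ->
  Q x @[x --> -oo] --> 0 -> Q x @[x --> +oo] --> 0 -> 0 <= K ->
  let F := Q w / p w in
  [/\ `|F| <= 4 + 3 * K, `|w * F + k w| <= 4 + 3 * K &
      `|(1 + w ^+ 2) * F + w * k w| <= 4 + 3 * K].
Proof.
move=> dM My kL kK dQ QNy Qy K0 F.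
have [w0|/ltW w0] := leP 0 w.
  have dq x : is_derive x 1 (fun t => - Q t) (- (k x * p x)).
    by have := dQ x => ?; apply: is_deriveN.
  have qy : - Q x @[x --> +oo] --> 0.
    by rewrite [X in _ --> X](_ : 0 = - 0); [exact: cvgN|rewrite oppr0].
  have := stein_half_line_bounds M dM My k _ K w kL kK dq qy w0 K0.
  by rewrite mulNr opprK.
have kL' x y : `|k (- x) - k (- y)| <= `|x - y|.
  by rewrite (le_trans (kL _ _))// opprK addrC distrC.
have kK' x : `|k (- x)| <= `|x| + K by rewrite (le_trans (kK _))// normrN.
have dq x : is_derive x 1 (fun t => Q (- t)) (- (k (- x) * p x)).
  by apply: is_derive_reflect; rewrite -std_normal_pdfN.
have qy : Q (- x) @[x --> +oo] --> 0 by apply/cvgNy_compNP.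
have w0' : 0 <= - w by rewrite oppr_ge0.
have := stein_half_line_bounds M dM My (fun t => k (- t)) _ K (- w) kL' kK' dq qy w0' K0.
rewrite /= !opprK std_normal_pdfN -/F normrN sqrrN mulrNN mulrN mulNr -opprD.
by rewrite normrN.
Qed.

(* [m] is the normal mean of [psi]. *)
Lemma stein_lipschitz : exists2 A : R, 0 < A & forall psi : R -> R,
  (forall x y, `|psi x - psi y| <= `|x - y|) ->
  exists F F1 : R -> R, [/\ continuous F, continuous F1,
    forall x, `|F x| <= A /\ `|F1 x| <= A,
    forall x y, `|F x - F y| <= A * `|x - y| /\
      `|F x - F y - F1 x * (x - y)| <= A * (x - y) ^+ 2 &
    forall x, F1 x = x * F x + (psi x - \int[mu]_t (psi t * p t))].
Proof.
have iabs : mu.-integrable [set: R] (fun t => (`|t| * p t)%:E).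
  apply: (integrable_linear_std_normal_pdf _ 0) => [|t].
    exact: normr_measurable.
  by rewrite normr_id addr0.
pose K := \int[mu]_t (`|t| * p t).
have K0 : 0 <= K.
  by apply: Rintegral_ge0 => t _; rewrite mulr_ge0// normal_pdf_ge0.
(* [K] is the first absolute normal moment. The derivative of [x * F x] is bounded by [4 + 3 * K],
   and the Lipschitz constant of [k] adds one. *)
exists (5 + 3 * K) => [|psi psiL]; first by rewrite ltr_wpDr// mulr_ge0.
have psic : continuous psi.
  by apply: (lipschitz_continuous _ 1) => x y; rewrite mul1r.
have mpsi : measurable_fun [set: R] psi by exact: continuous_measurable_fun.
have ip (u : R -> R) c : measurable_fun [set: R] u ->
    (forall x y, `|u x - u y| <= `|x - y|) ->
    mu.-integrable [set: R] (fun t => ((u t + c) * p t)%:E).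
  move=> mu' uL; apply: (integrable_linear_std_normal_pdf _ (`|u 0 + c|)) => [|t].
    exact: measurable_funD.
  have -> : u t + c = (u t - u 0) + (u 0 + c) by ring.
  by rewrite (le_trans (ler_normD _ _))// lerD2r -[X in _ <= `|X|]subr0.
have ipsi : mu.-integrable [set: R] (fun t => (psi t * p t)%:E).
  by have := ip psi 0 mpsi psiL; under eq_fun do rewrite addr0.
have I1 : \int[mu]_t p t = 1 by rewrite /Rintegral integral_normal_pdf.
have i1 := integrable_normal_pdf (0 : R) 1.
pose m := \int[mu]_t (psi t * p t).
pose k t := psi t - m.
have kL x y : `|k x - k y| <= `|x - y|.
  by rewrite /k opprB addrA subrK.
have ik : mu.-integrable [set: R] (fun t => (k t * p t)%:E) by exact: ip.
have Ik : \int[mu]_t (k t * p t) = 0.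
  under eq_Rintegral do rewrite /k mulrBl.
  rewrite RintegralB//; last exact: (integrableZl measurableT m i1).
  by rewrite RintegralZl// I1 mulr1 subrr.
(* [k x] is the normal mean of [psi x - psi t], whose modulus is at most [|x| + |t|]. *)
have kK x : `|k x| <= `|x| + K.
  have ipx : mu.-integrable [set: R] (fun t => (psi x * p t)%:E).
    exact: (integrableZl measurableT (psi x) i1).
  have ixp : mu.-integrable [set: R] (fun t => (`|x| * p t)%:E).
    exact: (integrableZl measurableT `|x| i1).
  have -> : k x = \int[mu]_t (psi x * p t - psi t * p t).
    by rewrite RintegralB// RintegralZl// I1 mulr1.
  have id : mu.-integrable [set: R] (EFin \o (fun t => psi x * p t - psi t * p t)).
    exact: (integrableB measurableT ipx ipsi).
  rewrite (le_trans (le_normr_Rintegral measurableT id))//.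
  rewrite (_ : `|x| + K = \int[mu]_t (`|x| * p t + `|t| * p t)); last first.
    by rewrite RintegralD// RintegralZl// I1 mulr1.
  apply: le_Rintegral => //.
  - exact: integrable_norm.
  - exact: (integrableD measurableT ixp iabs).
  - move=> t _; rewrite -mulrBl -mulrDl normrM (ger0_norm (normal_pdf_ge0 _ _ _)).
    by rewrite ler_wpM2r ?normal_pdf_ge0// (le_trans (psiL _ _))// ler_normB.
have kc : continuous k by move=> x; apply: cvgB; [exact: psic|exact: cvg_cst].
pose Q x := \int[mu]_(t in `]-oo, x]) (k t * p t).
have [dQ QNy Qy] : [/\ forall x, is_derive x 1 Q (k x * p x), Q x @[x --> -oo] --> 0 &
    Q x @[x --> +oo] --> \int[mu]_t (k t * p t)].
  exact: normal_integral_antiderivative.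
rewrite Ik in Qy.
have [dM My _] := std_normal_tail_antiderivative.
have B w := stein_solution_bounds _ k Q K w dM My kL kK dQ QNy Qy K0.
pose F x := Q x / p x.
pose F1 x := x * F x + k x.
have dF x : is_derive x 1 F (F1 x).
  by have := is_derive_div_pdf Q (k x) x (dQ x); rewrite addrC.
have dV x : is_derive x 1 (fun t => t * F t) ((1 + x ^+ 2) * F x + x * k x).
  have := dF x => dFx; apply: is_derive_eq; rewrite /GRing.scale/= /F1; ring.
have Fc : continuous F by move=> x; exact: is_derive_continuous (dF x).
have K43 : 4 + 3 * K <= 5 + 3 * K by rewrite lerD2r ler_nat.
exists F, F1; split => //.
- move=> x; apply: cvgD; last exact: kc.
  by apply: cvgM => //; exact: Fc.
- by move=> x; have [b1 b2 _] := B x; split; apply: le_trans K43.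
- move=> x y; split.
    apply: (derive_bounded_lipschitz F F1) => // z.
    by have [_ b _] := B z; apply: le_trans K43.
  (* [k] is only Lipschitz, so [F1] is split into [x * F x], whose derivative is bounded, and
     [k]. *)
  have F1L u v : `|F1 u - F1 v| <= (5 + 3 * K) * `|u - v|.
    have -> : F1 u - F1 v = (u * F u - v * F v) + (k u - k v) by rewrite /F1; ring.
    rewrite (le_trans (ler_normD _ _))//.
    have -> : 5 + 3 * K = (4 + 3 * K) + 1 by ring.
    rewrite mulrDl mul1r lerD//.
    apply: (derive_bounded_lipschitz _ _ _ dV) => z.
    by have [_ _ b] := B z.
  have [->|xy] := eqVneq x y; first by rewrite !subrr mulr0 subr0 normr0 expr0n mulr0.
  have [c cxy Fc'] : exists2 c, `|c - x| <= `|x - y| & F x - F y = F1 c * (x - y).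
    have [ltxy|ltyx|//] := ltgtP x y; last by move: xy => /eqP.
    - have [c /andP[xc cy] e] := mean_value F F1 x y ltxy (fun z _ => dF z).
      exists c; last by rewrite -opprB e; ring.
      rewrite gtr0_norm ?subr_gt0// ltr0_norm ?subr_lt0//; lra.
    - have [c /andP[xc cy] e] := mean_value F F1 y x ltyx (fun z _ => dF z).
      exists c => //.
      rewrite ltr0_norm ?subr_lt0// gtr0_norm ?subr_gt0//; lra.
  rewrite Fc' -mulrBl normrM (le_trans (ler_wpM2r (normr_ge0 _) (F1L c x)))//.
  rewrite -mulrA ler_wpM2l ?addr_ge0 ?mulr_ge0//.
  by rewrite -[leRHS]real_normK ?num_real// expr2 ler_wpM2r.
Qed.

End stein_equation.

(** * The Stein solution for the indicator of a half-line *)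

Section stein_indicator.
Context {R : realType}.
Implicit Types (x y t w z a b : R).
Notation mu := (@lebesgue_measure R).
Notation p := (@normal_pdf R 0 1).

Let M x := 1 - \int[mu]_(t in `]-oo, x]) p t.

Let dM x : is_derive x 1 M (- p x).
Proof. by have [d _ _] := @std_normal_tail_antiderivative R; exact: d. Qed.

Let My : M x @[x --> +oo] --> 0.
Proof. by have [_ d _] := @std_normal_tail_antiderivative R; exact: d. Qed.

(* By symmetry [M2 w] is again the upper tail [M w]; this is its form at [- w]. *)
Let M2 w := 1 - M (- w).

Let dM2 x : is_derive x 1 M2 (- p x).
Proof.
have := is_derive_reflect M _ x (dM (- x)); rewrite opprK std_normal_pdfN => ?.
by apply: is_derive_eq; ring.
Qed.

Let M2y : M2 x @[x --> +oo] --> 0.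
Proof.
rewrite [X in _ --> X](_ : 0 = 1 - 1); last by rewrite subrr.
apply: cvgB; first exact: cvg_cst.
have [_ _ d] := @std_normal_tail_antiderivative R.
by move/cvgNy_compNP : d.
Qed.

Let M_ge0 w : 0 <= M w. Proof. exact: (mills_ge0 M dM My). Qed.

Let M_le1 w : 0 <= 1 - M w.
Proof. by have := mills_ge0 M2 dM2 M2y (- w); rewrite /M2 opprK. Qed.

Let M_nincr a b : a <= b -> M b <= M a.
Proof.
move=> ab; rewrite -lerN2.
apply: (@derive_ge0_le _ (fun x => - M x) (fun x => - - p x)) => // x _.
  by have := dM x => ?; apply: is_deriveN.
by rewrite opprK ltW// std_normal_pdf_gt0.
Qed.

(** [F1] jumps at [z], so the remainder is measured by increments of [G w = w * F w] and of [H]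
    instead of a square. Explicitly [F] is [(1 - M) * M z / p] to the left of [z] and
    [(1 - M z) * M / p] to the right; that [G] increases is [mills_lower], for [M] on the right and
    for the reflected tail on the left. *)
Lemma stein_indicator z :
  let H w : R := (w <= z)%R%:R in
  exists F F1 : R -> R,
  [/\ measurable_fun [set: R] F, measurable_fun [set: R] F1,
    forall x, [/\ `|F x| <= 3, `|F1 x| <= 2 & `|x * F x| <= 1],
    forall x y, x <= y -> x * F x <= y * F y &
    [/\ forall x y, `|F x - F y| <= 2 * `|x - y|,
      forall x y, `|F x - F y - F1 x * (x - y)| <=
        `|x - y| * (`|x * F x - y * F y| + `|H x - H y|) &
      forall x, F1 x = x * F x + (H x - \int[mu]_(t in `]-oo, z]) p t)]].
Proof.
move=> H; have p0 := @std_normal_pdf_gt0 R.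
have pn0 x : p x != 0 by rewrite gt_eqF.
pose Phi := 1 - M z.
have PhiE : Phi = \int[mu]_(t in `]-oo, z]) p t by rewrite /Phi /M opprB addrC subrK.
pose FL w := (1 - M w) * M z / p w.
pose FR w := Phi * M w / p w.
pose F w := if w <= z then FL w else FR w.
pose G w := w * F w.
pose F1 w := G w + (H w - Phi).
have FLz : FL z = FR z by [].
have FRE w : z <= w -> F w = FR w.
  rewrite /F le_eqVlt => /predU1P[<-|zw]; first by rewrite lexx FLz.
  by rewrite leNgt zw.
have FLE w : w <= z -> F w = FL w by rewrite /F => ->.
have dFL x : is_derive x 1 FL (M z + x * FL x).
  apply: (is_derive_div_pdf (fun w => (1 - M w) * M z)).
  have := dM x => ?; apply: is_derive_eq; rewrite /GRing.scale/=; ring.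
have dFR x : is_derive x 1 FR (- Phi + x * FR x).
  apply: (is_derive_div_pdf (fun w => Phi * M w)).
  have := dM x => ?; apply: is_derive_eq; rewrite /GRing.scale/=; ring.
have GLm x y : x <= y -> x * FL x <= y * FL y.
  move=> xy; apply: (@derive_ge0_le _ (fun w => w * FL w)
    (fun w => M z / p w * ((1 + (- w) ^+ 2) * M2 (- w) - - w * p (- w)))) => // w _.
    have := dFL w => ?; apply: is_derive_eq.
    rewrite /GRing.scale/= /FL /M2 opprK std_normal_pdfN.
    by field; exact: pn0.
  rewrite mulr_ge0 ?divr_ge0 ?(ltW (p0 _))// subr_ge0.
  exact: (mills_lower M2 dM2 M2y).
have GRm x y : x <= y -> x * FR x <= y * FR y.
  move=> xy; apply: (@derive_ge0_le _ (fun w => w * FR w)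
    (fun w => Phi / p w * ((1 + w ^+ 2) * M w - w * p w))) => // w _.
    have := dFR w => ?; apply: is_derive_eq.
    rewrite /GRing.scale/= /FR.
    by field; exact: pn0.
  rewrite mulr_ge0 ?divr_ge0 ?(ltW (p0 _))// ?M_le1// subr_ge0.
  exact: (mills_lower M dM My).
have Gm x y : x <= y -> G x <= G y.
  move=> xy; rewrite /G; have [yz|zy] := leP y z.
    by rewrite !FLE ?(le_trans xy yz)// GLm.
  have [xz|zx] := leP x z; last first.
    by rewrite !FRE ?(le_trans (ltW zx) xy) ?(ltW zx)// GRm.
  rewrite FLE// (FRE y) ?(ltW zy)//.
  exact: le_trans (GLm _ _ xz) (GRm _ _ (ltW zy)).
(* [F * p] lies below both tails. The upper one serves for [w >= 0] and the lower one for [w <= 0],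
   so the Mills bounds for [M] and for [M2] give the constants 3 and 1. *)
have Fp w : [/\ 0 <= F w * p w, F w * p w <= M w & F w * p w <= 1 - M w].
  have [wz|/ltW zw] := leP w z.
    rewrite FLE// /FL divfK//; have Mzw := M_nincr _ _ wz; split.
    - by rewrite mulr_ge0.
    - by rewrite -[leRHS]mul1r ler_pM// gerBl.
    - by rewrite ler_piMr// -subr_ge0.
  rewrite FRE// /FR divfK//; have Mzw := M_nincr _ _ zw; split.
  - by rewrite mulr_ge0// M_le1.
  - by rewrite ler_piMl// gerBl.
  - rewrite -[leRHS]mulr1 ler_pM ?M_le1//; last by rewrite -subr_ge0.
    by rewrite lerD2l lerN2.
have F0 w : 0 <= F w by have [+ _ _] := Fp w; rewrite pmulr_lge0.
have FB w : `|F w| <= 3.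
  rewrite ger0_norm// -(ler_pM2r (p0 w)); have [_ FM FM2] := Fp w.
  have [w0|/ltW w0] := leP 0 w.
    by rewrite (le_trans FM)// (mills_ratio_le3 M dM My).
  rewrite (le_trans FM2)//.
  have := mills_ratio_le3 M2 dM2 M2y (- w); rewrite /M2 opprK std_normal_pdfN.
  by apply; rewrite oppr_ge0.
have GB w : `|G w| <= 1.
  rewrite -(ler_pM2r (p0 w)) mul1r -{1}(gtr0_norm (p0 w)) -normrM /G -mulrA.
  have [Fp0 FM FM2] := Fp w; rewrite normrM (ger0_norm Fp0).
  have [w0|/ltW w0] := leP 0 w.
    by rewrite (ger0_norm w0) (le_trans (ler_wpM2l w0 FM))// (mills_mul_le M dM My).
  have w0' : 0 <= - w by rewrite oppr_ge0.
  rewrite (ler0_norm w0) (le_trans (ler_wpM2l w0' FM2))//.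
  by have := mills_mul_le M2 dM2 M2y (- w); rewrite /M2 opprK std_normal_pdfN.
have H01 w : 0 <= H w <= 1 by rewrite /H; case: (w <= z); rewrite ?lexx ?ler01.
have Hm x y : x <= y -> H y <= H x.
  move=> xy; rewrite /H; case: (boolP (y <= z)) => [yz|_]; last by rewrite ler0n.
  by rewrite (le_trans xy yz).
have Phi01 : 0 <= Phi <= 1 by rewrite M_le1/= gerBl.
have F1B w : `|F1 w| <= 2.
  have := GB w; rewrite !ler_norml /F1 => /andP[? ?].
  by have /andP[? ?] := H01 w; case/andP : Phi01 => ? ?; apply/andP; split; lra.
(* [F1 = G + (H - Phi)] brackets every difference quotient since [G] increases
   and [H] decreases; no differentiability at [z] is needed. *)
have bracket a b : a < b ->
    (b - a) * (G a + H b - Phi) <= F b - F a <= (b - a) * (G b + H a - Phi).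
  have side a' b' : a' < b' -> (b' <= z) || (z <= a') ->
    (b' - a') * (G a' + H b' - Phi) <= F b' - F a' <= (b' - a') * (G b' + H a' - Phi).
    move=> ab /orP[bz|za].
      have [c /andP[ac cb]] := mean_value FL _ _ _ ab (fun w _ => dFL w).
      have cz : c <= z := le_trans (ltW cb) bz.
      have az : a' <= z := le_trans (ltW ac) cz.
      rewrite !FLE// => ->.
      have /(_ a' c)/(_ (ltW ac)) := Gm; have /(_ c b')/(_ (ltW cb)) := Gm.
      rewrite /G (FLE c)// [X in _ <= X <= _]mulrC => G1 G2.
      have ba : 0 <= b' - a' by rewrite subr_ge0 ltW.
      rewrite /H az bz /Phi /=; apply/andP; split; apply: ler_wpM2l => //; lra.
    have [c /andP[ac cb]] := mean_value FR _ _ _ ab (fun w _ => dFR w).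
    have zc : z < c := le_lt_trans za ac.
    have zb : z < b' := lt_trans zc cb.
    rewrite !FRE ?(ltW zb)// => ->.
    have /(_ a' c)/(_ (ltW ac)) := Gm; have /(_ c b')/(_ (ltW cb)) := Gm.
    rewrite /G (FRE c) ?(ltW zc)// [X in _ <= X <= _]mulrC => G1 G2.
    have ba : 0 <= b' - a' by rewrite subr_ge0 ltW.
    have /andP[H0 _] := H01 a'.
    have -> : H b' = 0 by rewrite /H leNgt zb.
    by apply/andP; split; apply: ler_wpM2l => //; lra.
  move=> ab; have [bz|zb] := leP b z; first by apply: side => //; rewrite bz.
  have [za|az] := leP z a; first by apply: side => //; rewrite za orbT.
  (* Across [z] the two one-sided brackets are added. Replacing [z] by [a] or by [b] only weakens
     them, since [G] increases and [H] decreases. *)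
  have /andP[l1 u1] := side z b zb ltac:(by rewrite lexx orbT).
  have /andP[l2 u2] := side a z az ltac:(by rewrite lexx).
  have Gaz := Gm _ _ (ltW az); have Gzb := Gm _ _ (ltW zb).
  have Haz := Hm _ _ (ltW az); have Hzb := Hm _ _ (ltW zb).
  have zb0 : 0 <= b - z by rewrite subr_ge0 ltW.
  have az0 : 0 <= z - a by rewrite subr_ge0 ltW.
  have split_ba X : (b - a) * X = (b - z) * X + (z - a) * X by ring.
  have -> : F b - F a = (F b - F z) + (F z - F a) by ring.
  rewrite !split_ba; apply/andP; split.
    apply: lerD.
      by apply: le_trans l1; apply: ler_wpM2l => //; lra.
    by apply: le_trans l2; apply: ler_wpM2l => //; lra.
  apply: lerD.
    by apply: (le_trans u1); apply: ler_wpM2l => //; lra.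
  by apply: (le_trans u2); apply: ler_wpM2l => //; lra.
have FL2 x y : `|F x - F y| <= 2 * `|x - y|.
  wlog yx : x y / y < x.
    move=> W; have [/W//|xy|->] := ltgtP y x; last by rewrite !subrr normr0 mulr0.
    by rewrite distrC (distrC x) W.
  have /andP[l u] := bracket _ _ yx.
  have xy0 : 0 <= x - y by rewrite subr_ge0 ltW.
  have := GB x; have := GB y; rewrite !ler_norml => /andP[? ?] /andP[? ?].
  have /andP[? ?] := H01 x; have /andP[? ?] := H01 y; case/andP : Phi01 => ? ?.
  rewrite (ger0_norm xy0) mulrC -mulrN; apply/andP; split.
    by apply: le_trans l; apply: ler_wpM2l => //; lra.
  by apply: (le_trans u); apply: ler_wpM2l => //; lra.
have Fc : continuous F := lipschitz_continuous F 2 FL2.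
have mF : measurable_fun [set: R] F by exact: continuous_measurable_fun.
exists F, F1; split => //.
- apply: measurable_funD; first exact: measurable_funM.
  by apply: measurable_funB => //; exact: nonincreasing_measurable.
- by move=> x; split; [exact: FB|exact: F1B|exact: GB].
- split=> //; last by move=> x; rewrite /F1 /G PhiE.
  have Hn u v : u <= v -> `|H v - H u| = H u - H v.
    by move=> uv; rewrite distrC ger0_norm// subr_ge0 Hm.
  have Gn u v : u <= v -> `|v * F v - u * F u| = G v - G u.
    by move=> uv; rewrite ger0_norm// subr_ge0 Gm.
  move=> x y; have [xy|yx|->] := ltgtP x y; last by rewrite !subrr mulr0 subr0 normr0 mul0r.
  + have /andP[l u] := bracket _ _ xy.
    rewrite (distrC x) (distrC (x * _)) (distrC (H x)) Hn ?Gn ?(ltW xy)//.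
    have xy0 : 0 <= y - x by rewrite subr_ge0 ltW.
    rewrite (ger0_norm xy0).
    have -> : F x - F y - F1 x * (x - y) = (y - x) * F1 x - (F y - F x) by ring.
    have G1 := Gm _ _ (ltW xy); have H1 := Hm _ _ (ltW xy).
    rewrite ler_norml -mulrN; apply/andP; split.
      rewrite lerBrDr -lerBrDl; apply: (le_trans u); rewrite -mulrBr.
      by apply: ler_wpM2l => //; rewrite /F1; lra.
    rewrite lerBlDr -lerBlDl; apply: le_trans l; rewrite -mulrBr.
    by apply: ler_wpM2l => //; rewrite /F1; lra.
  + have /andP[l u] := bracket _ _ yx.
    rewrite Hn ?Gn ?(ltW yx)//.
    have xy0 : 0 <= x - y by rewrite subr_ge0 ltW.
    rewrite (ger0_norm xy0) (mulrC (F1 x)).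
    have G1 := Gm _ _ (ltW yx); have H1 := Hm _ _ (ltW yx).
    rewrite ler_norml -mulrN; apply/andP; split.
      rewrite lerBrDr; apply: le_trans l; rewrite -mulrDr.
      by apply: ler_wpM2l => //; rewrite /F1; lra.
    rewrite lerBlDr; apply: (le_trans u); rewrite -mulrDr.
    by apply: ler_wpM2l => //; rewrite /F1; lra.
Qed.

End stein_indicator.

(** * Real-valued expectations and changes of law *)

Section real_integral.
Context {d : measure_display} {T : measurableType d} {R : realType}.
Variable P : {measure set T -> \bar R}.
Implicit Types (u v : T -> R).
Local Notation L1 u := (P.-integrable [set: T] (EFin \o (u : T -> R))).
Local Notation E u := (\int[P]_w (u w)).

Lemma L1_measurable u : L1 u -> measurable_fun [set: T] u.
Proof. by case/integrableP => /measurable_EFinP. Qed.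

Lemma L1_dom u v : measurable_fun [set: T] u -> (forall w, `|u w| <= v w) ->
  L1 v -> L1 u.
Proof.
move=> mu uv; apply: le_integrable => //; first exact/measurable_EFinP.
by move=> w _ /=; rewrite lee_fin (le_trans (uv w))// ler_norm.
Qed.

Lemma L1D u v : L1 u -> L1 v -> L1 (fun w => u w + v w).
Proof. by move=> iu iv; exact: (integrableD measurableT iu iv). Qed.

Lemma L1B u v : L1 u -> L1 v -> L1 (fun w => u w - v w).
Proof. by move=> iu iv; exact: (integrableB measurableT iu iv). Qed.

Lemma L1Z (c : R) u : L1 u -> L1 (fun w => c * u w).
Proof. by move=> iu; exact: (integrableZl measurableT c iu). Qed.

Lemma L1_norm u : L1 u -> L1 (fun w => `|u w|).
Proof. exact: integrable_norm. Qed.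

Lemma L1_bounded_mul u v (c : R) : measurable_fun [set: T] u ->
  (forall w, `|u w| <= c) -> L1 v -> L1 (fun w => u w * v w).
Proof.
move=> mu uc iv; have mv := L1_measurable _ iv.
apply: (L1_dom _ (fun w => c * `|v w|)).
- exact: measurable_funM.
- by move=> w; rewrite normrM ler_wpM2r.
- by apply: L1Z; exact: L1_norm.
Qed.

Lemma L1_sum (I : Type) (s : seq I) (f : I -> T -> R) :
  (forall i, L1 (f i)) -> L1 (fun w => \sum_(i <- s) f i w).
Proof.
move=> fi; elim: s => [|i s IH].
  by under eq_fun do rewrite big_nil; exact: integrable0.
by under eq_fun do rewrite big_cons; exact: L1D.
Qed.

Lemma ED u v : L1 u -> L1 v -> E (fun w => u w + v w) = E u + E v.
Proof. by move=> iu iv; rewrite RintegralD. Qed.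

Lemma EB u v : L1 u -> L1 v -> E (fun w => u w - v w) = E u - E v.
Proof. by move=> iu iv; rewrite RintegralB. Qed.

Lemma EZ (c : R) u : L1 u -> E (fun w => c * u w) = c * E u.
Proof. by move=> iu; rewrite RintegralZl. Qed.

Lemma E_sum (I : Type) (s : seq I) (f : I -> T -> R) :
  (forall i, L1 (f i)) -> E (fun w => \sum_(i <- s) f i w) = \sum_(i <- s) E (f i).
Proof.
move=> fi; elim: s => [|i s IH].
  by rewrite big_nil; under eq_Rintegral do rewrite big_nil; rewrite /Rintegral integral0.
rewrite big_cons -IH -ED//; last exact: L1_sum.
by apply: eq_Rintegral => w _; rewrite big_cons.
Qed.

Lemma eq_E u v : u =1 v -> E u = E v.
Proof. by move=> uv; apply: eq_Rintegral => w _. Qed.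

Lemma E_le u v : L1 u -> L1 v -> (forall w, u w <= v w) -> E u <= E v.
Proof. by move=> iu iv uv; apply: le_Rintegral. Qed.

Lemma E_ae_eq u v : measurable_fun [set: T] u -> measurable_fun [set: T] v ->
  {ae P, forall w, u w = v w} -> E u = E v.
Proof.
move=> mu mv uv; rewrite /Rintegral; congr fine; apply: ae_eq_integral => //.
- exact/measurable_EFinP.
- exact/measurable_EFinP.
- by move: uv; apply: filterS => w /= -> _.
Qed.

Lemma E_ae_le u v : L1 u -> L1 v -> {ae P, forall w, u w <= v w} -> E u <= E v.
Proof.
move=> iu iv uv; have mu := L1_measurable _ iu; have mv := L1_measurable _ iv.
(* The minimum is a version of [u] that lies below [v] everywhere. *)
have mm : measurable_fun [set: T] (fun w => Num.min (u w) (v w)) by exact: measurable_minr.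
have -> : E u = E (fun w => Num.min (u w) (v w)).
  by apply: E_ae_eq => //; move: uv; apply: filterS => w uvw; rewrite (min_idPl uvw).
apply: E_le => //; last by move=> w; rewrite ge_min lexx orbT.
apply: (L1_dom _ (fun w => `|u w| + `|v w|) mm); last by apply: L1D; exact: L1_norm.
by move=> w; rewrite minEle; case: ifP => _; rewrite ?lerDl ?lerDr.
Qed.

Lemma E_ge0 u : (forall w, 0 <= u w) -> 0 <= E u.
Proof. by move=> u0; apply: Rintegral_ge0. Qed.

Lemma E_normr u : L1 u -> `|E u| <= E (fun w => `|u w|).
Proof. by move=> iu; apply: le_normr_Rintegral. Qed.

Lemma E_dom u v : measurable_fun [set: T] u -> (forall w, `|u w| <= v w) ->
  L1 v -> `|E u| <= E v.
Proof.
move=> mu uv iv; have iu := L1_dom _ _ mu uv iv.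
by rewrite (le_trans (E_normr _ iu))// E_le//; exact: L1_norm.
Qed.

Lemma E_cvg (f : nat -> T -> R) u v : (forall n, measurable_fun [set: T] (f n)) ->
  measurable_fun [set: T] u -> L1 v -> (forall n w, `|f n w| <= v w) ->
  (forall w, f n w @[n --> \oo] --> u w) ->
  E (f n) @[n --> \oo] --> E u.
Proof.
move=> mf mu iv fv fu.
have [|||||iu _ H] := @dominated_convergence _ _ _ P [set: T] measurableT
  (fun n => EFin \o f n) (EFin \o u) (EFin \o v).
- by move=> n; exact/measurable_EFinP.
- exact/measurable_EFinP.
- by apply: aeW => w _; apply: cvg_EFin; [exact: nearW|exact: fu].
- exact: iv.
- by apply: aeW => w n _ /=; rewrite lee_fin.
have fE : (\int[P]_w (u w)%:E)%E \is a fin_num by exact: integrable_fin_num.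
rewrite /Rintegral.
suff : (\int[P]_w (f n w)%:E)%E @[n --> \oo] --> (fine (\int[P]_w (u w)%:E)%E)%:E.
  by move/fine_cvg.
by rewrite fineK.
Qed.

End real_integral.

Section real_expectation.
Context {d : measure_display} {T : measurableType d} {R : realType}.
Variable P : probability T R.
Implicit Types (u v : T -> R).
Local Notation L1 u := (P.-integrable [set: T] (EFin \o (u : T -> R))).
Local Notation E u := (\int[P]_w (u w)).

Lemma L1_cst (c : R) : L1 (fun=> c).
Proof. exact: finite_measure_integrable_cst. Qed.

Lemma L1_bounded u (c : R) : measurable_fun [set: T] u ->
  (forall w, `|u w| <= c) -> L1 u.
Proof. by move=> mu uc; exact: L1_dom uc (L1_cst c). Qed.

Lemma E_cst (c : R) : E (fun=> c) = c.
Proof. by rewrite Rintegral_cst//= probability_setT mulr1. Qed.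

Lemma E_gt0 u : L1 u -> (forall w, 0 < u w) -> 0 < E u.
Proof.
move=> iu u0; rewrite lt0r E_ge0 ?andbT; last by move=> w; exact: ltW.
apply/eqP => Eu0.
have : (\int[P]_w `|(u w)%:E| = 0)%E.
  transitivity (E u)%:E; last by rewrite Eu0.
  rewrite /Rintegral fineK; last exact: integrable_fin_num.
  by apply: eq_integral => w _; rewrite gee0_abs// lee_fin ltW.
have mu := measurable_int _ iu.
move/(ae_eq_integral_abs P measurableT mu) => [C [mC C0 subC]].
have : (P [set: T] <= P C)%E.
  apply: le_measure; rewrite ?inE// => w _; apply: subC => /= /(_ I) uw.
  by move: (u0 w); rewrite -lte_fin uw ltxx.
by rewrite [X in (_ <= X)%E]C0 probability_setT lee_fin ler10.
Qed.

Lemma expectation_real u : L1 u -> ('E_P[u] = (E u)%:E)%E.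
Proof.
by move=> iu; rewrite unlock /Rintegral fineK//; exact: integrable_fin_num.
Qed.

Lemma ge0_expectation_lty u : measurable_fun [set: T] u -> (forall w, 0 <= u w) ->
  ('E_P[u] < +oo)%E -> L1 u.
Proof.
move=> mu u0; rewrite unlock => uy; apply/integrableP; split.
  exact/measurable_EFinP.
by under eq_integral => w _ do rewrite /= ger0_norm//.
Qed.

(** Expand [E (|v| - c)^2 >= 0] at [c = E |v|]. Square integrability is not assumed: an infinite
    variance makes the right side infinite. The quantities [delta2] and [delta3] enter the proof
    through this bound. *)
Lemma mean_deviation_le_stddev u : L1 u ->
  ((E (fun w => `|u w - E u|))%:E <= sqrte 'V_P[u])%E.
Proof.
move=> iu; pose v w := u w - E u.
have iv : L1 v by apply: L1B => //; exact: L1_cst.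
have mv := L1_measurable P _ iv.
have mv2 : measurable_fun [set: T] (fun w => v w * v w) by exact: measurable_funM.
have VE : variance P u = expectation P (fun w => v w * v w).
  by rewrite /variance unlock (expectation_real _ iu).
rewrite VE; case: (ltP (expectation P (fun w => v w * v w)) +oo%E) => [fin|]; last first.
  by rewrite leye_eq => /eqP ->; rewrite /= leey.
have iv2 : L1 (fun w => v w * v w).
  by apply: ge0_expectation_lty => // w; rewrite -expr2 sqr_ge0.
rewrite (expectation_real _ iv2) /= lee_fin; set c := (X in X <= _).
have c0 : 0 <= c by apply: E_ge0.
rewrite -(ger0_norm c0) -sqrtr_sqr ler_sqrt; last by apply: E_ge0 => w; rewrite -expr2 sqr_ge0.
have : 0 <= E (fun w => v w * v w - (2 * c) * `|v w| + c ^+ 2).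
  apply: E_ge0 => w; have := sqr_ge0 (`|v w| - c).
  by rewrite sqrrB real_normK ?num_real// -expr2; lra.
have ian := L1_norm P _ iv.
have i2 : L1 (fun w => (2 * c) * `|v w|) by exact: L1Z.
have i3 : L1 (fun w => v w * v w - (2 * c) * `|v w|) by exact: L1B.
rewrite (ED P _ _ i3 (L1_cst _)) (EB P _ _ iv2 i2) (EZ P _ _ ian) E_cst.
by rewrite -/c; lra.
Qed.

End real_expectation.

(** * Transfer of integrals between laws *)

Section equal_laws.
Context {d dS : measure_display} {T : measurableType d} {S : measurableType dS}
  {R : realType}.
Variable P : probability T R.
Implicit Types psi : S -> R.
Local Notation L1 u := (P.-integrable [set: T] (EFin \o (u : T -> R))).
Local Notation E u := (\int[P]_w (u w)).

Lemma ge0_integral_same_law (U V : {mfun T >-> S}) (psi : S -> \bar R) :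
  (forall A, measurable A -> P (U @^-1` A) = P (V @^-1` A)) ->
  measurable_fun [set: S] psi -> (forall x, 0 <= psi x)%E ->
  (\int[P]_w psi (U w) = \int[P]_w psi (V w))%E.
Proof.
move=> UV mpsi psi0.
rewrite -(ge0_integral_distribution (P := P) U mpsi psi0).
rewrite -(ge0_integral_distribution (P := P) V mpsi psi0).
by apply: eq_measure_integral => A mA _; exact: UV.
Qed.

Lemma L1_same_law (U V : {mfun T >-> S}) psi :
  (forall A, measurable A -> P (U @^-1` A) = P (V @^-1` A)) ->
  measurable_fun [set: S] psi -> L1 (fun w => psi (U w)) -> L1 (fun w => psi (V w)).
Proof.
move=> UV mpsi /integrableP[_ iU]; apply/integrableP; split.
  by apply/measurable_EFinP; exact: measurableT_comp.
have /= <-// := ge0_integral_same_law U V (fun x => `|psi x|%:E) UV.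
by apply/measurable_EFinP; exact: measurableT_comp.
Qed.

Lemma E_same_law (U V : {mfun T >-> S}) psi :
  (forall A, measurable A -> P (U @^-1` A) = P (V @^-1` A)) ->
  measurable_fun [set: S] psi -> L1 (fun w => psi (U w)) ->
  E (fun w => psi (U w)) = E (fun w => psi (V w)).
Proof.
move=> UV mpsi iU; have iV := L1_same_law U V psi UV mpsi iU.
have mpsi' : measurable_fun [set: S] (EFin \o psi) by exact/measurable_EFinP.
rewrite /Rintegral; congr fine.
rewrite -(integral_distribution (P := P) (X := U) mpsi' iU).
rewrite -(integral_distribution (P := P) (X := V) mpsi' iV).
by apply: eq_measure_integral => A mA _; exact: UV.
Qed.

End equal_laws.

Section transfer.
Context {R : realType}.

(* Layer-cake discretization of [t], truncated at [n]. *)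
Lemma floor_sum_bounds (t : R) (n : nat) : 0 <= t <= n%:R ->
  let s := \sum_(k < n) (k.+1%:R <= t)%R%:R in s <= t /\ t <= s + 1.
Proof.
move=> tn; suff : forall m : nat, (m <= n)%N ->
    let s := \sum_(k < m) (k.+1%:R <= t)%R%:R in
    [/\ s <= t, m%:R <= t -> s = m%:R & t <= m%:R -> t <= s + 1].
  by move=> /(_ n (leqnn n))[? _]; move/andP : tn => [_ ->] /(_ isT).
move/andP: tn => [t0 tn].
elim=> [_|m IH mn] /=.
  by rewrite big_ord0; split => // t0'; rewrite (le_trans t0')// add0r.
have [s1 s2 s3] := IH (ltnW mn); rewrite big_ord_recr/=.
have [mt|tm] := leP m.+1%:R t.
  have mt' : m%:R <= t by rewrite (le_trans _ mt)// ler_nat.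
  rewrite (s2 mt') -natr1 in mt *; split => // tm; rewrite (le_trans tm)// lerDl//.
rewrite addr0; split => //.
move=> _; have [tm'|/ltW mt] := leP t m%:R; first exact: s3.
by rewrite s2// natr1 ltW.
Qed.

Context {d d' dS : measure_display} {T : measurableType d} {T' : measurableType d'}
  {S : measurableType dS}.
Variables (P : {measure set T -> \bar R}) (Q : {measure set T' -> \bar R}).

(* If two weighted laws on [S] agree on measurable sets, they agree on bounded
   functions, by uniform approximation. *)
Lemma weighted_law_bounded (U : T -> S) (V : T' -> S) (xi : T -> R) (zeta : T' -> R)
    (eta : S -> R) (B : R) :
  measurable_fun [set: T] U -> measurable_fun [set: T'] V ->
  P.-integrable [set: T] (EFin \o xi) -> Q.-integrable [set: T'] (EFin \o zeta) ->
  (forall A, measurable A ->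
    \int[P]_(w in U @^-1` A) xi w = \int[Q]_(w in V @^-1` A) zeta w) ->
  measurable_fun [set: S] eta -> (forall x, `|eta x| <= B) ->
  \int[P]_w (eta (U w) * xi w) = \int[Q]_w (eta (V w) * zeta w).
Proof.
move=> mU mV ixi izeta law meta etaB.
wlog B0 : B etaB / 0 < B.
  by move=> H; apply: (H (`|B| + 1)) => [x|]; rewrite ?ltr_wpDl// (le_trans (etaB x))// (le_trans (ler_norm _))// lerDl.
(* The affine map to [(eta x + B) n / (2 B)] sends the range of [eta] into the interval from 0 to
   [n], where [floor_sum_bounds] is off by at most 1. Scaled back, the step function [eta_ n] is
   within [2 B / n] of [eta], uniformly. *)
pose A (n k : nat) : set S := [set x | k.+1%:R <= (eta x + B) * n%:R / (2 * B)].
have mA n k : measurable (A n k).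
  rewrite -[A n k]setTI; apply: measurable_fun_ler => //.
  apply: measurable_funM => //; apply: measurable_funM => //.
  exact: measurable_funD.
pose eta_ (n : nat) x : R := - B + (2 * B) / n%:R * \sum_(k < n) \1_(A n k) x.
have metan n : measurable_fun [set: S] (eta_ n).
  apply: measurable_funD => //; apply: measurable_funM => //.
  by apply: measurable_sum => k; exact: measurable_indic.
have eta_B n x : `|eta x - eta_ n.+1 x| <= (2 * B) / n.+1%:R.
  pose t := (eta x + B) * n.+1%:R / (2 * B).
  have /andP[eB1 eB2] : - B <= eta x <= B by rewrite -ler_norml.
  have B20 : 0 < 2 * B by rewrite mulr_gt0.
  have tb : 0 <= t <= n.+1%:R.
    have eB0 : 0 <= eta x + B by rewrite -lerBlDr sub0r.
    apply/andP; split; first by rewrite divr_ge0 ?mulr_ge0// ltW.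
    by rewrite /t ler_pdivrMr// mulrC ler_wpM2l//; lra.
  have [s1 s2] := floor_sum_bounds t n.+1 tb.
  have -> : eta x = - B + (2 * B) / n.+1%:R * t.
    by rewrite /t; field; rewrite nat1r pnatr_eq0 gt_eqF.
  have -> : eta_ n.+1 x = - B + (2 * B) / n.+1%:R *
      \sum_(k < n.+1) (k.+1%:R <= t)%R%:R.
    rewrite /eta_; congr (_ + _ * _); apply: eq_bigr => k _.
    by rewrite indicE; congr (nat_of_bool _)%:R; apply/idP/idP; rewrite inE.
  rewrite opprD addrACA subrr add0r -mulrBr normrM gtr0_norm ?divr_gt0//.
  by rewrite ler_piMr ?divr_ge0 ?(ltW B20)// ger0_norm ?subr_ge0// lerBlDl.
have E_ n : \int[P]_w (eta_ n (U w) * xi w) = \int[Q]_w (eta_ n (V w) * zeta w).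
  have comp (d0 : measure_display) (T0 : measurableType d0) (P0 : {measure set T0 -> \bar R})
      (U0 : T0 -> S) (xi0 : T0 -> R) :
      measurable_fun [set: T0] U0 -> P0.-integrable [set: T0] (EFin \o xi0) ->
      \int[P0]_w (eta_ n (U0 w) * xi0 w) =
      - B * \int[P0]_w xi0 w + (2 * B) / n%:R *
        \sum_(k < n) \int[P0]_(w in U0 @^-1` A n k) xi0 w.
    move=> mU0 i0.
    have iind k : P0.-integrable [set: T0] (EFin \o (fun w => \1_(A n k) (U0 w) * xi0 w)).
      apply: (L1_bounded_mul _ _ _ 1) => //.
        by apply: measurableT_comp => //; exact: measurable_indic.
      by move=> w; rewrite indicE; case: (_ \in _); rewrite ?normr1 ?normr0.
    transitivity (\int[P0]_w (- B * xi0 w + (2 * B) / n%:R *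
        \sum_(k < n) (\1_(A n k) (U0 w) * xi0 w))).
      by apply: eq_E => w; rewrite /eta_ mulrDl -mulrA mulr_suml.
    have isum := L1_sum P0 _ (index_enum 'I_n) (fun k w => \1_(A n k) (U0 w) * xi0 w)
      (fun k => iind k).
    rewrite (ED P0 _ _ (L1Z P0 _ _ i0) (L1Z P0 _ _ isum)) (EZ P0 _ _ i0) (EZ P0 _ _ isum).
    rewrite E_sum//; congr (_ + _ * _); apply: eq_bigr => k _.
    rewrite [RHS]Rintegral_mkcond; apply: eq_E => w.
    rewrite patchE indicE; have -> : (w \in U0 @^-1` A n k) = (U0 w \in A n k).
      by apply/idP/idP; rewrite !inE.
    by case: (_ \in _); rewrite ?mul1r ?mul0r.
  rewrite !comp//; congr (_ * _ + _ * _).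
    by have := law _ measurableT; rewrite !preimage_setT.
  by apply: eq_bigr => k _; exact: law.
have mdiff n : measurable_fun [set: S] (fun x => eta x - eta_ n x).
  exact: measurable_funB.
have close (d0 : measure_display) (T0 : measurableType d0) (P0 : {measure set T0 -> \bar R})
    (U0 : T0 -> S) (xi0 : T0 -> R) n :
    measurable_fun [set: T0] U0 -> P0.-integrable [set: T0] (EFin \o xi0) ->
    `|\int[P0]_w (eta (U0 w) * xi0 w) - \int[P0]_w (eta_ n.+1 (U0 w) * xi0 w)| <=
    (2 * B) / n.+1%:R * \int[P0]_w `|xi0 w|.
  move=> mU0 i0; have mdU : measurable_fun [set: T0] (fun w => eta (U0 w) - eta_ n.+1 (U0 w)).
    by apply: (measurableT_comp (mdiff n.+1)).
  have mxi := L1_measurable P0 _ i0.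
  have i1 : P0.-integrable [set: T0] (EFin \o (fun w => eta (U0 w) * xi0 w)).
    by apply: (L1_bounded_mul _ _ _ B) => //; exact: measurableT_comp.
  have i2 : P0.-integrable [set: T0] (EFin \o (fun w => (eta (U0 w) - eta_ n.+1 (U0 w)) * xi0 w)).
    by apply: (L1_bounded_mul _ _ _ ((2 * B) / n.+1%:R)).
  have i3 : P0.-integrable [set: T0] (EFin \o (fun w => eta_ n.+1 (U0 w) * xi0 w)).
    have := L1B P0 _ _ i1 i2.
    by congr (P0.-integrable _ (EFin \o _)); apply/funext => w; ring.
  rewrite -(EB P0 _ _ i1 i3) -(EZ P0 _ _ (L1_norm P0 _ i0)).
  apply: E_dom => //.
  - by apply: measurable_funB; [exact: L1_measurable i1|exact: L1_measurable i3].
  - by move=> w; rewrite -mulrBl normrM ler_wpM2r.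
  - by apply: L1Z; exact: L1_norm.
pose K := \int[P]_w `|xi w| + \int[Q]_w `|zeta w|.
apply/eqP; rewrite -subr_eq0 -normr_le0; apply/ler_addgt0Pr => e e0; rewrite add0r.
have K0 : 0 <= K by rewrite addr_ge0// E_ge0.
pose n := Num.truncn (2 * B * K / e).
have nP : 2 * B * K / e < n.+1%:R by exact: truncnS_gt.
have := close _ _ P U xi n mU ixi; have := close _ _ Q V zeta n mV izeta.
rewrite E_ => h1 h2.
set a := \int[P]_w (eta (U w) * xi w) in h2 *; set b := \int[Q]_w (eta (V w) * zeta w) in h1 *.
set c := \int[Q]_w (eta_ n.+1 (V w) * zeta w) in h1 h2.
have -> : a - b = (a - c) - (b - c) by ring.
rewrite (le_trans (ler_normB _ _))// (le_trans (lerD h2 h1))// -mulrDr -/K.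
by rewrite mulrAC ler_pdivrMr// [leRHS]mulrC -ler_pdivrMr// ltW.
Qed.

End transfer.

Section clamp.
Context {R : realType}.
Implicit Types (K x y : R).

Definition clamp K x : R := Num.max (- K) (Num.min x K).

Lemma clamp_bound K x : 0 <= K -> `|clamp K x| <= K.
Proof.
move=> K0; rewrite ler_norml le_max lexx/= ge_max ge_min lexx orbT andbT.
lra.
Qed.

Lemma clamp_lipschitz K x y : 0 <= K -> `|clamp K x - clamp K y| <= `|x - y|.
Proof.
move=> K0; wlog xy : x y / y <= x.
  by move=> W; have [/W//|/ltW/W] := leP y x; rewrite distrC (distrC x).
rewrite (ger0_norm (_ : 0 <= x - y)) ?subr_ge0// ler_norml /clamp !maxEle !minEle.
by apply/andP; split; do ?case: ifPn; rewrite -?ltNge; lra.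
Qed.

Lemma clamp_norm_le K x : 0 <= K -> `|clamp K x| <= `|x|.
Proof.
move=> K0; have := clamp_lipschitz K x 0 K0.
by rewrite {2}/clamp (min_idPl K0) (max_idPr (_ : - K <= 0)) ?oppr_le0// !subr0.
Qed.

Lemma clamp_id K x : `|x| <= K -> clamp K x = x.
Proof.
by rewrite ler_norml => /andP[Kx xK]; rewrite /clamp (min_idPl xK) (max_idPr Kx).
Qed.

Lemma cvg_clamp x : clamp n%:R x @[n --> \oo] --> x.
Proof.
apply: cvg_near_cst; near=> n; apply: clamp_id.
by near: n; exact: nbhs_infty_ger.
Unshelve. all: by end_near. Qed.

Lemma measurable_clamp d (T : measurableType d) K (u : T -> R) :
  measurable_fun [set: T] u -> measurable_fun [set: T] (fun w => clamp K (u w)).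
Proof. by move=> mu; apply: measurable_maxr => //; exact: measurable_minr. Qed.

End clamp.

(** By definition of a conditional expectation, the weights [xi] and [phi \o U] induce the same
    signed law of [U]. *)
Lemma cond_exp_bounded {R : realType} {d dS : measure_display}
    {T : measurableType d} {S : measurableType dS} (P : probability T R)
    (U : T -> S) (xi : T -> R) (phi eta : S -> R) (B : R) :
  measurable_fun [set: T] U -> is_cond_exp P U xi phi ->
  measurable_fun [set: S] eta -> (forall x, `|eta x| <= B) ->
  \int[P]_w (eta (U w) * xi w) = \int[P]_w (eta (U w) * phi (U w)).
Proof.
move=> mU [ixi mphi iphi law] meta etaB.
apply: (weighted_law_bounded P P U U xi (phi \o U) eta B) => // A mA.
by rewrite /Rintegral law.
Qed.

Lemma ge0_integral_truncation {R : realType} {d : measure_display} {T : measurableType d}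
    (mu : {measure set T -> \bar R}) (u r : T -> R) :
  measurable_fun [set: T] u -> measurable_fun [set: T] r ->
  (forall w, 0 <= u w) -> (forall w, 0 <= r w) ->
  (\int[mu]_w (u w * r w)%:E = limn (fun n => \int[mu]_w (Num.min (u w) n%:R * r w)%:E))%E.
Proof.
move=> mu' mr u0 r0; pose G (n : nat) w : \bar R := (Num.min (u w) n%:R * r w)%:E.
have mG n : measurable_fun [set: T] (G n).
  by apply/measurable_EFinP; apply: measurable_funM => //; exact: measurable_minr.
have G0 n w : [set: T] w -> (0 <= G n w)%E.
  by move=> _; rewrite lee_fin mulr_ge0// le_min u0 ler0n.
have ndG w : [set: T] w -> {homo G^~ w : n k / (n <= k)%N >-> (n <= k)%E}.
  move=> _ n k nk; rewrite lee_fin ler_wpM2r// le_min !ge_min lexx/=.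
  by rewrite ler_nat nk orbT.
rewrite -(monotone_convergence _ _ mG G0 ndG)//; apply: eq_integral => w _.
apply/esym/cvg_lim => //; apply: cvg_near_cst; near=> n.
rewrite /G (min_idPl _)//; near: n; exact: nbhs_infty_ger.
Unshelve. all: by end_near. Qed.

(** * Change of variables under a density *)

Section density_transfer.
Context {R : realType} {d d' dS : measure_display} {T : measurableType d}
  {T' : measurableType d'} {S : measurableType dS}.
Variables (P : {measure set T -> \bar R}) (Q : probability T' R).
Variables (X : {mfun T >-> S}) (Y : {mfun T' >-> S}) (rho : S -> R).
Hypotheses (rho0 : forall x, 0 <= rho x) (mrho : measurable_fun [set: S] rho)
  (irho : P.-integrable [set: T] (EFin \o (rho \o X)))
  (QP : forall A, measurable A ->
    Q (Y @^-1` A) = (\int[P]_(w in X @^-1` A) (rho (X w))%:E)%E).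

Lemma density_bounded (eta : S -> R) (B : R) :
  measurable_fun [set: S] eta -> (forall x, `|eta x| <= B) ->
  \int[P]_w (eta (X w) * rho (X w)) = \int[Q]_w eta (Y w).
Proof.
move=> meta etaB; have mX := @measurable_funPT _ _ _ _ X.
have mY := @measurable_funPT _ _ _ _ Y.
transitivity (\int[Q]_w (eta (Y w) * 1)); last by apply: eq_E => w; rewrite mulr1.
apply: (weighted_law_bounded P Q X Y (rho \o X) (fun=> 1) eta B) => //.
  exact: L1_cst.
move=> A mA; rewrite /Rintegral.
rewrite integral_cst; last by rewrite -[_ @^-1` _]setTI; exact: mY.
by rewrite mul1e; congr fine; exact/esym/QP.
Qed.

Lemma density_ge0 (eta : S -> R) : measurable_fun [set: S] eta ->
  (forall x, 0 <= eta x) ->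
  (\int[P]_w (eta (X w) * rho (X w))%:E = \int[Q]_w (eta (Y w))%:E)%E.
Proof.
move=> meta eta0; have mX := @measurable_funPT _ _ _ _ X.
have mY := @measurable_funPT _ _ _ _ Y.
have metaX : measurable_fun [set: T] (fun w => eta (X w)) := measurableT_comp meta mX.
have metaY : measurable_fun [set: T'] (fun w => eta (Y w)) := measurableT_comp meta mY.
have mrX : measurable_fun [set: T] (fun w => rho (X w)) := measurableT_comp mrho mX.
rewrite (ge0_integral_truncation P _ _ metaX mrX)//.
have -> : (\int[Q]_w (eta (Y w))%:E = \int[Q]_w (eta (Y w) * 1)%:E)%E.
  by apply: eq_integral => w _; rewrite mulr1.
rewrite (ge0_integral_truncation Q _ (fun=> 1) metaY)//.
congr (limn _); apply/funext => n.
pose m x := Num.min (eta x) n%:R.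
have mm : measurable_fun [set: S] m by exact: measurable_minr.
have mn x : `|m x| <= n%:R.
  by rewrite ger0_norm ?le_min ?eta0 ?ler0n// ge_min lexx orbT.
have i1 : P.-integrable [set: T] (EFin \o (fun w => m (X w) * rho (X w))).
  by apply: (L1_bounded_mul _ _ _ n%:R) => //; exact: measurableT_comp.
have i2 : Q.-integrable [set: T'] (EFin \o (fun w => m (Y w) * 1)).
  apply: (L1_bounded_mul _ _ _ n%:R) => //; first exact: measurableT_comp.
  exact: L1_cst.
rewrite -[LHS]fineK; last exact: integrable_fin_num i1.
rewrite -[RHS]fineK; last exact: integrable_fin_num i2.
congr (_%:E); rewrite -!/(Rintegral _ _ _).
transitivity (\int[Q]_w m (Y w)); first exact: (density_bounded m n%:R).
by apply: eq_E => w; rewrite mulr1.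
Qed.

Lemma density_L1 (eta : S -> R) : measurable_fun [set: S] eta ->
  Q.-integrable [set: T'] (EFin \o (eta \o Y)) <->
  P.-integrable [set: T] (EFin \o (fun w => eta (X w) * rho (X w))).
Proof.
move=> meta; have mX := @measurable_funPT _ _ _ _ X.
have mY := @measurable_funPT _ _ _ _ Y.
have mn : measurable_fun [set: S] (fun x => `|eta x|) by exact: measurableT_comp.
have e : (\int[P]_w `|(EFin \o (fun w => (eta (X w) * rho (X w))%R)) w| =
          \int[Q]_w `|(EFin \o (eta \o Y)) w|)%E.
  rewrite -(density_ge0 _ mn)//; apply: eq_integral => w _.
  by rewrite /= normrM (ger0_norm (rho0 _)).
split=> /integrableP[_ iy]; apply/integrableP; split; rewrite -?e// ?e//.
- apply/measurable_EFinP; apply: measurable_funM; exact: measurableT_comp.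
- apply/measurable_EFinP; exact: measurableT_comp.
Qed.

Lemma density_E (eta : S -> R) : measurable_fun [set: S] eta ->
  Q.-integrable [set: T'] (EFin \o (eta \o Y)) ->
  \int[P]_w (eta (X w) * rho (X w)) = \int[Q]_w eta (Y w).
Proof.
move=> meta ieta; have mX := @measurable_funPT _ _ _ _ X.
have mY := @measurable_funPT _ _ _ _ Y.
have iP := (density_L1 eta meta).1 ieta.
have mcl n : measurable_fun [set: S] (fun x => clamp n%:R (eta x)).
  exact: measurable_clamp.
have c1 : \int[P]_w (clamp n%:R (eta (X w)) * rho (X w)) @[n --> \oo] -->
    \int[P]_w (eta (X w) * rho (X w)).
  apply: (E_cvg P _ _ (fun w => `|eta (X w) * rho (X w)|)).
  - move=> n; apply: measurable_funM; last exact: measurableT_comp.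
    by apply: (measurableT_comp (mcl n)).
  - by apply: measurable_funM; exact: measurableT_comp.
  - exact: L1_norm.
  - by move=> n w; rewrite !normrM ler_wpM2r// clamp_norm_le.
  - by move=> w; apply: cvgM; [exact: cvg_clamp|exact: cvg_cst].
have c2 : \int[Q]_w (clamp n%:R (eta (Y w))) @[n --> \oo] --> \int[Q]_w eta (Y w).
  apply: (E_cvg Q _ _ (fun w => `|eta (Y w)|)).
  - by move=> n; apply: (measurableT_comp (mcl n)).
  - exact: measurableT_comp.
  - exact: L1_norm.
  - by move=> n w; rewrite clamp_norm_le.
  - by move=> w; exact: cvg_clamp.
suff e : (fun n => \int[P]_w (clamp n%:R (eta (X w)) * rho (X w))) =
    (fun n => \int[Q]_w (clamp n%:R (eta (Y w)))).
  by rewrite e in c1; exact: cvg_unique c1 c2.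
apply/funext => n; apply: (density_bounded _ n%:R (mcl n)) => x.
by rewrite clamp_bound.
Qed.

End density_transfer.

(** * Exchanging one coordinate of the pair *)

Section swap.
Context {R : realType} {N : nat}.
Notation S := (N.-tuple R * N.-tuple R)%type.
Implicit Types (x : N.-tuple R) (i : 'I_N) (p : S) (u : N.-tuple R -> R).

Definition swap i p : S := (resample p.1 p.2 i, resample p.2 p.1 i).

Lemma resample_swap x x' i :
  resample (resample x x' i) (resample x' x i) i = x.
Proof.
apply: eq_from_tnth => j; rewrite !tnth_mktuple.
by case: eqP => [->|_]; rewrite ?eqxx.
Qed.

(** The interpolations at [i] and [i.+1] differ only at the ordinal [i], which is taken from [x'] in
    the former and from [x] in the latter; exchanging that coordinate turns each into the other. *)
Lemma interp_swapS x x' i :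
  interp (resample x x' i) (resample x' x i) i.+1 = interp x x' i.
Proof.
apply: eq_from_tnth => j; rewrite !tnth_mktuple ltnS -(inj_eq val_inj).
by case: ltngtP.
Qed.

Lemma interp_swap x x' i :
  interp (resample x x' i) (resample x' x i) i = interp x x' i.+1.
Proof.
apply: eq_from_tnth => j; rewrite !tnth_mktuple ltnS -(inj_eq val_inj).
by case: ltngtP.
Qed.

Lemma resample_diff_swap u x x' i :
  resample_diff u (resample x x' i) (resample x' x i) i = - resample_diff u x x' i.
Proof. by rewrite /resample_diff resample_swap opprB. Qed.

Lemma interp_diff_swap u x x' i :
  interp_diff u (resample x x' i) (resample x' x i) i = - interp_diff u x x' i.
Proof. by rewrite /interp_diff interp_swapS interp_swap opprB. Qed.

Lemma interp_diff_telescope u x x' :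
  \sum_(i < N) interp_diff u x x' i = u x - u x'.
Proof.
rewrite /interp_diff -(big_mkord xpredT
  (fun k : nat => u (interp x x' k.+1) - u (interp x x' k))).
rewrite (telescope_sumr (fun k => u (interp x x' k)))//.
congr (u _ - u _); apply: eq_from_tnth => j; rewrite tnth_mktuple//.
by rewrite ltn_ord.
Qed.

Lemma measurable_resample d (T : measurableType d) (U V : T -> N.-tuple R) i :
  measurable_fun [set: T] U -> measurable_fun [set: T] V ->
  measurable_fun [set: T] (fun w => resample (U w) (V w) i).
Proof.
move=> mU mV; apply/measurable_fun_tnthP => j.
apply: (eq_measurable_fun (fun w => if j == i then tnth (V w) j else tnth (U w) j)).
  by move=> w _ /=; rewrite tnth_mktuple.
by case: (j == i); apply: (measurableT_comp (measurable_tnth j)).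
Qed.

Lemma measurable_interp d (T : measurableType d) (U V : T -> N.-tuple R) k :
  measurable_fun [set: T] U -> measurable_fun [set: T] V ->
  measurable_fun [set: T] (fun w => interp (U w) (V w) k).
Proof.
move=> mU mV; apply/measurable_fun_tnthP => j.
apply: (eq_measurable_fun (fun w => if (j < k)%N then tnth (U w) j else tnth (V w) j)).
  by move=> w _ /=; rewrite tnth_mktuple.
by case: (j < k)%N; apply: (measurableT_comp (measurable_tnth j)).
Qed.

Definition rect (A : 'I_N -> set R) : set (N.-tuple R) :=
  [set x | forall j, A j (tnth x j)].

Lemma measurable_rect A : (forall j, measurable (A j)) -> measurable (rect A).
Proof.
move=> mA.
rewrite (_ : rect A = \bigcap_(j in [set: 'I_N]) ((@tnth N R)^~ j @^-1` A j)).
  apply: fin_bigcap_measurable => // j _; rewrite -[_ @^-1` _]setTI.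
  exact: measurable_tnth.
by apply/seteqP; split => x /= Ax j; [move=> _|]; exact: Ax.
Qed.

(** Products of boxes: they are closed under intersection, and on them the joint law of [(X, X')] is
    an explicit product over the coordinates. *)
Let rects : set (set S) := [set C | exists A B, [/\ forall j, measurable (A j),
  forall j, measurable (B j) & C = rect A `*` rect B]].

Lemma measurable_rects : (@measurable _ S : set (set S)) = <<s rects >>.
Proof.
apply/seteqP; split; last first.
  apply: smallest_sub; first exact: sigma_algebra_measurable.
  move=> _ [A [B [mA mB ->]]]; apply: measurableX; exact: measurable_rect.
pose G := g_sigma_algebraType rects.
(* A condition on one coordinate is a rectangle whose other sides are full, so all coordinate maps
   are measurable for the generated sigma-algebra. *)
have tn (b : bool) j (C : set R) : measurable C ->
    <<s rects >> [set p : S | C (tnth (if b then p.1 else p.2) j)].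
  move=> mC; apply: sub_sigma_algebra.
  exists (fun k => if b && (k == j) then C else setT),
    (fun k => if ~~ b && (k == j) then C else setT); split.
  - by move=> k; case: ifP.
  - by move=> k; case: ifP.
  - case: b => /=; apply/seteqP; split => -[x y] /=.
    + by move=> Cx; split=> k //=; case: eqP => // ->.
    + by move=> [/(_ j)]; rewrite eqxx.
    + by move=> Cx; split=> k //=; case: eqP => // ->.
    + by move=> [_ /(_ j)]; rewrite eqxx.
have m1 : measurable_fun [set: G] (fst : G -> N.-tuple R).
  apply/measurable_fun_tnthP => j _ C mC; rewrite setTI; exact: (tn true j C mC).
have m2 : measurable_fun [set: G] (snd : G -> N.-tuple R).
  apply/measurable_fun_tnthP => j _ C mC; rewrite setTI; exact: (tn false j C mC).
have mid : measurable_fun [set: G] (fun p : G => (p : S)).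
  by apply/measurable_fun_pairP; split.
by move=> A mA; have := mid measurableT A mA; rewrite setTI.
Qed.

Context {d : measure_display} {T : measurableType d}.
Variables (P : probability T R) (X X' : {RV P >-> N.-tuple R}).
Hypotheses (indX : mutually_independent P (fun i w => tnth (X w) i))
  (lawX' : forall A, measurable A -> distribution P X' A = distribution P X A)
  (indXX' : independent_RV2 P X X').

Let law_rect A : (forall j, measurable (A j)) ->
  P (X @^-1` rect A) = (\prod_(j < N) P ((fun w => tnth (X w) j) @^-1` A j))%E.
Proof.
move=> mA; have := indX [set: 'I_N]%SET A mA.
under eq_bigl do rewrite finset.in_setT.
move=> <-; congr (P _); apply/seteqP; split => w /=.
  by move=> Aw j _; exact: Aw.
by move=> Aw j; apply: Aw; rewrite /= finset.in_setT.
Qed.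

Let law_rects A B : (forall j, measurable (A j)) -> (forall j, measurable (B j)) ->
  P ((fun w => (X w, X' w)) @^-1` (rect A `*` rect B)) =
  (\prod_(j < N) (P ((fun w => tnth (X w) j) @^-1` A j) *
    P ((fun w => tnth (X w) j) @^-1` B j)))%E.
Proof.
move=> mA mB; have mrA := measurable_rect _ mA; have mrB := measurable_rect _ mB.
have := indXX' _ _ mrA mrB.
have -> : (X @^-1` rect A) `&` (X' @^-1` rect B) =
   (fun w => (X w, X' w)) @^-1` (rect A `*` rect B) by [].
move=> ->; rewrite law_rect//.
have -> : P (X' @^-1` rect B) = P (X @^-1` rect B) by exact: lawX'.
by rewrite law_rect// big_split.
Qed.

Definition pair_mfun : {mfun T >-> S} :=
  HB.pack (fun w => (X w, X' w)) (@isMeasurableFun.Build _ _ _ _ _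
    (measurable_fun_pair (@measurable_funPT _ _ _ _ X) (@measurable_funPT _ _ _ _ X'))).

Lemma measurable_swap_pair i : measurable_fun [set: T] (fun w => swap i (X w, X' w)).
Proof.
apply: measurable_fun_pair => /=; apply: measurable_resample; exact: measurable_funPT.
Qed.

Definition swap_mfun i : {mfun T >-> S} :=
  HB.pack (fun w => swap i (X w, X' w))
    (@isMeasurableFun.Build _ _ _ _ _ (measurable_swap_pair i)).

(** On a product of boxes the probability is a product over [j] of [P(X_j in A_j) P(X_j in B_j)].
    The exchange trades [A_i] for [B_i], which permutes the two factors at [i]; uniqueness of
    measures on a generating pi-system does the rest. *)
Lemma swap_law i C : measurable C -> P (pair_mfun @^-1` C) = P (swap_mfun i @^-1` C).
Proof.
move=> mC.
apply: (measure_unique rects (fun=> setT) _ _ _ _ (distribution P pair_mfun)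
  (distribution P (swap_mfun i))) => //.
- exact: measurable_rects.
- move=> _ _ [A [B [mA mB ->]]] [A' [B' [mA' mB' ->]]].
  exists (fun j => A j `&` A' j), (fun j => B j `&` B' j); split.
  + by move=> j; exact: measurableI.
  + by move=> j; exact: measurableI.
  + apply/seteqP; split => -[x y] /=.
      by move=> [[? ?] [? ?]]; split => j; split.
    by move=> [Ax By]; split; split=> j; [case: (Ax j)|case: (By j)|case: (Ax j)|case: (By j)].
- move=> n; exists (fun=> setT), (fun=> setT); split => //.
  by apply/seteqP; split => -[x y].
- by rewrite bigcup_const//; exists 0%N.
- move=> _ [A [B [mA mB ->]]].
  pose A' j := if j == i then B j else A j.
  pose B' j := if j == i then A j else B j.
  transitivity (P ((fun w => (X w, X' w)) @^-1` (rect A `*` rect B))) => //.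
  transitivity (P ((fun w => (X w, X' w)) @^-1` (rect A' `*` rect B'))); last first.
    congr (P _); apply/seteqP; split => w /=.
      move=> [Aw Bw]; split=> j; have := Aw j; have := Bw j;
        by rewrite /A' /B' tnth_mktuple; case: eqP.
    move=> [Aw Bw]; split=> j; have := Aw j; have := Bw j;
      by rewrite /A' /B' !tnth_mktuple; case: eqP.
  rewrite !law_rects//.
  + apply: eq_bigr => j _; rewrite /A' /B'; case: eqP => // _; exact: muleC.
  + by move=> j; rewrite /A'; case: eqP.
  + by move=> j; rewrite /B'; case: eqP.
- by move=> _; apply: (@le_lt_trans _ _ 1%E); [exact: probability_le1|exact: ltry].
Qed.

Lemma L1_swap i (psi : S -> R) : measurable_fun [set: S] psi ->
  P.-integrable [set: T] (EFin \o (fun w => psi (X w, X' w))) ->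
  P.-integrable [set: T] (EFin \o (fun w => psi (swap i (X w, X' w)))).
Proof.
by move=> mpsi; exact: (L1_same_law P pair_mfun (swap_mfun i) psi (swap_law i)).
Qed.

Lemma E_swap i (psi : S -> R) : measurable_fun [set: S] psi ->
  P.-integrable [set: T] (EFin \o (fun w => psi (X w, X' w))) ->
  \int[P]_w psi (X w, X' w) = \int[P]_w psi (swap i (X w, X' w)).
Proof.
by move=> mpsi; exact: (E_same_law P pair_mfun (swap_mfun i) psi (swap_law i)).
Qed.

End swap.

(** * A smooth truncation of the exponential *)

Section trapezoid.
Context {R : realType}.
Implicit Types (f : R -> R) (x y t m M : R).

Lemma mean_value_in f (df : R -> R) m M x y : (forall t, is_derive t 1 f (df t)) ->
  m <= x <= M -> m <= y <= M -> exists2 z, m <= z <= M &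
    [/\ `|z - x| <= `|x - y|, `|z - y| <= `|x - y| & f x - f y = df z * (x - y)].
Proof.
move=> fdf mx my.
case/andP : (mx) => mx1 mx2; case/andP : (my) => my1 my2.
have [xy|yx|->] := ltgtP x y.
- have [c /andP[xc cy] e] := mean_value f df x y xy (fun z _ => fdf z).
  exists c; first by apply/andP; split; lra.
  split; last by rewrite -opprB e; ring.
  + by rewrite gtr0_norm ?subr_gt0// ltr0_norm ?subr_lt0//; lra.
  + by rewrite ltr0_norm ?subr_lt0// ltr0_norm ?subr_lt0//; lra.
- have [c /andP[xc cy] e] := mean_value f df y x yx (fun z _ => fdf z).
  exists c; first by apply/andP; split; lra.
  split => //.
  + by rewrite ltr0_norm ?subr_lt0// gtr0_norm ?subr_gt0//; lra.
  + by rewrite gtr0_norm ?subr_gt0// gtr0_norm ?subr_gt0//; lra.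
- by exists y => //; rewrite !subrr mulr0.
Qed.

(** Three mean value steps, for [D], [f1] and [f2], each yield one factor of size [|x - y|]. The
    sharp factor [1 / 12] is given up. Only a local bound on [f3] is asked for, since here it will
    be an exponential. *)
Lemma trapezoid_error f (f1 f2 f3 : R -> R) m M (B : R) x y :
  (forall t, is_derive t 1 f (f1 t)) -> (forall t, is_derive t 1 f1 (f2 t)) ->
  (forall t, is_derive t 1 f2 (f3 t)) -> (forall t, m <= t <= M -> `|f3 t| <= B) ->
  m <= x <= M -> m <= y <= M ->
  `|f x - f y - (x - y) * ((f1 x + f1 y) / 2)| <= B * `|x - y| ^+ 3.
Proof.
move=> d1 d2 d3 f3B xm ym.
have B0 : 0 <= B := le_trans (normr_ge0 _) (f3B x xm).
pose D t := f t - f y - (t - y) * ((f1 t + f1 y) / 2).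
pose dD t := (f1 t - f1 y - (t - y) * f2 t) / 2.
have DdD t : is_derive t 1 D (dD t).
  have := d1 t => ?; have := d2 t => ?.
  by apply: is_derive_eq; rewrite /GRing.scale/= /dD; field.
have [z zm [_ zy e]] := mean_value_in D dD m M x y DdD xm ym.
have -> : f x - f y - (x - y) * ((f1 x + f1 y) / 2) = D x - D y.
  by rewrite /D !subrr mul0r !subr0.
rewrite e normrM exprSr mulrA ler_wpM2r//.
have [z1 z1m [z1z _ e1]] := mean_value_in f1 f2 m M z y d2 zm ym.
have -> : dD z = (z - y) * ((f2 z1 - f2 z) / 2) by rewrite /dD e1; field.
have [z2 z2m [_ _ ->]] := mean_value_in f2 f3 m M z1 z d3 z1m zm.
rewrite normrM.
apply: (@le_trans _ _ (`|x - y| * (B * `|x - y|))); last by rewrite expr2 mulrCA.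
apply: ler_pM => //; rewrite !normrM normfV (ger0_norm (ler0n _ 2)).
apply: (@le_trans _ _ (`|f3 z2| * `|z1 - z|)).
  by rewrite ler_piMr ?mulr_ge0// invf_le1// ler1n.
by apply: ler_pM => //; [exact: f3B|rewrite (le_trans z1z)].
Qed.

End trapezoid.

Section logistic_weight.
Context {R : realType}.
Implicit Types (c x y t : R).

(* A smooth increasing truncation of [expR] at level [c]; unlike [Num.min] it
   keeps the trapezoidal error of third order. *)
Definition logis c t := expR t / (1 + expR t / c).
Definition logis1 c t := expR t / (1 + expR t / c) ^+ 2.
Definition logis2 c t := expR t * (1 - expR t / c) / (1 + expR t / c) ^+ 3.
Definition logis3 c t := expR t * (1 - 4 * (expR t / c) + (expR t / c) ^+ 2) /
  (1 + expR t / c) ^+ 4.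

Variable c : R.
Hypothesis c0 : 0 < c.

Let s0 t : 0 < expR t / c. Proof. by rewrite divr_gt0// expR_gt0. Qed.
Let s1 t : 0 < 1 + expR t / c. Proof. by rewrite ltr_wpDl. Qed.
Let s1n t : 1 + expR t / c != 0. Proof. by rewrite gt_eqF. Qed.
Let s1ge t : 1 <= 1 + expR t / c. Proof. by rewrite lerDl ltW. Qed.

Let ds t : is_derive t 1 (fun t => 1 + expR t / c) (expR t / c).
Proof. by apply: is_derive_eq; rewrite /GRing.scale/=; ring. Qed.

Let ds2 t : is_derive t 1 (fun t => (1 + expR t / c) ^+ 2)
  (2 * (1 + expR t / c) * (expR t / c)).
Proof.
by have := ds t => ?; apply: is_derive_eq; rewrite /GRing.scale/=; ring.
Qed.

Let ds3 t : is_derive t 1 (fun t => (1 + expR t / c) ^+ 3)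
  (3 * (1 + expR t / c) ^+ 2 * (expR t / c)).
Proof.
by have := ds t => ?; apply: is_derive_eq; rewrite /GRing.scale/=; ring.
Qed.

Let sXn n t : (1 + expR t / c) ^+ n != 0. Proof. by rewrite expf_neq0. Qed.

Lemma is_derive_logis t : is_derive t 1 (logis c) (logis1 c t).
Proof.
have H := is_derive_quotient _ _ _ _ t (is_derive_expR t) (ds t) (s1n t).
apply: is_derive_eq; rewrite /logis1; field.
by rewrite !gt_eqF// addr_gt0// expR_gt0.
Qed.

Lemma is_derive_logis1 t : is_derive t 1 (logis1 c) (logis2 c t).
Proof.
have H := is_derive_quotient _ _ _ _ t (is_derive_expR t) (ds2 t) (sXn _ t).
apply: is_derive_eq; rewrite /logis2; field.
by rewrite !gt_eqF// addr_gt0// expR_gt0.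
Qed.

Lemma is_derive_logis2 t : is_derive t 1 (logis2 c) (logis3 c t).
Proof.
have dn : is_derive t 1 (fun t => expR t * (1 - expR t / c))
    (expR t * (1 - 2 * (expR t / c))).
  by apply: is_derive_eq; rewrite /GRing.scale/=; ring.
have H := is_derive_quotient _ _ _ _ t dn (ds3 t) (sXn _ t).
apply: is_derive_eq; rewrite /logis3; field.
by rewrite !gt_eqF// addr_gt0// expR_gt0.
Qed.

(** [logis1], [logis2] and [logis3] are [expR t] times a rational function of [expR t / c] of
    modulus at most 1. This makes all bounds uniform in the level [c]. *)
Let expR_frac (u : R) n t : `|u| <= (1 + expR t / c) ^+ n ->
  `|expR t * u / (1 + expR t / c) ^+ n| <= expR t.
Proof.
move=> un; rewrite !normrM normfV (gtr0_norm (expR_gt0 t)).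
rewrite (ger0_norm (exprn_ge0 _ (ltW (s1 t)))) -mulrA ler_piMr ?expR_ge0//.
by rewrite ler_pdivrMr ?exprn_gt0// mul1r.
Qed.

Lemma logis_ge0 t : 0 <= logis c t.
Proof. by rewrite divr_ge0 ?expR_ge0// ltW. Qed.

Lemma logis1_ge0 t : 0 <= logis1 c t.
Proof. by rewrite divr_ge0 ?expR_ge0// exprn_ge0// ltW. Qed.

Lemma logis_le_expR t : logis c t <= expR t.
Proof. by rewrite ler_pdivrMr// ler_peMr// expR_ge0. Qed.

Lemma logis_le t : logis c t <= c.
Proof.
rewrite ler_pdivrMr// mulrDr mulr1 mulrCA divff ?gt_eqF// mulr1.
by rewrite lerDr ltW.
Qed.

Lemma logis1_le_logis t : logis1 c t <= logis c t.
Proof.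
rewrite /logis1 /logis ler_wpM2l ?expR_ge0// lef_pV2 ?posrE ?exprn_gt0//.
by rewrite expr2 ler_peMr// ltW.
Qed.

Lemma logis_gt0 t : 0 < logis c t.
Proof. by rewrite divr_gt0 ?expR_gt0. Qed.

Lemma logis2_norm t : `|logis2 c t| <= expR t.
Proof.
apply: expR_frac; have s := s0 t; set u := expR t / c in s *.
have -> : (1 + u) ^+ 3 = 1 + 3 * u + 3 * u ^+ 2 + u ^+ 3 by ring.
have u2 : 0 <= u ^+ 2 by rewrite sqr_ge0.
have u3 : 0 <= u ^+ 3 by rewrite exprn_ge0// ltW.
by rewrite ler_norml; apply/andP; split; lra.
Qed.

Lemma logis3_norm t : `|logis3 c t| <= expR t.
Proof.
apply: expR_frac; have s := s0 t; set u := expR t / c in s *.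
have -> : (1 + u) ^+ 4 = 1 + 4 * u + 6 * u ^+ 2 + 4 * u ^+ 3 + u ^+ 4 by ring.
have u2 : 0 <= u ^+ 2 by rewrite sqr_ge0.
have u3 : 0 <= u ^+ 3 by rewrite exprn_ge0// ltW.
have u4 : 0 <= u ^+ 4 by rewrite exprn_ge0// ltW.
by rewrite ler_norml; apply/andP; split; lra.
Qed.

Let near_le x y t : x - `|x - y| <= t <= x + `|x - y| ->
  expR t <= expR x * expR `|x - y|.
Proof. by move=> /andP[_ tx]; rewrite -expRD ler_expR. Qed.

Let in_range x y : (x - `|x - y| <= x <= x + `|x - y|) &&
  (x - `|x - y| <= y <= x + `|x - y|).
Proof.
rewrite gerBl lerDl normr_ge0/=; have := ler_norm (x - y).
have := ler_norm (y - x); rewrite (distrC y) => ? ?.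
by apply/andP; split; lra.
Qed.

Lemma logis_increment x y :
  `|logis c x - logis c y| <= expR x * expR `|x - y| * `|x - y|.
Proof.
have /andP[hx hy] := in_range x y.
have [z zm [_ _ ->]] := mean_value_in _ _ _ _ x y is_derive_logis hx hy.
rewrite normrM ler_wpM2r// (le_trans _ (near_le x y z zm))//.
by rewrite ger0_norm ?logis1_ge0// (le_trans (logis1_le_logis _))// logis_le_expR.
Qed.

Lemma logis1_increment x y :
  `|logis1 c x - logis1 c y| <= expR x * expR `|x - y| * `|x - y|.
Proof.
have /andP[hx hy] := in_range x y.
have [z zm [_ _ ->]] := mean_value_in _ _ _ _ x y is_derive_logis1 hx hy.
by rewrite normrM ler_wpM2r// (le_trans _ (near_le x y z zm))// logis2_norm.
Qed.

Lemma logis_trapezoid x y :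
  `|logis c x - logis c y - (x - y) * ((logis1 c x + logis1 c y) / 2)| <=
  expR x * expR `|x - y| * `|x - y| ^+ 3.
Proof.
have /andP[hx hy] := in_range x y.
apply: (trapezoid_error _ _ _ _ _ _ _ x y is_derive_logis is_derive_logis1
  is_derive_logis2 _ hx hy) => z zm.
by rewrite (le_trans _ (near_le x y z zm))// logis3_norm.
Qed.

(* Discrete product rule for [F * logis c g]: [u, v] are the values of [F] and
   [x, y] those of [g] at two points, [D] is the increment of [f]. *)
Lemma logis_product_rule (A u v D x y : R) : `|u| <= A -> `|v| <= A ->
  `|u - v| <= A * `|D| ->
  `|(logis c x * u - logis c y * v)
    - ((logis c x + logis c y) / 2 * (u - v)
       + (x - y) * ((logis1 c x * u + logis1 c y * v) / 2))| <=
  A * (expR x * expR `|x - y| * (x - y) ^+ 2 * (`|x - y| + `|D|)).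
Proof.
move=> uA vA uvA; have A0 := le_trans (normr_ge0 _) uA.
set T := logis c x - logis c y - (x - y) * ((logis1 c x + logis1 c y) / 2).
(* The increment of a product is the mean of each factor times the increment of the other, and the
   mean of a product is the product of means plus a quarter of the product of increments. The first
   remaining term carries the trapezoidal error and gives the summand [|x - y|]; the second gives
   [|D|]. *)
have -> : (logis c x * u - logis c y * v)
    - ((logis c x + logis c y) / 2 * (u - v)
       + (x - y) * ((logis1 c x * u + logis1 c y * v) / 2)) =
  T * ((u + v) / 2) - (x - y) * (logis1 c x - logis1 c y) * ((u - v) / 4).
  by rewrite /T; field.
set E := expR x * expR `|x - y|.
have E0 : 0 <= E by rewrite mulr_ge0 ?expR_ge0.
rewrite (le_trans (ler_normB _ _))//.
have t1 : `|T| * `|(u + v) / 2| <= A * (E * (x - y) ^+ 2 * `|x - y|).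
  rewrite mulrC ler_pM//.
    rewrite normrM normfV (ger0_norm (ler0n _ 2)) ler_pdivrMr//.
    rewrite (le_trans (ler_normD _ _))//; lra.
  rewrite (le_trans (logis_trapezoid x y))// -/E -mulrA ler_wpM2l//.
  by rewrite exprSr real_normK ?num_real.
have t2 : `|x - y| * `|logis1 c x - logis1 c y| * `|(u - v) / 4| <=
    A * (E * (x - y) ^+ 2 * `|D|).
  rewrite (@le_trans _ _ ((E * (x - y) ^+ 2) * (A * `|D|)))//; last first.
    by rewrite mulrCA.
  apply: ler_pM => //.
    have -> : E * (x - y) ^+ 2 = `|x - y| * (E * `|x - y|).
      by rewrite -(real_normK (num_real (x - y))); ring.
    by rewrite ler_wpM2l// logis1_increment.
  rewrite normrM normfV (ger0_norm (ler0n _ 4)) (le_trans _ uvA)//.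
  by rewrite ler_piMr// invf_le1// ler1n.
rewrite (normrM T) (normrM (_ * _)) (normrM (x - y)).
by rewrite (le_trans (lerD t1 t2))// -mulrDr -mulrDr.
Qed.

End logistic_weight.

Section logistic_limits.
Context {R : realType}.

Lemma cvg_logis (t : R) : logis n.+1%:R t @[n --> \oo] --> expR t.
Proof.
rewrite [X in _ --> X](_ : expR t = expR t * 1^-1); last by rewrite invr1 mulr1.
apply: cvgM; first exact: cvg_cst.
apply: cvgV; first exact: oner_neq0.
rewrite [X in _ --> X](_ : 1 = 1 + expR t * 0); last by rewrite mulr0 addr0.
apply: cvgD; first exact: cvg_cst.
apply: cvgM; first exact: cvg_cst.
exact: cvg_harmonic.
Qed.

Lemma cvg_logis1 (t : R) : logis1 n.+1%:R t @[n --> \oo] --> expR t.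
Proof.
rewrite [X in _ --> X](_ : expR t = expR t * 1^-1); last by rewrite invr1 mulr1.
apply: cvgM; first exact: cvg_cst.
apply: cvgV; first exact: oner_neq0.
rewrite [X in _ --> X](_ : 1 = (1 + expR t * 0) * (1 + expR t * 0)); last by rewrite mulr0 addr0 mulr1.
have H : 1 + expR t / n.+1%:R @[n --> \oo] --> 1 + expR t * 0.
  apply: cvgD; first exact: cvg_cst.
  by apply: cvgM; [exact: cvg_cst|exact: cvg_harmonic].
exact: cvgM.
Qed.

Lemma measurable_logis d (T : measurableType d) (c : R) (u : T -> R) : 0 < c ->
  measurable_fun [set: T] u -> measurable_fun [set: T] (fun w => logis c (u w)).
Proof.
move=> c0; apply: measurableT_comp; apply: continuous_measurable_fun => t.
exact: is_derive_continuous (is_derive_logis c c0 t).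
Qed.

Lemma measurable_logis1 d (T : measurableType d) (c : R) (u : T -> R) : 0 < c ->
  measurable_fun [set: T] u -> measurable_fun [set: T] (fun w => logis1 c (u w)).
Proof.
move=> c0; apply: measurableT_comp; apply: continuous_measurable_fun => t.
exact: is_derive_continuous (is_derive_logis1 c c0 t).
Qed.

End logistic_limits.

(** * The exchange identity *)

Section exchange_step.
Context {R : realType} {N : nat} {d : measure_display} {T : measurableType d}.
Notation S := (N.-tuple R * N.-tuple R)%type.
Variables (P : probability T R) (X X' : {RV P >-> N.-tuple R})
  (f g : {mfun N.-tuple R >-> R}).
Hypotheses (indX : mutually_independent P (fun i w => tnth (X w) i))
  (lawX' : forall A, measurable A -> distribution P X' A = distribution P X A)
  (indXX' : independent_RV2 P X X').
Local Notation L1 u := (P.-integrable [set: T] (EFin \o (u : T -> R))).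
Local Notation E u := (\int[P]_w (u w)).

Local Notation RD u i w := (resample_diff u (X w) (X' w) i).
Local Notation ID u i w := (interp_diff u (X w) (X' w) i).
Local Notation tau i w := (expR (g (X w)) * expR `|RD g i w| * RD g i w ^+ 2 *
  (`|RD g i w| + `|RD f i w|) * `|ID f i w|).

Lemma measurable_on_pair (psi : S -> R) : measurable_fun [set: S] psi ->
  measurable_fun [set: T] (fun w => psi (X w, X' w)).
Proof.
move=> mpsi; apply: (measurableT_comp mpsi).
by apply: measurable_fun_pair; exact: measurable_funPT.
Qed.

Lemma measurable_coord1 (u : N.-tuple R -> R) : measurable_fun setT u ->
  measurable_fun [set: S] (fun p => u p.1).
Proof. by move=> mu; apply: (measurableT_comp mu); exact: measurable_fst. Qed.

Lemma measurable_coord_resample (u : N.-tuple R -> R) i : measurable_fun setT u ->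
  measurable_fun [set: S] (fun p => u (resample p.1 p.2 i)).
Proof.
move=> mu; apply: (measurableT_comp mu); apply: measurable_resample.
  exact: measurable_fst.
exact: measurable_snd.
Qed.

Lemma measurable_resample_diff (u : N.-tuple R -> R) i : measurable_fun setT u ->
  measurable_fun [set: S] (fun p => resample_diff u p.1 p.2 i).
Proof.
move=> mu; apply: measurable_funB; first exact: measurable_coord1.
exact: measurable_coord_resample.
Qed.

Lemma measurable_interp_diff (u : N.-tuple R -> R) i : measurable_fun setT u ->
  measurable_fun [set: S] (fun p => interp_diff u p.1 p.2 i).
Proof.
move=> mu; apply: measurable_funB; apply: (measurableT_comp mu);
  apply: measurable_interp; by [exact: measurable_fst|exact: measurable_snd].
Qed.

Lemma E_symmetrize i (psi : S -> R) : measurable_fun [set: S] psi ->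
  L1 (fun w => psi (X w, X' w)) ->
  E (fun w => psi (X w, X' w)) =
  E (fun w => (psi (X w, X' w) + psi (swap i (X w, X' w))) / 2).
Proof.
move=> mpsi ipsi.
have ips := L1_swap P X X' indX lawX' indXX' i psi mpsi ipsi.
transitivity (E (fun w => 2^-1 * (psi (X w, X' w) + psi (swap i (X w, X' w))))).
  rewrite EZ; last exact: L1D.
  by rewrite ED// -(E_swap P X X' indX lawX' indXX' i psi mpsi ipsi); field.
by apply: eq_E => w; rewrite mulrC.
Qed.

(** Independence is given on events and is extended one factor at a time: under [X], an indicator of
    [X'] weighs as much as its probability; then, under [X'], the weight [u (X w)] is equivalent to
    its mean. *)
Lemma E_independent (u v : N.-tuple R -> R) (A B : R) :
  measurable_fun setT u -> measurable_fun setT v ->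
  (forall x, `|u x| <= A) -> (forall x, `|v x| <= B) ->
  E (fun w => u (X w) * v (X' w)) = E (fun w => u (X w)) * E (fun w => v (X' w)).
Proof.
move=> mu mv uA vB.
have mX := @measurable_funPT _ _ _ _ X; have mX' := @measurable_funPT _ _ _ _ X'.
have muX : measurable_fun [set: T] (fun w => u (X w)) := measurableT_comp mu mX.
have mvX' : measurable_fun [set: T] (fun w => v (X' w)) := measurableT_comp mv mX'.
have indic_E (C : set T) : measurable C -> E (\1_C) = fine (P C).
  by move=> mC; rewrite /Rintegral integral_indic// setIT.
have pre (U : {RV P >-> N.-tuple R}) C : measurable C -> measurable (U @^-1` C).
  by move=> mC; rewrite -[_ @^-1` _]setTI; exact: (@measurable_funPT _ _ _ _ U).
have i1 C : measurable C -> L1 (\1_C : T -> R).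
  by move=> mC; apply: (L1_bounded P _ 1) => [|w];
    [exact: measurable_indic|rewrite indicE; case: (_ \in _); rewrite ?normr1 ?normr0].
have step1 C : measurable C ->
    E (fun w => u (X w) * \1_(X' @^-1` C) w) = E (fun w => u (X w)) * fine (P (X' @^-1` C)).
  move=> mC.
  rewrite (weighted_law_bounded P P X X _ (fun=> fine (P (X' @^-1` C))) u A)//.
  - transitivity (E (fun w => fine (P (X' @^-1` C)) * u (X w))).
      by apply: eq_E => w; rewrite mulrC.
    rewrite EZ; first exact: mulrC.
    by apply: (L1_bounded P _ A) => [|w]; [exact: muX|exact: uA].
  - by apply: i1; exact: pre.
  - exact: L1_cst.
  - move=> A' mA'; rewrite Rintegral_cst; last exact: pre.
    rewrite /Rintegral integral_indic; [|exact: pre|exact: pre].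
    have Pfin (C' : set T) : measurable C' -> P C' \is a fin_num by exact: fin_num_measure.
    rewrite setIC -fineM ?Pfin//; [|exact: pre|exact: pre].
    by rewrite muleC; congr fine; exact: indXX'.
transitivity (E (fun w => v (X' w) * u (X w))).
  by apply: eq_E => w; rewrite mulrC.
rewrite (weighted_law_bounded P P X' X' (fun w => u (X w)) (fun=> E (fun w => u (X w))) v B)//.
- transitivity (E (fun w => E (fun w => u (X w)) * v (X' w))).
    by apply: eq_E => w; rewrite mulrC.
  by rewrite EZ//; exact: (L1_bounded P _ B mvX').
- exact: (L1_bounded P _ A muX).
- exact: L1_cst.
- move=> C mC; rewrite Rintegral_cst; last exact: pre.
  rewrite -step1// Rintegral_mkcond; apply: eq_E => w.
  by rewrite patchE indicE; case: (_ \in _); rewrite ?mulr1 ?mulr0.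
Qed.

Section level.
Variable c : R.
Hypothesis c0 : 0 < c.
Variables (F : R -> R) (A : R).
Hypotheses (mF : measurable_fun [set: R] F) (FA : forall x, `|F x| <= A)
  (FL : forall x y, `|F x - F y| <= A * `|x - y|).

Let phi x := logis c (g x).
Let wt x := logis1 c (g x).
Let df i p := resample_diff f p.1 p.2 i.
Let dg i p := resample_diff g p.1 p.2 i.
Let If i p := interp_diff f p.1 p.2 i.
Let dF i p := resample_diff (F \o f) p.1 p.2 i.
Let fK (K : R) x := clamp K (f x).
Let IfK K i p := interp_diff (fK K) p.1 p.2 i.
Let V w : S := (X w, X' w).

Hypotheses (itau : forall i, L1 (fun w => tau i w))
  (idg : forall i, L1 (fun w => RD g i w * ID f i w))
  (idf : forall i, L1 (fun w => RD f i w * ID f i w)).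

Let mf : measurable_fun setT f. Proof. exact: measurable_funPT. Qed.
Let mg : measurable_fun setT g. Proof. exact: measurable_funPT. Qed.
Let mphi : measurable_fun setT phi. Proof. exact: measurable_logis. Qed.
Let mwt : measurable_fun setT wt. Proof. exact: measurable_logis1. Qed.
Let mFf : measurable_fun setT (F \o f). Proof. exact: measurableT_comp. Qed.
Let mfK K : measurable_fun setT (fK K). Proof. exact: measurable_clamp. Qed.
Let phi_ge0 x : 0 <= phi x. Proof. exact: logis_ge0. Qed.
Let phi_le x : phi x <= c. Proof. exact: logis_le. Qed.
Let wt_ge0 x : 0 <= wt x. Proof. exact: logis1_ge0. Qed.
Let wt_le x : wt x <= c.
Proof. by rewrite (le_trans (logis1_le_logis _ _ _)) ?logis_le. Qed.

Let IfK_le K i p : 0 <= K -> `|IfK K i p| <= `|If i p|.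
Proof. by move=> K0; exact: clamp_lipschitz. Qed.

Let IfK_bound K i p : 0 <= K -> `|IfK K i p| <= 2 * K.
Proof.
move=> K0; rewrite (le_trans (ler_normB _ _))//.
have := clamp_bound K (f (interp p.1 p.2 i.+1)) K0.
have := clamp_bound K (f (interp p.1 p.2 i)) K0; rewrite /fK; lra.
Qed.

Let dF_le i p : `|dF i p| <= A * `|df i p|. Proof. exact: FL. Qed.
Let dF_bound i p : `|dF i p| <= 2 * A.
Proof.
rewrite (le_trans (ler_normB _ _))//=.
have := FA (f p.1); have := FA (f (resample p.1 p.2 i)); lra.
Qed.

Let wF x := wt x * F (f x).
Let pF x := phi x * F (f x).
Let mwF : measurable_fun setT wF. Proof. exact: measurable_funM. Qed.
Let mpF : measurable_fun setT pF. Proof. exact: measurable_funM. Qed.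
Let wF_bound x : `|wF x| <= c * A.
Proof. by rewrite normrM (ger0_norm (wt_ge0 _)) ler_pM. Qed.
Let pF_bound x : `|pF x| <= c * A.
Proof. by rewrite normrM (ger0_norm (phi_ge0 _)) ler_pM. Qed.

Let mI K i : measurable_fun [set: S] (IfK K i).
Proof. exact: measurable_interp_diff. Qed.
Let mdg i : measurable_fun [set: S] (dg i).
Proof. exact: measurable_resample_diff. Qed.
Let mdF i : measurable_fun [set: S] (dF i).
Proof. exact: measurable_resample_diff. Qed.

(** The exchange reverses [I_i], so symmetrizing the first expectation gives half the increment of
    [pF] times [I_i]. In the other two, both increments are reversed, their product is invariant,
    and symmetrizing only averages the weights: these averages are the ones in [logis_product_rule].
    Clamping makes the first integrand bounded. *)
Lemma exchange_term K i : 0 <= K ->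
  `|E (fun w => pF (X w) * IfK K i (V w))
    - 2^-1 * (E (fun w => phi (X w) * dF i (V w) * IfK K i (V w))
       + E (fun w => wF (X w) * (dg i (V w) * IfK K i (V w))))| <= 2^-1 * A * E (fun w => tau i w).
Proof.
move=> K0.
pose ps1 (p : S) := pF p.1 * IfK K i p.
pose ps2 (p : S) := phi p.1 * dF i p * IfK K i p.
pose ps3 (p : S) := wF p.1 * (dg i p * IfK K i p).
have m1 : measurable_fun [set: S] ps1.
  by apply: measurable_funM => //; exact: measurable_coord1.
have m2 : measurable_fun [set: S] ps2.
  by apply: measurable_funM => //; apply: measurable_funM => //; exact: measurable_coord1.
have m3 : measurable_fun [set: S] ps3.
  apply: measurable_funM; first exact: measurable_coord1.
  exact: measurable_funM.
have i1 : L1 (fun w => ps1 (V w)).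
  apply: (L1_bounded P _ (c * A * (2 * K))); first exact: measurable_on_pair.
  by move=> w; rewrite /ps1 (normrM (pF _)); apply: ler_pM => //; exact: IfK_bound.
have i2 : L1 (fun w => ps2 (V w)).
  apply: (L1_bounded P _ (c * (2 * A) * (2 * K))); first exact: measurable_on_pair.
  move=> w; rewrite /ps2 (normrM (phi _ * _)) (normrM (phi _)) (ger0_norm (phi_ge0 _)).
  apply: ler_pM => //; [exact: mulr_ge0|exact: ler_pM|exact: IfK_bound].
have i3 : L1 (fun w => ps3 (V w)).
  apply: (L1_dom P _ (fun w => c * A * `|dg i (V w) * If i (V w)|)).
  - exact: measurable_on_pair.
  - move=> w; rewrite /ps3 (normrM (wF _)); apply: ler_pM => //.
    by rewrite (normrM (dg _ _)) (normrM (dg _ _)) ler_wpM2l// IfK_le.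
  - by apply: L1Z; exact: (L1_norm P _ (idg i)).
have sw (ps : S -> R) : measurable_fun [set: S] ps -> L1 (fun w => ps (V w)) ->
    L1 (fun w => (ps (V w) + ps (swap i (V w))) / 2).
  move=> mps ips; have ips' := L1_swap P X X' indX lawX' indXX' i ps mps ips.
  have := L1Z P 2^-1 _ (L1D P _ _ ips ips').
  by congr (P.-integrable _ (EFin \o _)); apply/funext => w; rewrite mulrC.
rewrite -/(ps1 (V _)) (E_symmetrize i ps1 m1 i1) (E_symmetrize i ps2 m2 i2) (E_symmetrize i ps3 m3 i3).
have j1 := sw _ m1 i1; have j2 := sw _ m2 i2; have j3 := sw _ m3 i3.
rewrite -(ED P _ _ j2 j3).
rewrite -(EZ P 2^-1 _ (L1D P _ _ j2 j3)) -(EB P _ _ j1 (L1Z P 2^-1 _ (L1D P _ _ j2 j3))).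
rewrite -(EZ P (2^-1 * A) _ (itau i)).
have j4 := L1B P _ _ j1 (L1Z P 2^-1 _ (L1D P _ _ j2 j3)).
apply: (E_dom P _ _ (L1_measurable P _ j4)); last exact: (L1Z P (2^-1 * A) _ (itau i)).
move=> w; set p := V w; set p' := swap i p.
have eI : IfK K i p' = - IfK K i p by exact: interp_diff_swap.
have edF : dF i p' = - dF i p by exact: resample_diff_swap.
have edg : dg i p' = - dg i p by exact: resample_diff_swap.
rewrite /ps1 /ps2 /ps3 eI edF edg.
have -> : (pF p.1 * IfK K i p + pF p'.1 * - IfK K i p) / 2 -
  2^-1 * ((phi p.1 * dF i p * IfK K i p + phi p'.1 * - dF i p * - IfK K i p) / 2 +
    (wF p.1 * (dg i p * IfK K i p) + wF p'.1 * (- dg i p * - IfK K i p)) / 2) =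
  2^-1 * ((pF p.1 - pF p'.1 - ((phi p.1 + phi p'.1) / 2 * dF i p +
     dg i p * ((wF p.1 + wF p'.1) / 2))) * IfK K i p) by field.
rewrite normrM (ger0_norm (_ : 0 <= 2^-1)) ?invr_ge0// -[leRHS]mulrA.
apply: ler_wpM2l; first by rewrite invr_ge0.
rewrite (normrM _ (IfK K i p)) [leRHS]mulrA; apply: ler_pM => //; last exact: IfK_le.
exact: (logis_product_rule c c0 A (F (f p.1)) (F (f p'.1)) (df i p) (g p.1) (g p'.1)).
Qed.

Lemma exchange_truncated K : 0 <= K ->
  `|E (fun w => logis c (g (X w)) * F (f (X w)) * clamp K (f (X w)))
    - E (fun w => logis c (g (X w)) * F (f (X w))) * E (fun w => clamp K (f (X' w)))
    - 2^-1 * \sum_(i < N)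
       (E (fun w => logis c (g (X w)) * RD (F \o f) i w * ID (fun x => clamp K (f x)) i w)
      + E (fun w => logis1 c (g (X w)) * F (f (X w)) *
           (RD g i w * ID (fun x => clamp K (f x)) i w)))|
  <= 2^-1 * A * \sum_(i < N) E (fun w => tau i w).
Proof.
move=> K0.
have mX := @measurable_funPT _ _ _ _ X.
have fK_bound x : `|fK K x| <= K by exact: clamp_bound.
have ipF : L1 (fun w => pF (X w) * fK K (X w)).
  apply: (L1_bounded P _ (c * A * K)).
    by apply: measurable_funM; [exact: (measurableT_comp mpF mX)|exact: (measurableT_comp (mfK K) mX)].
  by move=> w; rewrite (normrM (pF _)); apply: ler_pM.
have ipF' : L1 (fun w => pF (X w) * fK K (X' w)).
  apply: (L1_bounded P _ (c * A * K)).
    apply: measurable_funM; first exact: (measurableT_comp mpF mX).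
    exact: (measurableT_comp (mfK K) (@measurable_funPT _ _ _ _ X')).
  by move=> w; rewrite (normrM (pF _)); apply: ler_pM.
have iI i : L1 (fun w => pF (X w) * IfK K i (V w)).
  apply: (L1_bounded P _ (c * A * (2 * K))).
    apply: (measurable_on_pair (fun p => pF p.1 * IfK K i p)).
    by apply: measurable_funM => //; exact: measurable_coord1.
  by move=> w; rewrite (normrM (pF _)); apply: ler_pM => //; exact: IfK_bound.
(* Read backwards, independence puts the product of means under a single expectation, where
   [f_K(X) - f_K(X')] telescopes. *)
rewrite -(E_independent pF (fK K) (c * A) K)//.
rewrite -(EB P _ _ ipF ipF').
have -> : E (fun w => pF (X w) * fK K (X w) - pF (X w) * fK K (X' w)) =
    \sum_(i < N) E (fun w => pF (X w) * IfK K i (V w)).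
  rewrite -E_sum//; apply: eq_E => w.
  by rewrite -mulr_sumr interp_diff_telescope mulrBr.
rewrite !mulr_sumr -sumrB (le_trans (ler_norm_sum _ _ _))//.
by apply: ler_sum => i _; exact: exchange_term.
Qed.

Let pF_le w : `|pF (X w)| <= A * expR (g (X w)).
Proof.
rewrite /pF (normrM (phi _)) mulrC; apply: ler_pM => //.
by rewrite (ger0_norm (phi_ge0 _)); exact: logis_le_expR.
Qed.

Hypothesis ihf : L1 (fun w => expR (g (X w)) * f (X w)).

(** The level [c] is still fixed, so the weights are bounded. The dominating functions are multiples
    of [h f(X)] and of the two products of increments whose conditional expectations define
    [Delta_1] and [Delta_2]. *)
Lemma cvg_truncated_terms :
  E (fun w => logis c (g (X w)) * F (f (X w)) * clamp k%:R (f (X w))) @[k --> \oo] -->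
    E (fun w => logis c (g (X w)) * F (f (X w)) * f (X w)) /\
  forall i,
  E (fun w => logis c (g (X w)) * RD (F \o f) i w * ID (fun x => clamp k%:R (f x)) i w)
    @[k --> \oo] --> E (fun w => logis c (g (X w)) * RD (F \o f) i w * ID f i w) /\
  E (fun w => logis1 c (g (X w)) * F (f (X w)) *
           (RD g i w * ID (fun x => clamp k%:R (f x)) i w)) @[k --> \oo] -->
    E (fun w => logis1 c (g (X w)) * F (f (X w)) * (RD g i w * ID f i w)).
Proof.
have mX := @measurable_funPT _ _ _ _ X.
have cvgI i w : ID (fun x => clamp k%:R (f x)) i w @[k --> \oo] --> ID f i w.
  by apply: cvgB; exact: cvg_clamp.
have mIf i : measurable_fun [set: S] (If i) by exact: measurable_interp_diff.
split.
  apply: (E_cvg P _ _ (fun w => A * `|expR (g (X w)) * f (X w)|)).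
  - move=> k; apply: measurable_funM; first exact: (measurableT_comp mpF mX).
    exact: (measurableT_comp (mfK k%:R) mX).
  - by apply: measurable_funM; [exact: (measurableT_comp mpF mX)|exact: (measurableT_comp mf mX)].
  - by apply: L1Z; exact: L1_norm.
  - move=> k w; rewrite (normrM (_ * F _)) (normrM (expR _)) mulrA.
    rewrite (ger0_norm (expR_ge0 _)); apply: ler_pM => //; first exact: pF_le.
    exact: clamp_norm_le.
  - by move=> w; apply: cvgM; [exact: cvg_cst|exact: cvg_clamp].
move=> i; split.
  apply: (E_cvg P _ _ (fun w => c * A * `|RD f i w * ID f i w|)).
  - move=> k; apply: (measurable_on_pair (fun p => phi p.1 * dF i p * IfK k%:R i p)).
    by apply: measurable_funM => //; apply: measurable_funM => //; exact: measurable_coord1.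
  - apply: (measurable_on_pair (fun p => phi p.1 * dF i p * If i p)).
    by apply: measurable_funM => //; apply: measurable_funM => //; exact: measurable_coord1.
  - by apply: L1Z; exact: L1_norm.
  - move=> k w; rewrite (normrM (_ * _)) (normrM (RD f i w)) mulrA.
    apply: ler_pM => //; last exact: (IfK_le k%:R i (V w)).
    rewrite (normrM (logis _ _)) -mulrA; apply: ler_pM => //; last exact: (dF_le i (V w)).
    by rewrite (ger0_norm (phi_ge0 _)); exact: phi_le.
  - by move=> w; apply: cvgM; [exact: cvg_cst|exact: cvgI].
apply: (E_cvg P _ _ (fun w => c * A * `|RD g i w * ID f i w|)).
- move=> k; apply: (measurable_on_pair (fun p => wF p.1 * (dg i p * IfK k%:R i p))).
  by apply: measurable_funM; [exact: measurable_coord1|exact: measurable_funM].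
- apply: (measurable_on_pair (fun p => wF p.1 * (dg i p * If i p))).
  by apply: measurable_funM; [exact: measurable_coord1|exact: measurable_funM].
- by apply: L1Z; exact: L1_norm.
- move=> k w; rewrite (normrM (_ * F _)); apply: ler_pM => //; first exact: wF_bound.
  by rewrite (normrM (RD g i w)) (normrM (RD g i w)) ler_wpM2l//; exact: (IfK_le k%:R i (V w)).
- by move=> w; apply: cvgM; [exact: cvg_cst|apply: cvgM; [exact: cvg_cst|exact: cvgI]].
Qed.

End level.

End exchange_step.

(** * Removal of the clamp and of the cutoff of the weight *)

Section exchange_limit.
Context {R : realType} {N : nat} {d : measure_display} {T : measurableType d}.
Variables (P : probability T R) (X X' : {RV P >-> N.-tuple R})
  (f g : {mfun N.-tuple R >-> R}).
Hypotheses (indX : mutually_independent P (fun i w => tnth (X w) i))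
  (lawX' : forall A, measurable A -> distribution P X' A = distribution P X A)
  (indXX' : independent_RV2 P X X').
Local Notation L1 u := (P.-integrable [set: T] (EFin \o (u : T -> R))).
Local Notation E u := (\int[P]_w (u w)).
Local Notation RD u i w := (resample_diff u (X w) (X' w) i).
Local Notation ID u i w := (interp_diff u (X w) (X' w) i).
Local Notation tau i w := (expR (g (X w)) * expR `|RD g i w| * RD g i w ^+ 2 *
  (`|RD g i w| + `|RD f i w|) * `|ID f i w|).
Variables Delta1 Delta2 : 'I_N -> N.-tuple R -> R.
Hypotheses (itau : forall i, L1 (fun w => tau i w))
  (D1 : forall i, Delta_spec P X X' f f i (Delta1 i))
  (D2 : forall i, Delta_spec P X X' f g i (Delta2 i))
  (ih : L1 (fun w => expR (g (X w))))
  (ihf : L1 (fun w => expR (g (X w)) * f (X w)))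
  (ihD1 : L1 (fun w => expR (g (X w)) * \sum_(i < N) Delta1 i (X w)))
  (ihD2 : L1 (fun w => expR (g (X w)) * \sum_(i < N) Delta2 i (X w))).

Lemma cvg_norm_le (u : R^nat) (l B : R) :
  u n @[n --> \oo] --> l -> (forall n, `|u n| <= B) -> `|l| <= B.
Proof.
move=> ul uB; apply/ler_addgt0Pr => e e0.
move/cvgrPdist_lt : ul => /(_ e e0)[n _ /(_ n (leqnn n))] /= H.
have -> : l = (l - u n) + u n by ring.
by rewrite (le_trans (ler_normD _ _))// addrC lerD// ltW.
Qed.

Lemma cvg_sumr (I : Type) (r : seq I) (u : nat -> I -> R) (v : I -> R) :
  (forall i, u n i @[n --> \oo] --> v i) ->
  \sum_(i <- r) u n i @[n --> \oo] --> \sum_(i <- r) v i.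
Proof.
move=> uv; elim: r => [|i r IH].
  by rewrite big_nil; under eq_fun do rewrite big_nil; exact: cvg_cst.
rewrite big_cons; under eq_fun do rewrite big_cons.
by apply: cvgD.
Qed.

Let mX : measurable_fun [set: T] X. Proof. exact: measurable_funPT. Qed.
Let mfX : measurable_fun [set: T] (fun w => f (X w)).
Proof. exact: (measurableT_comp (@measurable_funPT _ _ _ _ f) mX). Qed.
Let mgX : measurable_fun [set: T] (fun w => g (X w)).
Proof. exact: (measurableT_comp (@measurable_funPT _ _ _ _ g) mX). Qed.

Lemma Delta_spec_L1 u i Delta : Delta_spec P X X' f u i Delta ->
  L1 (fun w => RD u i w * ID f i w).
Proof. by move=> [cu []]. Qed.

Lemma Delta_spec_measurable u i Delta : Delta_spec P X X' f u i Delta ->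
  measurable_fun [set: N.-tuple R] Delta.
Proof.
move=> [cu [_ mcu _ _] De]; rewrite (_ : Delta = fun x => 2^-1 * cu x).
  exact: measurable_funM.
exact/funext.
Qed.

Lemma Delta_spec_integrable u i Delta : Delta_spec P X X' f u i Delta ->
  L1 (fun w => Delta (X w)).
Proof.
move=> [cu [_ _ icu _] De]; have := L1Z P 2^-1 _ icu.
by congr (P.-integrable _ (EFin \o _)); apply/funext => w; rewrite De.
Qed.

Lemma Delta_spec_E u i Delta (eta : N.-tuple R -> R) (B : R) :
  Delta_spec P X X' f u i Delta ->
  measurable_fun [set: N.-tuple R] eta -> (forall x, `|eta x| <= B) ->
  2^-1 * E (fun w => eta (X w) * (RD u i w * ID f i w)) =
  E (fun w => eta (X w) * Delta (X w)).
Proof.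
move=> [cu cE De] meta etaB; have [_ mcu icu _] := cE.
rewrite (cond_exp_bounded P X _ cu eta B mX cE meta etaB) -EZ.
  by apply: eq_E => w; rewrite De mulrCA.
by apply: (L1_bounded_mul P _ _ B) => //; exact: (measurableT_comp meta mX).
Qed.

Lemma sum_Delta_E u Delta (eta : N.-tuple R -> R) (B : R) :
  (forall i, Delta_spec P X X' f u i (Delta i)) ->
  measurable_fun [set: N.-tuple R] eta -> (forall x, `|eta x| <= B) ->
  2^-1 * \sum_(i < N) E (fun w => eta (X w) * (RD u i w * ID f i w)) =
  E (fun w => eta (X w) * \sum_(i < N) Delta i (X w)).
Proof.
move=> DS meta etaB; rewrite mulr_sumr.
under eq_bigr do rewrite (Delta_spec_E u _ _ _ B (DS _) meta etaB).
rewrite -E_sum; last first.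
  move=> i; apply: (L1_bounded_mul P _ _ B) => //.
    exact: (measurableT_comp meta mX).
  exact: Delta_spec_integrable (DS i).
by apply: eq_E => w; rewrite mulr_sumr.
Qed.

Let idf i : L1 (fun w => RD f i w * ID f i w) := Delta_spec_L1 f i _ (D1 i).
Let idg i : L1 (fun w => RD g i w * ID f i w) := Delta_spec_L1 g i _ (D2 i).

Section bounded_function.
Variables (F : R -> R) (A : R).
Hypotheses (mF : measurable_fun [set: R] F) (FA : forall x, `|F x| <= A)
  (FL : forall x y, `|F x - F y| <= A * `|x - y|).

Let mFX : measurable_fun [set: T] (fun w => F (f (X w))).
Proof. exact: measurableT_comp. Qed.

Lemma logis1_mul_bound (c : R) (G : R -> R) (B : R) x : 0 < c -> (forall x, `|G x| <= B) ->
  `|logis1 c (g x) * G (f x)| <= c * B.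
Proof.
move=> c0 GB; rewrite (normrM (logis1 _ _)); apply: ler_pM => //.
rewrite (ger0_norm (logis1_ge0 _ c0 _)).
exact: le_trans (logis1_le_logis _ c0 _) (logis_le _ c0 _).
Qed.

Lemma logis_mul_bound (c : R) (G : R -> R) (B : R) x : 0 < c -> (forall x, `|G x| <= B) ->
  `|logis c (g x) * G (f x)| <= c * B.
Proof.
move=> c0 GB; rewrite (normrM (logis _ _)); apply: ler_pM => //.
by rewrite (ger0_norm (logis_ge0 _ c0 _)) logis_le.
Qed.

Lemma measurable_logis1_mul (c : R) (G : R -> R) : 0 < c -> measurable_fun [set: R] G ->
  measurable_fun [set: N.-tuple R] (fun x => logis1 c (g x) * G (f x)).
Proof.
move=> c0 mG; apply: measurable_funM.
  by apply: measurable_logis1 => //; exact: measurable_funPT.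
by apply: (measurableT_comp mG); exact: measurable_funPT.
Qed.

Lemma measurable_logis_mul (c : R) (G : R -> R) : 0 < c -> measurable_fun [set: R] G ->
  measurable_fun [set: N.-tuple R] (fun x => logis c (g x) * G (f x)).
Proof.
move=> c0 mG; apply: measurable_funM.
  by apply: measurable_logis => //; exact: measurable_funPT.
by apply: (measurableT_comp mG); exact: measurable_funPT.
Qed.

Lemma sum_Delta2_E (c : R) (G : R -> R) (B : R) : 0 < c ->
  measurable_fun [set: R] G -> (forall x, `|G x| <= B) ->
  2^-1 * \sum_(i < N) E (fun w => logis1 c (g (X w)) * G (f (X w)) * (RD g i w * ID f i w)) =
  E (fun w => logis1 c (g (X w)) * G (f (X w)) * \sum_(i < N) Delta2 i (X w)).
Proof.
move=> c0 mG GB; apply: (sum_Delta_E g Delta2 (fun x => logis1 c (g x) * G (f x)) (c * B) D2).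
  exact: measurable_logis1_mul.
by move=> x; exact: logis1_mul_bound.
Qed.

(** The only term without a limit in [K] is the mean of [clamp K (f (X'))], a common factor in the
    statements for [F] and for the constant 1. A combination of the two cancels it at every [K], and
    the limit is taken afterwards. *)
Lemma exchange_level (c : R) : 0 < c ->
  `|E (fun w => logis c (g (X w)) * F (f (X w)) * f (X w))
    - E (fun w => logis c (g (X w)) * F (f (X w))) / E (fun w => logis c (g (X w))) *
      (E (fun w => logis c (g (X w)) * f (X w))
       - E (fun w => logis1 c (g (X w)) * \sum_(i < N) Delta2 i (X w)))
    - 2^-1 * (\sum_(i < N) E (fun w => logis c (g (X w)) * RD (F \o f) i w * ID f i w))
    - E (fun w => logis1 c (g (X w)) * F (f (X w)) * \sum_(i < N) Delta2 i (X w))|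
  <= A * \sum_(i < N) E (fun w => tau i w).
Proof.
move=> c0.
have one_A (x : R) : `|(fun=> 1) x : R| <= 1 by rewrite normr1.
have one_L (x y : R) : `|(fun=> 1) x - (fun=> 1) y| <= 1 * `|x - y| :> R.
  by rewrite subrr normr0 mul1r.
have m1 : measurable_fun [set: R] (fun=> 1 : R) by [].
have HF k := exchange_truncated P X X' f g indX lawX' indXX' c c0 F A mF FA FL itau idg k%:R (ler0n R k).
have H1 k := exchange_truncated P X X' f g indX lawX' indXX' c c0 (fun=> 1) 1 m1 one_A one_L itau idg k%:R (ler0n R k).
have [cF cFi] := cvg_truncated_terms P X X' f g c c0 F A mF FA FL idg idf ihf.
have [c1 c1i] := cvg_truncated_terms P X X' f g c c0 (fun=> 1) 1 m1 one_A one_L idg idf ihf.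
set Tau := \sum_(i < N) E (fun w => tau i w) in HF H1 *.
have Tau0 : 0 <= Tau.
  apply: sumr_ge0 => i _; apply: E_ge0 => w.
  apply: mulr_ge0 => //; apply: mulr_ge0; last exact: addr_ge0.
  by apply: mulr_ge0; [rewrite mulr_ge0 ?expR_ge0|exact: sqr_ge0].
have mphi : measurable_fun [set: T] (fun w => logis c (g (X w))) by exact: measurable_logis.
have phi0 w : 0 <= logis c (g (X w)) by exact: logis_ge0.
have phic w : `|logis c (g (X w))| <= c by rewrite ger0_norm//; exact: logis_le.
have iphi : L1 (fun w => logis c (g (X w))) by exact: (L1_bounded P _ c mphi phic).
have iphiF : L1 (fun w => logis c (g (X w)) * F (f (X w))).
  by have := L1_bounded_mul P _ _ A mFX (fun w => FA _) iphi;
    congr (P.-integrable _ (EFin \o _)); apply/funext => w; rewrite mulrC.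
set p := E (fun w => logis c (g (X w))).
have p0 : 0 < p.
  by apply: E_gt0 => // w; exact: logis_gt0.
pose EF := E (fun w => logis c (g (X w)) * F (f (X w))).
(* The mean of [F] under the normalized weight, hence at most [A] in modulus: the two errors, of
   half of [A * Tau] each, add up to [A * Tau]. *)
pose mm := EF / p.
have mA : `|mm| <= A.
  rewrite /mm normrM normfV (gtr0_norm p0) ler_pdivrMr//.
  rewrite -(EZ P A _ iphi); apply: E_dom; [exact: measurable_funM| |exact: L1Z].
  by move=> w; rewrite (normrM (logis _ _)) mulrC ler_pM// ger0_norm.
pose a k := E (fun w => logis c (g (X w)) * F (f (X w)) * clamp k%:R (f (X w))).
pose a1 k := E (fun w => logis c (g (X w)) * 1 * clamp k%:R (f (X w))).
pose kap k := E (fun w => clamp k%:R (f (X' w))).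
pose sF k := \sum_(i < N)
  (E (fun w => logis c (g (X w)) * RD (F \o f) i w * ID (fun x => clamp k%:R (f x)) i w)
   + E (fun w => logis1 c (g (X w)) * F (f (X w)) *
       (RD g i w * ID (fun x => clamp k%:R (f x)) i w))).
pose s1 k := \sum_(i < N)
  (E (fun w => logis c (g (X w)) * RD ((fun=> 1) \o f) i w * ID (fun x => clamp k%:R (f x)) i w)
   + E (fun w => logis1 c (g (X w)) * 1 *
       (RD g i w * ID (fun x => clamp k%:R (f x)) i w))).
have bnd k : `|(a k - mm * a1 k) - 2^-1 * (sF k - mm * s1 k)| <= A * Tau.
  have h1 : `|a k - EF * kap k - 2^-1 * sF k| <= 2^-1 * A * Tau by exact: HF.
  have h2 : `|a1 k - p * kap k - 2^-1 * s1 k| <= 2^-1 * 1 * Tau.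
    have -> : p = E (fun w => logis c (g (X w)) * 1) by apply: eq_E => w; rewrite mulr1.
    exact: H1.
  have -> : (a k - mm * a1 k) - 2^-1 * (sF k - mm * s1 k) =
      (a k - EF * kap k - 2^-1 * sF k) - mm * (a1 k - p * kap k - 2^-1 * s1 k).
    by rewrite /mm; field; rewrite gt_eqF.
  rewrite (le_trans (ler_normB _ _))// (normrM mm).
  have h3 := ler_pM (normr_ge0 mm) (normr_ge0 _) mA h2.
  rewrite (le_trans (lerD h1 h3))// le_eqVlt; apply/orP; left; apply/eqP.
  by field.
have ca : a k @[k --> \oo] --> E (fun w => logis c (g (X w)) * F (f (X w)) * f (X w)).
  exact: cF.
have ca1 : a1 k @[k --> \oo] --> E (fun w => logis c (g (X w)) * 1 * f (X w)).
  exact: c1.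
have csF : sF k @[k --> \oo] --> \sum_(i < N)
  (E (fun w => logis c (g (X w)) * RD (F \o f) i w * ID f i w)
   + E (fun w => logis1 c (g (X w)) * F (f (X w)) * (RD g i w * ID f i w))).
  by apply: cvg_sumr => i; have [? ?] := cFi i; exact: cvgD.
have cs1 : s1 k @[k --> \oo] --> \sum_(i < N)
  (E (fun w => logis c (g (X w)) * RD ((fun=> 1) \o f) i w * ID f i w)
   + E (fun w => logis1 c (g (X w)) * 1 * (RD g i w * ID f i w))).
  by apply: cvg_sumr => i; have [? ?] := c1i i; exact: cvgD.
apply: (cvg_norm_le (fun k => (a k - mm * a1 k) - 2^-1 * (sF k - mm * s1 k))) => //.
have -> : E (fun w => logis c (g (X w)) * F (f (X w)) * f (X w)) - EF / p *
    (E (fun w => logis c (g (X w)) * f (X w))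
       - E (fun w => logis1 c (g (X w)) * \sum_(i < N) Delta2 i (X w)))
    - 2^-1 * (\sum_(i < N) E (fun w => logis c (g (X w)) * RD (F \o f) i w * ID f i w))
    - E (fun w => logis1 c (g (X w)) * F (f (X w)) * \sum_(i < N) Delta2 i (X w)) =
  (E (fun w => logis c (g (X w)) * F (f (X w)) * f (X w))
    - mm * E (fun w => logis c (g (X w)) * 1 * f (X w)))
  - 2^-1 * (\sum_(i < N)
     (E (fun w => logis c (g (X w)) * RD (F \o f) i w * ID f i w)
      + E (fun w => logis1 c (g (X w)) * F (f (X w)) * (RD g i w * ID f i w)))
    - mm * \sum_(i < N)
     (E (fun w => logis c (g (X w)) * RD ((fun=> 1) \o f) i w * ID f i w)
      + E (fun w => logis1 c (g (X w)) * 1 * (RD g i w * ID f i w)))).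
  rewrite !big_split/= -(sum_Delta2_E c F A c0 mF FA).
  have := sum_Delta2_E c (fun=> 1) 1 c0 m1 one_A.
  have -> : E (fun w => logis1 c (g (X w)) * 1 * \sum_(i < N) Delta2 i (X w)) =
      E (fun w => logis1 c (g (X w)) * \sum_(i < N) Delta2 i (X w)).
    by apply: eq_E => w; rewrite mulr1.
  move=> <-.
  have -> : E (fun w => logis c (g (X w)) * 1 * f (X w)) = E (fun w => logis c (g (X w)) * f (X w)).
    by apply: eq_E => w; rewrite mulr1.
  have -> : \sum_(i < N) E (fun w => logis c (g (X w)) * RD ((fun=> 1) \o f) i w * ID f i w) = 0.
    rewrite big1// => i _; transitivity (E (fun=> 0)); last exact: E_cst.
    by apply: eq_E => w; rewrite /resample_diff /= subrr mulr0 mul0r.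
  rewrite -/mm; move: (E (fun w => logis c (g (X w)) * F (f (X w)) * f (X w))) => e1.
  move: (E (fun w => logis c (g (X w)) * f (X w))) => e2.
  do 3 move: (\sum_(i < N) _) => ?.
  by ring.
apply: cvgB; first by apply: cvgB => //; apply: cvgM => //; exact: cvg_cst.
apply: cvgM; first exact: cvg_cst.
by apply: cvgB => //; apply: cvgM => //; exact: cvg_cst.
Qed.

Lemma cvg_weight_E (q : R -> R -> R) (u : T -> R) :
  (forall n, measurable_fun [set: T] (fun w => q n.+1%:R (g (X w)))) ->
  (forall n x, `|q n.+1%:R x| <= expR x) ->
  (forall x, q n.+1%:R x @[n --> \oo] --> expR x) ->
  measurable_fun [set: T] u -> L1 (fun w => expR (g (X w)) * u w) ->
  E (fun w => q n.+1%:R (g (X w)) * u w) @[n --> \oo] --> E (fun w => expR (g (X w)) * u w).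
Proof.
move=> mq qe qc mu iu; apply: (E_cvg P _ _ (fun w => `|expR (g (X w)) * u w|)).
- by move=> n; exact: measurable_funM.
- exact: L1_measurable iu.
- exact: L1_norm iu.
- by move=> n w; rewrite (normrM (q _ _)) (normrM (expR _)) ler_wpM2r// (ger0_norm (expR_ge0 _)).
- by move=> w; apply: cvgM; [exact: qc|exact: cvg_cst].
Qed.

Let logis_le' n x : `|logis n.+1%:R x| <= expR x :> R.
Proof. by rewrite ger0_norm ?logis_ge0// logis_le_expR. Qed.

Let logis1_le' n x : `|logis1 n.+1%:R x| <= expR x :> R.
Proof.
rewrite ger0_norm ?logis1_ge0// (le_trans (logis1_le_logis _ _ _))//.
exact: logis_le_expR.
Qed.

Lemma cvg_logis_E (u : T -> R) :
  measurable_fun [set: T] u -> L1 (fun w => expR (g (X w)) * u w) ->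
  E (fun w => logis n.+1%:R (g (X w)) * u w) @[n --> \oo] --> E (fun w => expR (g (X w)) * u w).
Proof.
apply: cvg_weight_E => //; last by move=> x; exact: cvg_logis.
by move=> n; exact: measurable_logis.
Qed.

Lemma cvg_logis1_E (u : T -> R) :
  measurable_fun [set: T] u -> L1 (fun w => expR (g (X w)) * u w) ->
  E (fun w => logis1 n.+1%:R (g (X w)) * u w) @[n --> \oo] --> E (fun w => expR (g (X w)) * u w).
Proof.
apply: cvg_weight_E => //; last by move=> x; exact: cvg_logis1.
by move=> n; exact: measurable_logis1.
Qed.

Lemma L1_weight_mul (G : R -> R) (B : R) (u : T -> R) :
  measurable_fun [set: R] G -> (forall x, `|G x| <= B) ->
  L1 (fun w => expR (g (X w)) * u w) -> L1 (fun w => expR (g (X w)) * (G (f (X w)) * u w)).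
Proof.
move=> mG GB iu; have mGX : measurable_fun [set: T] (fun w => G (f (X w))) by exact: measurableT_comp.
have := L1_bounded_mul P _ _ B mGX (fun w => GB _) iu.
by congr (P.-integrable _ (EFin \o _)); apply/funext => w; rewrite mulrCA.
Qed.

(** The Taylor remainder of [F] enters through a bound [eps] uniform in [c]. The Wasserstein and the
    Kolmogorov arguments differ in this bound and share the identity. *)
Variables (F1 : R -> R) (eps : R).
Hypotheses (mF1 : measurable_fun [set: R] F1) (F1A : forall x, `|F1 x| <= A)
  (ihf0 : E (fun w => expR (g (X w)) * f (X w)) = 0)
  (Feps : forall c, 0 < c ->
    `|2^-1 * (\sum_(i < N) E (fun w => logis c (g (X w)) * RD (F \o f) i w * ID f i w))
      - E (fun w => logis c (g (X w)) * F1 (f (X w)) * \sum_(i < N) Delta1 i (X w))| <= eps).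

Lemma exchange_identity :
  `|E (fun w => expR (g (X w)) * (F (f (X w)) * f (X w)))
    + E (fun w => expR (g (X w)) * F (f (X w))) / E (fun w => expR (g (X w))) *
      E (fun w => expR (g (X w)) * \sum_(i < N) Delta2 i (X w))
    - E (fun w => expR (g (X w)) * (F1 (f (X w)) * \sum_(i < N) Delta1 i (X w)))
    - E (fun w => expR (g (X w)) * (F (f (X w)) * \sum_(i < N) Delta2 i (X w)))|
  <= A * \sum_(i < N) E (fun w => tau i w) + eps.
Proof.
have mF1X : measurable_fun [set: T] (fun w => F1 (f (X w))) by exact: measurableT_comp.
have mD u Delta : (forall i, Delta_spec P X X' f u i (Delta i)) ->
    measurable_fun [set: T] (fun w => \sum_(i < N) Delta i (X w)).
  move=> DS; apply: measurable_sum => i.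
  exact: (measurableT_comp (Delta_spec_measurable u i _ (DS i)) mX).
have mSD1 := mD f _ D1; have mSD2 := mD g _ D2.
pose t1 n := E (fun w => logis n.+1%:R (g (X w)) * (F (f (X w)) * f (X w))).
pose t2 n := E (fun w => logis n.+1%:R (g (X w)) * F (f (X w))).
pose t3 n := E (fun w => logis n.+1%:R (g (X w)) * 1).
pose t4 n := E (fun w => logis n.+1%:R (g (X w)) * f (X w)).
pose t5 n := E (fun w => logis1 n.+1%:R (g (X w)) * \sum_(i < N) Delta2 i (X w)).
pose t6 n := E (fun w => logis n.+1%:R (g (X w)) * (F1 (f (X w)) * \sum_(i < N) Delta1 i (X w))).
pose t7 n := E (fun w => logis1 n.+1%:R (g (X w)) * (F (f (X w)) * \sum_(i < N) Delta2 i (X w))).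
pose t8 n := 2^-1 * (\sum_(i < N) E (fun w => logis n.+1%:R (g (X w)) * RD (F \o f) i w * ID f i w)).
have ih1 : L1 (fun w => expR (g (X w)) * 1).
  by have := ih; congr (P.-integrable _ (EFin \o _)); apply/funext => w; rewrite mulr1.
have bnd n : `|t1 n - t2 n / t3 n * (t4 n - t5 n) - t6 n - t7 n| <=
    A * \sum_(i < N) E (fun w => tau i w) + eps.
  have h1 : `|t1 n - t2 n / t3 n * (t4 n - t5 n) - t8 n - t7 n| <=
      A * \sum_(i < N) E (fun w => tau i w).
    have -> : t1 n = E (fun w => logis n.+1%:R (g (X w)) * F (f (X w)) * f (X w)).
      by apply: eq_E => w; rewrite mulrA.
    have -> : t7 n = E (fun w => logis1 n.+1%:R (g (X w)) * F (f (X w)) * \sum_(i < N) Delta2 i (X w)).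
      by apply: eq_E => w; rewrite mulrA.
    have -> : t3 n = E (fun w => logis n.+1%:R (g (X w))).
      by apply: eq_E => w; rewrite mulr1.
    exact: exchange_level.
  have h2 : `|t8 n - t6 n| <= eps.
    have -> : t6 n = E (fun w => logis n.+1%:R (g (X w)) * F1 (f (X w)) * \sum_(i < N) Delta1 i (X w)).
      by apply: eq_E => w; rewrite mulrA.
    exact: Feps.
  have -> : t1 n - t2 n / t3 n * (t4 n - t5 n) - t6 n - t7 n =
     (t1 n - t2 n / t3 n * (t4 n - t5 n) - t8 n - t7 n) + (t8 n - t6 n).
    by move: (t2 n / t3 n) => q; ring.
  by rewrite (le_trans (ler_normD _ _))// lerD.
have c1 : t1 n @[n --> \oo] --> E (fun w => expR (g (X w)) * (F (f (X w)) * f (X w))).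
  by apply: cvg_logis_E; [exact: measurable_funM|exact: (L1_weight_mul _ A)].
have c2 : t2 n @[n --> \oo] --> E (fun w => expR (g (X w)) * F (f (X w))).
  apply: cvg_logis_E => //.
  have := L1_weight_mul F A (fun=> 1) mF FA ih1.
  by congr (P.-integrable _ (EFin \o _)); apply/funext => w; rewrite mulr1.
have c3 : t3 n @[n --> \oo] --> E (fun w => expR (g (X w)) * 1).
  exact: cvg_logis_E.
have c4 : t4 n @[n --> \oo] --> E (fun w => expR (g (X w)) * f (X w)).
  exact: cvg_logis_E.
have c5 : t5 n @[n --> \oo] --> E (fun w => expR (g (X w)) * \sum_(i < N) Delta2 i (X w)).
  exact: cvg_logis1_E.
have c6 : t6 n @[n --> \oo] --> E (fun w => expR (g (X w)) * (F1 (f (X w)) * \sum_(i < N) Delta1 i (X w))).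
  by apply: cvg_logis_E; [exact: measurable_funM|exact: (L1_weight_mul _ A)].
have c7 : t7 n @[n --> \oo] --> E (fun w => expR (g (X w)) * (F (f (X w)) * \sum_(i < N) Delta2 i (X w))).
  by apply: cvg_logis1_E; [exact: measurable_funM|exact: (L1_weight_mul _ A)].
apply: (cvg_norm_le (fun n => t1 n - t2 n / t3 n * (t4 n - t5 n) - t6 n - t7 n)) => //.
apply: cvgB => //; apply: cvgB => //.
(* As [h f(X)] has mean zero, only the mean of [h] times [sum Delta2] survives in the subtracted
   case [F = 1], with a plus sign; it will centre [sum Delta2]. *)
have -> : E (fun w => expR (g (X w)) * (F (f (X w)) * f (X w)))
    + E (fun w => expR (g (X w)) * F (f (X w))) / E (fun w => expR (g (X w))) *
      E (fun w => expR (g (X w)) * \sum_(i < N) Delta2 i (X w)) =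
  E (fun w => expR (g (X w)) * (F (f (X w)) * f (X w)))
    - E (fun w => expR (g (X w)) * F (f (X w))) / E (fun w => expR (g (X w)) * 1) *
      (E (fun w => expR (g (X w)) * f (X w)) -
       E (fun w => expR (g (X w)) * \sum_(i < N) Delta2 i (X w))).
  rewrite ihf0 sub0r mulrN opprK; congr (_ + _ / _ * _).
  by apply: eq_E => w; rewrite mulr1.
apply: cvgB => //; apply: cvgM; last exact: cvgB.
apply: cvgM => //; apply: cvgV => //.
rewrite gt_eqF//; apply: E_gt0 => // w; rewrite mulr1; exact: expR_gt0.
Qed.

End bounded_function.
End exchange_limit.

(** * Remainder of the Stein solution *)

Section taylor_error.
Context {R : realType} {N : nat} {d : measure_display} {T : measurableType d}.
Notation S := (N.-tuple R * N.-tuple R)%type.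
Variables (P : probability T R) (X X' : {RV P >-> N.-tuple R})
  (f g : {mfun N.-tuple R >-> R}).
Hypotheses (indX : mutually_independent P (fun i w => tnth (X w) i))
  (lawX' : forall A, measurable A -> distribution P X' A = distribution P X A)
  (indXX' : independent_RV2 P X X').
Local Notation L1 u := (P.-integrable [set: T] (EFin \o (u : T -> R))).
Local Notation E u := (\int[P]_w (u w)).
Local Notation RD u i w := (resample_diff u (X w) (X' w) i).
Local Notation ID u i w := (interp_diff u (X w) (X' w) i).
Variables Delta1 : 'I_N -> N.-tuple R -> R.
Hypotheses (D1 : forall i, Delta_spec P X X' f f i (Delta1 i)).
Variables (F F1 : R -> R) (A : R).
Hypotheses (mF : measurable_fun [set: R] F) (mF1 : measurable_fun [set: R] F1)
  (FL : forall x y, `|F x - F y| <= A * `|x - y|) (F1A : forall x, `|F1 x| <= A).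
Variable c : R.
Hypothesis c0 : 0 < c.

Let A0 : 0 <= A. Proof. exact: le_trans (normr_ge0 _) (F1A 0). Qed.
Let mf : measurable_fun [set: N.-tuple R] f. Proof. exact: measurable_funPT. Qed.
Let mg : measurable_fun [set: N.-tuple R] g. Proof. exact: measurable_funPT. Qed.
Let mphi : measurable_fun [set: N.-tuple R] (fun x => logis c (g x)).
Proof. exact: measurable_logis. Qed.
Let idf i : L1 (fun w => RD f i w * ID f i w) := Delta_spec_L1 P X X' f f i _ (D1 i).
Let mID i : measurable_fun [set: S] (fun p => interp_diff f p.1 p.2 i).
Proof. exact: measurable_interp_diff. Qed.
Let mRD i : measurable_fun [set: S] (fun p => resample_diff f p.1 p.2 i).
Proof. exact: measurable_resample_diff. Qed.

Let phi_bound x : `|logis c (g x)| <= c.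
Proof. by rewrite ger0_norm ?logis_ge0// logis_le. Qed.

Let i1 i : L1 (fun w => logis c (g (X w)) * RD (F \o f) i w * ID f i w).
Proof.
apply: (L1_dom P _ (fun w => c * A * `|RD f i w * ID f i w|)).
- apply: (measurable_on_pair P X X' (fun p => logis c (g p.1) *
    resample_diff (F \o f) p.1 p.2 i * interp_diff f p.1 p.2 i)).
  apply: measurable_funM => //; apply: measurable_funM.
    exact: (measurable_coord1 _ mphi).
  by apply: measurable_resample_diff; exact: measurableT_comp.
- move=> w; rewrite (normrM (_ * _)) (normrM (RD f i w)) mulrA; apply: ler_pM => //.
  rewrite (normrM (logis _ _)) -mulrA; apply: ler_pM => //.
  exact: FL.
- by apply: L1Z; exact: (L1_norm P _ (idf i)).
Qed.

Let i2 i : L1 (fun w => logis c (g (X w)) * F1 (f (X w)) * (RD f i w * ID f i w)).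
Proof.
apply: (L1_bounded_mul P _ _ (c * A)) => //.
  apply: (measurableT_comp (measurable_logis_mul f g c F1 c0 mF1)); exact: measurable_funPT.
by move=> w; exact: logis_mul_bound.
Qed.

Let remainder i w : R := logis c (g (X w)) *
  (RD (F \o f) i w - F1 (f (X w)) * RD f i w) * ID f i w.

Let iremainder i : L1 (remainder i).
Proof.
have := L1B P _ _ (i1 i) (i2 i).
by congr (P.-integrable _ (EFin \o _)); apply/funext => w; rewrite /remainder; ring.
Qed.

(** Conditioning turns the weight times [F1 (f (X w))] times [Delta1 i] into half the same weight
    times the two increments of [f]. What is left is the first-order remainder of [F] between [f(X)]
    and [f(X^(i))]. *)
Lemma taylor_remainder :
  2^-1 * (\sum_(i < N) E (fun w => logis c (g (X w)) * RD (F \o f) i w * ID f i w))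
      - E (fun w => logis c (g (X w)) * F1 (f (X w)) * \sum_(i < N) Delta1 i (X w)) =
  2^-1 * \sum_(i < N) E (fun w => logis c (g (X w)) *
  (RD (F \o f) i w - F1 (f (X w)) * RD f i w) * ID f i w).
Proof.
rewrite -(sum_Delta_E P X X' f f Delta1 (fun x => logis c (g x) * F1 (f x)) (c * A) D1).
- rewrite -mulrBr -sumrB; congr (_ * _); apply: eq_bigr => i _.
  by rewrite -EB//; apply: eq_E => w; ring.
- exact: measurable_logis_mul.
- by move=> x; exact: logis_mul_bound.
Qed.

Lemma quadratic_taylor_error :
  (forall i, L1 (fun w => expR (g (X w)) * RD f i w ^+ 2 * `|ID f i w|)) ->
  (forall x y, `|F x - F y - F1 x * (x - y)| <= A * (x - y) ^+ 2) ->
  `|2^-1 * (\sum_(i < N) E (fun w => logis c (g (X w)) * RD (F \o f) i w * ID f i w))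
      - E (fun w => logis c (g (X w)) * F1 (f (X w)) * \sum_(i < N) Delta1 i (X w))| <=
  A * \sum_(i < N) E (fun w => expR (g (X w)) * RD f i w ^+ 2 * `|ID f i w|).
Proof.
move=> iq FQ; rewrite taylor_remainder normrM ger0_norm ?invr_ge0//.
have q0 i : 0 <= E (fun w => expR (g (X w)) * RD f i w ^+ 2 * `|ID f i w|).
  by apply: E_ge0 => w; rewrite mulr_ge0// mulr_ge0 ?expR_ge0// sqr_ge0.
rewrite (@le_trans _ _ (2^-1 * (A * \sum_(i < N) E (fun w => expR (g (X w)) * RD f i w ^+ 2 * `|ID f i w|))))//.
  rewrite ler_wpM2l ?invr_ge0// (le_trans (ler_norm_sum _ _ _))// mulr_sumr.
  apply: ler_sum => i _; rewrite -(EZ P A _ (iq i)).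
  apply: (E_dom P _ _ (L1_measurable P _ (iremainder i))); last exact: (L1Z P A _ (iq i)).
  move=> w; rewrite /remainder (normrM (_ * _)) (mulrA A); apply: ler_pM => //.
  rewrite (normrM (logis _ _)) mulrCA; apply: ler_pM => //; last exact: FQ.
  by rewrite ger0_norm ?logis_ge0// logis_le_expR.
rewrite ler_piMl//; first by rewrite mulr_ge0// sumr_ge0.
by rewrite invf_le1// ler1n.
Qed.

Variables (M : R -> R) (B : R) (D : 'I_N -> N.-tuple R -> N.-tuple R -> R)
  (cc : 'I_N -> N.-tuple R -> R).
Hypotheses (Mm : forall x y, x <= y -> M x <= M y) (MB : forall x, `|M x| <= B)
  (FM : forall x y, `|F x - F y - F1 x * (x - y)| <= (x - y) * (M x - M y))
  (symD : forall i, sym_dominating P X X' f i (D i))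
  (condD : forall i, is_cond_exp P X
     (fun w => D i (X w) (X' w) * RD f i w) (cc i))
  (icc : L1 (fun w => expR (g (X w)) * `|\sum_(i < N) cc i (X w)|))
  (iD : forall i, L1 (fun w => expR (g (X w)) * expR `|RD g i w| *
     `|D i (X w) (X' w)| * `|RD f i w| * `|RD g i w|)).

Let B0 : 0 <= B. Proof. exact: le_trans (normr_ge0 _) (MB 0). Qed.
Let mM : measurable_fun [set: R] M.
Proof. by apply: nondecreasing_measurable => // x y; exact: Mm. Qed.
Let Dw i w := D i (X w) (X' w).
Let mD i : measurable_fun [set: S] (fun p => D i p.1 p.2).
Proof. by have [] := symD i. Qed.
Let iDf i : L1 (fun w => Dw i w * RD f i w).
Proof. by have [] := condD i. Qed.
Let mX : measurable_fun [set: T] X. Proof. exact: measurable_funPT. Qed.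

(** Three variants of one integrand: all factors at [X], then [M \o f] moved to the resampled point,
    then the weight moved there instead. The exchange interchanges the last two. *)
Let psi1 i (p : S) := logis c (g p.1) * M (f p.1) *
  (D i p.1 p.2 * resample_diff f p.1 p.2 i).
Let psi2 i (p : S) := logis c (g p.1) * M (f (resample p.1 p.2 i)) *
  (D i p.1 p.2 * resample_diff f p.1 p.2 i).
Let psi3 i (p : S) := logis c (g (resample p.1 p.2 i)) * M (f p.1) *
  (D i p.1 p.2 * resample_diff f p.1 p.2 i).

Let mMf : measurable_fun [set: N.-tuple R] (M \o f).
Proof. exact: measurableT_comp. Qed.

Let mpsi1 i : measurable_fun [set: S] (psi1 i).
Proof.
apply: measurable_funM; last exact: measurable_funM.
by apply: measurable_funM; [exact: (measurable_coord1 _ mphi)|exact: (measurable_coord1 _ mMf)].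
Qed.
Let mpsi2 i : measurable_fun [set: S] (psi2 i).
Proof.
apply: measurable_funM; last exact: measurable_funM.
by apply: measurable_funM; [exact: (measurable_coord1 _ mphi)|exact: (measurable_coord_resample _ i mMf)].
Qed.
Let mpsi3 i : measurable_fun [set: S] (psi3 i).
Proof.
apply: measurable_funM; last exact: measurable_funM.
by apply: measurable_funM; [exact: (measurable_coord_resample _ i mphi)|exact: (measurable_coord1 _ mMf)].
Qed.

Let L1_psi i (psi : S -> R) : measurable_fun [set: S] psi ->
  (forall p, `|psi p| <= c * B * `|D i p.1 p.2 * resample_diff f p.1 p.2 i|) ->
  L1 (fun w => psi (X w, X' w)).
Proof.
move=> mpsi psiB; apply: (L1_dom P _ (fun w => c * B * `|Dw i w * RD f i w|)).
- exact: measurable_on_pair.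
- by move=> w; exact: psiB.
- by apply: L1Z; exact: (L1_norm P _ (iDf i)).
Qed.

Let psi_bound i x y p : `|logis c (g x) * M (f y) * (D i p.1 p.2 * resample_diff f p.1 p.2 i)|
  <= c * B * `|D i p.1 p.2 * resample_diff f p.1 p.2 i|.
Proof.
rewrite (normrM (_ * M _)); apply: ler_pM => //.
by rewrite (normrM (logis _ _)); apply: ler_pM.
Qed.

Let ipsi1 i : L1 (fun w => psi1 i (X w, X' w)).
Proof. by apply: (L1_psi i) => // p; exact: psi_bound. Qed.
Let ipsi2 i : L1 (fun w => psi2 i (X w, X' w)).
Proof. by apply: (L1_psi i) => // p; exact: psi_bound. Qed.
Let ipsi3 i : L1 (fun w => psi3 i (X w, X' w)).
Proof. by apply: (L1_psi i) => // p; exact: psi_bound. Qed.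

(** The exchange moves the argument of [M] back to [X] and that of the weight to the resampled
    point, reverses the increment of [f], and fixes [D]: this is where invariance of [D] under the
    exchange of a single coordinate enters. *)
Let E_psi2 i : E (fun w => psi2 i (X w, X' w)) = - E (fun w => psi3 i (X w, X' w)).
Proof.
rewrite (E_swap P X X' indX lawX' indXX' i (psi2 i) (mpsi2 i) (ipsi2 i)).
transitivity (E (fun w => -1 * psi3 i (X w, X' w))); last by rewrite (EZ P _ _ (ipsi3 i)) mulN1r.
have [_ _ sD _] := symD i.
apply: E_ae_eq.
- by apply: (measurableT_comp (mpsi2 i)); exact: measurable_swap_pair.
- by apply: measurable_funM => //; exact: (measurable_on_pair P X X' (psi3 i)).
- move: sD; apply: filterS => w sDw.
  rewrite /psi2 /psi3 /swap /= resample_swap resample_diff_swap sDw; ring.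
Qed.

(** Since [M] is only bounded and monotone, its increment is not small. The exchange trades it for
    an increment of [logis c \o g], which is controlled by that of [g]. The part without increment
    is conditioned on [X] and summed over [i] before moduli are taken, so cancellation among the
    [cc i] is kept. *)
Lemma monotone_taylor_error :
  `|2^-1 * (\sum_(i < N) E (fun w => logis c (g (X w)) * RD (F \o f) i w * ID f i w))
      - E (fun w => logis c (g (X w)) * F1 (f (X w)) * \sum_(i < N) Delta1 i (X w))| <=
  B * (E (fun w => expR (g (X w)) * `|\sum_(i < N) cc i (X w)|) +
    \sum_(i < N) E (fun w => expR (g (X w)) * expR `|RD g i w| *
     `|D i (X w) (X' w)| * `|RD f i w| * `|RD g i w|)).
Proof.
rewrite taylor_remainder normrM ger0_norm ?invr_ge0//.
have step i : `|E (remainder i)| <= 2 * E (fun w => psi1 i (X w, X' w)) +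
    B * E (fun w => expR (g (X w)) * expR `|RD g i w| * `|Dw i w| * `|RD f i w| * `|RD g i w|).
  apply: (@le_trans _ _ (E (fun w => psi1 i (X w, X' w) - psi2 i (X w, X' w)))).
    rewrite (le_trans (E_normr P _ (iremainder i)))//.
    apply: E_ae_le.
    - exact: (L1_norm P _ (iremainder i)).
    - exact: L1B.
    - have [_ _ _ dD] := symD i.
      move: dD; apply: filterS => w dDw.
      have -> : psi1 i (X w, X' w) - psi2 i (X w, X' w) =
          logis c (g (X w)) * (RD f i w * (M (f (X w)) - M (f (resample (X w) (X' w) i)))) * Dw i w.
        by rewrite /psi1 /psi2 /Dw /=; ring.
      rewrite /remainder (normrM (_ * _)); apply: ler_pM => //.
      rewrite (normrM (logis _ _)); apply: ler_pM => //.
        by rewrite ger0_norm// logis_ge0.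
      exact: FM.
  rewrite (EB P _ _ (ipsi1 i) (ipsi2 i)) E_psi2 opprK.
  (* In [2 * psi1 - (psi1 - psi3)] the first term can be conditioned on [X], and the bracket
     contains the increment of the weight. *)
  have -> : E (fun w => psi1 i (X w, X' w)) + E (fun w => psi3 i (X w, X' w)) =
      2 * E (fun w => psi1 i (X w, X' w)) - E (fun w => psi1 i (X w, X' w) - psi3 i (X w, X' w)).
    rewrite (EB P _ _ (ipsi1 i) (ipsi3 i)).
    by move: (E (fun w => psi1 i (X w, X' w))) (E (fun w => psi3 i (X w, X' w))) => x y; ring.
  rewrite lerD2l (le_trans (ler_norm _))// normrN.
  rewrite -(EZ P B _ (iD i)).
  apply: (E_dom P _ _ (L1_measurable P _ (L1B P _ _ (ipsi1 i) (ipsi3 i)))); last exact: (L1Z P B _ (iD i)).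
  move=> w.
  have -> : psi1 i (X w, X' w) - psi3 i (X w, X' w) =
     M (f (X w)) * ((logis c (g (X w)) - logis c (g (resample (X w) (X' w) i))) *
       (Dw i w * RD f i w)).
    by rewrite /psi1 /psi3 /Dw /=; ring.
  rewrite (normrM (M _)); apply: ler_pM => //.
  rewrite (normrM (_ - _)) (normrM (Dw i w)).
  have -> : expR (g (X w)) * expR `|RD g i w| * `|Dw i w| * `|RD f i w| * `|RD g i w| =
     expR (g (X w)) * expR `|RD g i w| * `|RD g i w| * (`|Dw i w| * `|RD f i w|) by ring.
  rewrite ler_wpM2r ?mulr_ge0//.
  exact: (logis_increment c c0).
have E1 i : E (fun w => psi1 i (X w, X' w)) = E (fun w => logis c (g (X w)) * M (f (X w)) * cc i (X w)).
  apply: (cond_exp_bounded P X _ (cc i) (fun x => logis c (g x) * M (f x)) (c * B) mX (condD i)).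
    exact: measurable_logis_mul.
  by move=> x; exact: logis_mul_bound.
have icci i : L1 (fun w => logis c (g (X w)) * M (f (X w)) * cc i (X w)).
  have [_ _ ic _] := condD i.
  apply: (L1_bounded_mul P _ _ (c * B)) => //.
    by apply: (measurableT_comp (measurable_logis_mul f g c M c0 mM)).
  by move=> w; exact: logis_mul_bound.
have sum1 : \sum_(i < N) E (fun w => psi1 i (X w, X' w)) <=
    B * E (fun w => expR (g (X w)) * `|\sum_(i < N) cc i (X w)|).
  under eq_bigr do rewrite E1.
  rewrite -E_sum// (le_trans (ler_norm _))// -(EZ P B _ icc).
  apply: (E_dom P _ _ (L1_measurable P _ (L1_sum P _ _ _ icci))); last exact: (L1Z P B _ icc).
  move=> w; rewrite -mulr_sumr (normrM (_ * M _)) mulrA; apply: ler_pM => //.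
  rewrite (normrM (logis _ _)) mulrC; apply: ler_pM => //.
  by rewrite ger0_norm ?logis_ge0// logis_le_expR.
set K1 := E (fun w => expR (g (X w)) * `|\sum_(i < N) cc i (X w)|) in sum1 *.
set K2 := \sum_(i < N) E (fun w => expR (g (X w)) * expR `|RD g i w| *
     `|D i (X w) (X' w)| * `|RD f i w| * `|RD g i w|).
have K20 : 0 <= K2.
  by apply: sumr_ge0 => i _; apply: E_ge0 => w; rewrite !mulr_ge0 ?expR_ge0.
rewrite (@le_trans _ _ (2^-1 * (2 * (B * K1) + B * K2)))//.
  rewrite ler_wpM2l ?invr_ge0// (le_trans (ler_norm_sum _ _ _))//.
  rewrite (le_trans (ler_sum _ (fun i _ => step i)))// big_split/= -!mulr_sumr.
  by rewrite lerD2r ler_wpM2l.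
have BK : 0 <= B * K2 by rewrite mulr_ge0.
have -> : 2^-1 * (2 * (B * K1) + B * K2) = B * K1 + 2^-1 * (B * K2) by field.
rewrite [leRHS]mulrDr lerD2l.
by rewrite ler_piMl// invf_le1// ler1n.
Qed.

End taylor_error.

(** * The Gibbs measure *)

Section gibbs_law.
Context {R : realType} {N : nat} {d dY : measure_display} {T : measurableType d}
  {TY : measurableType dY}.
Variables (P : probability T R) (Q : probability TY R)
  (X X' : {RV P >-> N.-tuple R}) (Y : {RV Q >-> N.-tuple R})
  (f g : {mfun N.-tuple R >-> R}).
Local Notation a := (weight_mean P X g).
Hypotheses (indX : mutually_independent P (fun i w => tnth (X w) i))
  (lawX' : forall A, measurable A -> distribution P X' A = distribution P X A)
  (indXX' : independent_RV2 P X X')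
  (ih : P.-integrable [set: T] (fun w => (expR (g (X w)))%:E))
  (lawY : forall A, measurable A -> distribution Q Y A =
    (\int[distribution P X]_(y in A) (expR (g y) / a)%:E)%E).
Local Notation RD u i w := (resample_diff u (X w) (X' w) i).
Local Notation ID u i w := (interp_diff u (X w) (X' w) i).
Local Notation tau i w := (expR (g (X w)) * expR `|RD g i w| * RD g i w ^+ 2 *
  (`|RD g i w| + `|RD f i w|) * `|ID f i w|).

Lemma weight_meanE : a = \int[P]_w expR (g (X w)).
Proof. by rewrite /weight_mean expectation_real. Qed.

Lemma weight_mean_gt0 : 0 < a.
Proof. by rewrite weight_meanE; apply: E_gt0 => // w; exact: expR_gt0. Qed.

Let rho (x : N.-tuple R) : R := expR (g x) / a.

Let rho0 x : 0 <= rho x.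
Proof. by rewrite divr_ge0 ?expR_ge0// ltW// weight_mean_gt0. Qed.

Let mrho : measurable_fun [set: N.-tuple R] rho.
Proof.
by apply: measurable_funM => //; apply: measurableT_comp => //.
Qed.

Let irho : P.-integrable [set: T] (EFin \o (rho \o X)).
Proof.
have := L1Z P a^-1 _ ih.
by congr (P.-integrable _ (EFin \o _)); apply/funext => w; rewrite mulrC.
Qed.

Let law_rho A : measurable A ->
  Q (Y @^-1` A) = (\int[P]_(w in X @^-1` A) (rho (X w))%:E)%E.
Proof.
move=> mA; transitivity (distribution Q Y A) => //; rewrite lawY//.
rewrite ge0_integral_pushforward//.
  by apply/measurable_EFinP; exact: measurable_funS mrho.
by move=> y _; rewrite lee_fin; exact: rho0.
Qed.

Lemma gibbs_L1 (u : N.-tuple R -> R) : measurable_fun [set: N.-tuple R] u ->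
  Q.-integrable [set: TY] (EFin \o (u \o Y)) ->
  P.-integrable [set: T] (EFin \o (fun w => expR (g (X w)) * u (X w))).
Proof.
move=> mu iu; have := (density_L1 P Q X Y rho rho0 mrho irho law_rho u mu).1 iu.
move/(L1Z P a); congr (P.-integrable _ (EFin \o _)); apply/funext => w.
by rewrite /rho; field; rewrite gt_eqF// weight_mean_gt0.
Qed.

Lemma gibbs_E (u : N.-tuple R -> R) : measurable_fun [set: N.-tuple R] u ->
  Q.-integrable [set: TY] (EFin \o (u \o Y)) ->
  \int[P]_w (expR (g (X w)) * u (X w)) = a * \int[Q]_w u (Y w).
Proof.
move=> mu iu; rewrite -(density_E P Q X Y rho rho0 mrho irho law_rho u mu iu).
rewrite -EZ; last exact: (density_L1 P Q X Y rho rho0 mrho irho law_rho u mu).1 iu.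
apply: eq_E => w.
by rewrite /rho; field; rewrite gt_eqF// weight_mean_gt0.
Qed.

Variables Delta1 Delta2 : 'I_N -> N.-tuple R -> R.
Hypotheses (iW : Q.-integrable [set: TY] (EFin \o (f \o Y)))
  (EW : \int[Q]_w f (Y w) = 0)
  (D1 : forall i, Delta_spec P X X' f f i (Delta1 i))
  (D2 : forall i, Delta_spec P X X' f g i (Delta2 i))
  (iS1 : Q.-integrable [set: TY] (fun w => (\sum_(i < N) Delta1 i (Y w))%:E))
  (iS2 : Q.-integrable [set: TY] (fun w => (\sum_(i < N) Delta2 i (Y w))%:E))
  (itau : forall i, P.-integrable [set: T] (EFin \o (fun w => tau i w))).
Variables (F F1 : R -> R) (A eps : R).
Hypotheses (mF : measurable_fun [set: R] F) (mF1 : measurable_fun [set: R] F1)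
  (FA : forall x, `|F x| <= A) (F1A : forall x, `|F1 x| <= A)
  (FL : forall x y, `|F x - F y| <= A * `|x - y|)
  (Feps : forall c, 0 < c ->
    `|2^-1 * (\sum_(i < N) \int[P]_w (logis c (g (X w)) * RD (F \o f) i w * ID f i w))
      - \int[P]_w (logis c (g (X w)) * F1 (f (X w)) * \sum_(i < N) Delta1 i (X w))| <= eps).
Local Notation E u := (\int[Q]_w (u w)).
Local Notation L1 u := (Q.-integrable [set: TY] (EFin \o (u : TY -> R))).
Let S1 x := \sum_(i < N) Delta1 i x.
Let S2 x := \sum_(i < N) Delta2 i x.
Let W w := f (Y w).

Lemma gibbs_stein_identity :
  `|E (fun w => F (W w) * W w) + E (fun w => F (W w)) * E (fun w => S2 (Y w))
    - E (fun w => F1 (W w) * S1 (Y w)) - E (fun w => F (W w) * S2 (Y w))|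
  <= a^-1 * (A * \sum_(i < N) \int[P]_w (tau i w) + eps).
Proof.
have a0 := weight_mean_gt0.
have mf : measurable_fun [set: N.-tuple R] f by exact: measurable_funPT.
have mY : measurable_fun [set: TY] Y by exact: measurable_funPT.
have mFf : measurable_fun [set: N.-tuple R] (F \o f) by exact: measurableT_comp.
have mF1f : measurable_fun [set: N.-tuple R] (F1 \o f) by exact: measurableT_comp.
have mS1 : measurable_fun [set: N.-tuple R] S1.
  by apply: measurable_sum => i; exact: (Delta_spec_measurable P X X' f f i _ (D1 i)).
have mS2 : measurable_fun [set: N.-tuple R] S2.
  by apply: measurable_sum => i; exact: (Delta_spec_measurable P X X' f g i _ (D2 i)).
have mFW : measurable_fun [set: TY] (fun w => F (W w)) by exact: (measurableT_comp mFf mY).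
have mF1W : measurable_fun [set: TY] (fun w => F1 (W w)) by exact: (measurableT_comp mF1f mY).
have ihf := gibbs_L1 f mf iW.
have ihS1 := gibbs_L1 S1 mS1 iS1.
have ihS2 := gibbs_L1 S2 mS2 iS2.
have ihf0 : \int[P]_w (expR (g (X w)) * f (X w)) = 0.
  by rewrite (gibbs_E f mf iW) EW mulr0.
have := exchange_identity P X X' f g indX lawX' indXX' Delta1 Delta2 itau D1 D2 ih ihf
  ihS1 ihS2 F A mF FA FL F1 eps mF1 F1A ihf0 Feps.
rewrite -/(S1 _) -weight_meanE.
rewrite (gibbs_E (fun x => F (f x) * f x)); last 2 first.
- exact: measurable_funM.
- exact: (L1_bounded_mul Q _ _ A mFW (fun w => FA _) iW).
rewrite (gibbs_E (fun x => F (f x))); last 2 first.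
- exact: mFf.
- exact: (L1_bounded Q _ A mFW (fun w => FA _)).
rewrite (gibbs_E S2)//.
rewrite (gibbs_E (fun x => F1 (f x) * S1 x)); last 2 first.
- exact: measurable_funM.
- exact: (L1_bounded_mul Q _ _ A mF1W (fun w => F1A _) iS1).
rewrite (gibbs_E (fun x => F (f x) * S2 x)); last 2 first.
- exact: measurable_funM.
- exact: (L1_bounded_mul Q _ _ A mFW (fun w => FA _) iS2).
rewrite /W; move: (E (fun w => F (f (Y w)) * f (Y w))) (E (fun w => F (f (Y w))))
  (E (fun w => S2 (Y w))) (E (fun w => F1 (f (Y w)) * S1 (Y w)))
  (E (fun w => F (f (Y w)) * S2 (Y w))) => x1 x2 x3 x4 x5.
move: a a0 => a' a0; rewrite ler_pdivlMl// => H.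
rewrite -{1}(gtr0_norm a0) -normrM (le_trans _ H)// le_eqVlt; apply/orP; left; apply/eqP.
by congr (`|_|); field; rewrite gt_eqF.
Qed.

Let b := E (fun w => S1 (Y w)).
Let V w := S2 (Y w) - (1 - b) * W w.

(** [E F(W) W] is split in the proportions [b] and [1 - b]. The share [1 - b] is subtracted from
    [S2] and forms [V], whose mean is that of [S2] because [W] is centred; the share [b] is matched
    with [S1] replaced by its mean [b]. *)
Lemma gibbs_stein_bound :
  `|b| * `|E (fun w => F (W w) * W w - F1 (W w))| <=
  a^-1 * (A * \sum_(i < N) \int[P]_w (tau i w) + eps)
  + A * (E (fun w => `|S1 (Y w) - b|) + E (fun w => `|V w - E V|)).
Proof.
have H := gibbs_stein_identity.
have iW' : L1 W by exact: iW.
have iS1' : L1 (fun w => S1 (Y w)) by exact: iS1.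
have iS2' : L1 (fun w => S2 (Y w)) by exact: iS2.
have mf : measurable_fun [set: N.-tuple R] f by exact: measurable_funPT.
have mY : measurable_fun [set: TY] Y by exact: measurable_funPT.
have mW : measurable_fun [set: TY] W by exact: (measurableT_comp mf mY).
have mFW : measurable_fun [set: TY] (fun w => F (W w)) by exact: (measurableT_comp mF mW).
have mF1W : measurable_fun [set: TY] (fun w => F1 (W w)) by exact: (measurableT_comp mF1 mW).
have bmul (G : R -> R) (u : TY -> R) : measurable_fun [set: TY] (fun w => G (W w)) ->
    (forall x, `|G x| <= A) -> L1 u -> L1 (fun w => G (W w) * u w).
  by move=> mG GA; exact: (L1_bounded_mul Q _ _ A mG (fun w => GA _)).
have iV : L1 V by apply: L1B => //; exact: (L1Z Q _ _ iW').
have EV : E V = E (fun w => S2 (Y w)).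
  rewrite /V (EB Q _ _ iS2' (L1Z Q _ _ iW')) (EZ Q _ _ iW').
  by rewrite EW mulr0 subr0.
have iSb : L1 (fun w => S1 (Y w) - b) by apply: L1B => //; exact: L1_cst.
have iVE : L1 (fun w => V w - E V) by apply: L1B => //; exact: L1_cst.
have iF1 : L1 (fun w => F1 (W w)) by exact: (L1_bounded Q _ A mF1W (fun w => F1A _)).
have iF : L1 (fun w => F (W w)) by exact: (L1_bounded Q _ A mFW (fun w => FA _)).
have iFW : L1 (fun w => F (W w) * W w) by exact: bmul.
have e1 : E (fun w => F1 (W w) * (S1 (Y w) - b)) =
    E (fun w => F1 (W w) * S1 (Y w)) - b * E (fun w => F1 (W w)).
  rewrite -(EZ Q _ _ iF1) -(EB Q _ _ (bmul F1 _ mF1W F1A iS1') (L1Z Q b _ iF1)).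
  by apply: eq_E => w; ring.
have e2 : E (fun w => F (W w) * (V w - E V)) = E (fun w => F (W w) * S2 (Y w))
    - (1 - b) * E (fun w => F (W w) * W w) - E (fun w => F (W w)) * E (fun w => S2 (Y w)).
  rewrite EV [X in _ - X]mulrC -(EZ Q _ _ iF) -(EZ Q _ _ iFW).
  have i2 := bmul F _ mFW FA iS2'.
  rewrite -(EB Q _ _ i2 (L1Z Q (1 - b) _ iFW)).
  rewrite -(EB Q _ _ (L1B Q _ _ i2 (L1Z Q (1 - b) _ iFW)) (L1Z Q _ _ iF)).
  by apply: eq_E => w; rewrite /V; ring.
have n1 : `|E (fun w => F1 (W w) * (S1 (Y w) - b))| <= A * E (fun w => `|S1 (Y w) - b|).
  have i' := bmul F1 _ mF1W F1A iSb.
  rewrite -(EZ Q A _ (L1_norm Q _ iSb)).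
  apply: (E_dom Q _ _ (L1_measurable Q _ i')); last exact: (L1Z Q A _ (L1_norm Q _ iSb)).
  by move=> w; rewrite normrM ler_wpM2r.
have n2 : `|E (fun w => F (W w) * (V w - E V))| <= A * E (fun w => `|V w - E V|).
  have i' := bmul F _ mFW FA iVE.
  rewrite -(EZ Q A _ (L1_norm Q _ iVE)).
  apply: (E_dom Q _ _ (L1_measurable Q _ i')); last exact: (L1Z Q A _ (L1_norm Q _ iVE)).
  by move=> w; rewrite normrM ler_wpM2r.
rewrite -normrM (EB Q _ _ iFW iF1) [X in _ <= _ + X]mulrDr.
rewrite e1 in n1; rewrite e2 in n2.
move: H n1 n2; rewrite -/b.
move: (E (fun w => F (W w) * W w)) (E (fun w => F (W w))) (E (fun w => S2 (Y w)))
  (E (fun w => F1 (W w) * S1 (Y w))) (E (fun w => F (W w) * S2 (Y w)))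
  (E (fun w => F1 (W w))) => x1 x2 x3 x4 x5 x6 H n1 n2.
have -> : b * (x1 - x6) = (x1 + x2 * x3 - x4 - x5) + (x4 - b * x6) +
    (x5 - (1 - b) * x1 - x2 * x3) by ring.
rewrite (le_trans (ler_normD _ _))// (le_trans (lerD (ler_normD _ _) (lexx _)))//.
by rewrite -addrA; apply: lerD => //; rewrite [leRHS]addrC addrC lerD.
Qed.

End gibbs_law.

(** * Bounds with values in the extended reals, and the normal law *)

Section extended_bounds.
Context {R : realType}.

(** Finiteness of an error quantity is converted into integrability of each of its nonnegative
    summands, so no separate moment assumption is required of them. *)
Lemma scaled_sum_expectation_lty {d : measure_display} {T : measurableType d}
    (P : probability T R) (N : nat) (r : R) (v : 'I_N -> T -> R) :
  0 < r -> (forall i, measurable_fun [set: T] (v i)) -> (forall i w, 0 <= v i w) ->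
  (r%:E * \sum_(i < N) 'E_P[v i] < +oo)%E ->
  (forall i, P.-integrable [set: T] (EFin \o v i)) /\
  (r%:E * \sum_(i < N) 'E_P[v i] = (r * \sum_(i < N) \int[P]_w v i w)%:E)%E.
Proof.
move=> r0 mv v0 fin.
have e0 i : (0 <= 'E_P[v i])%E by apply: expectation_ge0.
have iv i : P.-integrable [set: T] (EFin \o v i).
  apply: ge0_expectation_lty => //; rewrite ltey; apply/eqP => ei.
  have : (+oo <= \sum_(i < N) 'E_P[v i])%E.
    by rewrite (bigD1 i)//= ei leeDl// sume_ge0.
  rewrite leye_eq => /eqP e.
  by move: fin; rewrite e gt0_muley ?lte_fin// ltxx.
split => //; rewrite EFinM -sumEFin; congr (_ * _)%E.
by apply: eq_bigr => i _; rewrite expectation_real.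
Qed.

Lemma scaled_expectation_lty {d : measure_display} {T : measurableType d}
    (P : probability T R) (r : R) (v : T -> R) :
  0 < r -> measurable_fun [set: T] v -> (forall w, 0 <= v w) ->
  (r%:E * 'E_P[v] < +oo)%E ->
  P.-integrable [set: T] (EFin \o v) /\ (r%:E * 'E_P[v] = (r * \int[P]_w v w)%:E)%E.
Proof.
move=> r0 mv v0 fin.
have iv : P.-integrable [set: T] (EFin \o v).
  apply: ge0_expectation_lty => //; rewrite ltey; apply/eqP => ei.
  by move: fin; rewrite ei gt0_muley ?lte_fin// ltxx.
by split => //; rewrite EFinM expectation_real.
Qed.

Lemma normalized_bound (C b x r v1 v3 : R) (d2 d3 : \bar R) : 0 <= C -> b != 0 ->
  (v1%:E <= d2)%E -> (v3%:E <= d3)%E -> `|b| * x <= C * (r + v1 + v3) ->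
  (x%:E <= (C / `|b|)%:E * (r%:E + d2 + d3))%E.
Proof.
move=> C0 b0 vd2 vd3 H; have b1 : 0 < `|b| by rewrite normr_gt0.
apply: (@le_trans _ _ ((C / `|b|)%:E * (r%:E + v1%:E + v3%:E))%E).
  by rewrite -!EFinD -EFinM lee_fin mulrAC ler_pdivlMr// mulrC.
rewrite lee_wpmul2l ?lee_fin ?divr_ge0//.
by rewrite leeD// leeD.
Qed.

Lemma normal_law_E {d : measure_display} {T : measurableType d} (P : probability T R)
    (Z : {RV P >-> R}) (psi : R -> R) :
  (forall A, measurable A -> distribution P Z A = normal_prob 0 1 A) ->
  measurable_fun [set: R] psi ->
  (@lebesgue_measure R).-integrable [set: R] (fun t => (psi t * normal_pdf 0 1 t)%:E) ->
  P.-integrable [set: T] (EFin \o (psi \o Z)) /\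
  \int[P]_w psi (Z w) = \int[@lebesgue_measure R]_t (psi t * normal_pdf 0 1 t).
Proof.
move=> lawZ mpsi ipsi.
(* The base variable is the identity of the line under Lebesgue measure; [density_transfer] admits a
   base measure that is not a probability for this purpose. *)
pose idR : {mfun measurableTypeR R >-> R} :=
  HB.pack (fun x : measurableTypeR R => x : R)
    (@isMeasurableFun.Build _ _ (measurableTypeR R) R _ (@measurable_id _ _ setT)).
have irho : (@lebesgue_measure R).-integrable [set: R] (EFin \o (normal_pdf 0 1 \o idR)).
  exact: integrable_normal_pdf.
have rho0 (x : R) : 0 <= normal_pdf 0 1 x by exact: normal_pdf_ge0.
have mrho : measurable_fun [set: R] (@normal_pdf R 0 1) by exact: measurable_normal_pdf.
have QP A : measurable A -> P (Z @^-1` A) =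
    (\int[@lebesgue_measure R]_(w in idR @^-1` A) (normal_pdf 0 1 (idR w))%:E)%E.
  by move=> mA; exact: (lawZ A mA).
have iZ : P.-integrable [set: T] (EFin \o (psi \o Z)).
  apply/(density_L1 (@lebesgue_measure R) P idR Z (normal_pdf 0 1) rho0 mrho irho QP psi mpsi).
  exact: ipsi.
split => //.
by rewrite -(density_E (@lebesgue_measure R) P idR Z (normal_pdf 0 1) rho0 mrho irho QP psi mpsi iZ).
Qed.

End extended_bounds.

(** * From Stein solutions to the two error bounds *)

Section gibbs_distances.
Context {R : realType} {N : nat} {d dY : measure_display} {T : measurableType d}
  {TY : measurableType dY}.
Variables (P : probability T R) (Q : probability TY R)
  (X X' : {RV P >-> N.-tuple R}) (Y : {RV Q >-> N.-tuple R})
  (f g : {mfun N.-tuple R >-> R}).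
Local Notation a := (weight_mean P X g).
Hypotheses (indX : mutually_independent P (fun i w => tnth (X w) i))
  (lawX' : forall A, measurable A -> distribution P X' A = distribution P X A)
  (indXX' : independent_RV2 P X X')
  (ih : P.-integrable [set: T] (fun w => (expR (g (X w)))%:E))
  (lawY : forall A, measurable A -> distribution Q Y A =
    (\int[distribution P X]_(y in A) (expR (g y) / a)%:E)%E).
Local Notation RD u i w := (resample_diff u (X w) (X' w) i).
Local Notation ID u i w := (interp_diff u (X w) (X' w) i).
Local Notation tau i w := (expR (g (X w)) * expR `|RD g i w| * RD g i w ^+ 2 *
  (`|RD g i w| + `|RD f i w|) * `|ID f i w|).
Variables Delta1 Delta2 : 'I_N -> N.-tuple R -> R.
Hypotheses (iW : Q.-integrable [set: TY] (EFin \o (f \o Y)))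
  (EW : \int[Q]_w f (Y w) = 0)
  (D1 : forall i, Delta_spec P X X' f f i (Delta1 i))
  (D2 : forall i, Delta_spec P X X' f g i (Delta2 i))
  (iS1 : Q.-integrable [set: TY] (fun w => (\sum_(i < N) Delta1 i (Y w))%:E))
  (iS2 : Q.-integrable [set: TY] (fun w => (\sum_(i < N) Delta2 i (Y w))%:E)).
Local Notation b := (bquant Q Y Delta1).
Hypothesis b0 : b != 0.
Local Notation L1P u := (P.-integrable [set: T] (EFin \o (u : T -> R))).

Let bE : b = \int[Q]_w (\sum_(i < N) Delta1 i (Y w)).
Proof. by rewrite /bquant expectation_real. Qed.

Let mf : measurable_fun [set: N.-tuple R] f. Proof. exact: measurable_funPT. Qed.
Let mg : measurable_fun [set: N.-tuple R] g. Proof. exact: measurable_funPT. Qed.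
Let mhp : measurable_fun [set: N.-tuple R * N.-tuple R] (fun p => expR (g p.1)).
Proof. by apply: measurableT_comp => //; exact: measurable_coord1. Qed.
Let mRD u i : measurable_fun [set: N.-tuple R] u ->
  measurable_fun [set: N.-tuple R * N.-tuple R] (fun p => resample_diff u p.1 p.2 i).
Proof. exact: measurable_resample_diff. Qed.
Let mID i : measurable_fun [set: N.-tuple R * N.-tuple R] (fun p => interp_diff f p.1 p.2 i).
Proof. exact: measurable_interp_diff. Qed.
Let mnorm (u : N.-tuple R * N.-tuple R -> R) : measurable_fun setT u ->
  measurable_fun setT (fun p => `|u p|).
Proof. by move=> mu; exact: measurableT_comp. Qed.
Let mexp (u : N.-tuple R * N.-tuple R -> R) : measurable_fun setT u ->
  measurable_fun setT (fun p => expR (u p)).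
Proof. by move=> mu; exact: measurableT_comp. Qed.

Let mtau i : measurable_fun [set: T] (fun w => tau i w).
Proof.
apply: (measurable_on_pair P X X' (fun p => expR (g p.1) *
  expR `|resample_diff g p.1 p.2 i| * resample_diff g p.1 p.2 i ^+ 2 *
  (`|resample_diff g p.1 p.2 i| + `|resample_diff f p.1 p.2 i|) *
  `|interp_diff f p.1 p.2 i|)).
apply: measurable_funM; last exact: mnorm.
apply: measurable_funM; last first.
  by apply: measurable_funD; apply: mnorm; exact: mRD.
apply: measurable_funM; last by apply: measurable_funX; exact: mRD.
by apply: measurable_funM => //; apply: mexp; apply: mnorm; exact: mRD.
Qed.

Let tau_ge0 i w : 0 <= tau i w.
Proof.
apply: mulr_ge0 => //; apply: mulr_ge0; last exact: addr_ge0.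
by apply: mulr_ge0; [rewrite mulr_ge0 ?expR_ge0|exact: sqr_ge0].
Qed.

Let a0 : 0 < a. Proof. exact: weight_mean_gt0. Qed.

Let T_ge0 : (0 <= Tquant P X X' f g)%E.
Proof.
rewrite mule_ge0 ?lee_fin ?invr_ge0 ?(ltW a0)//.
by apply: sume_ge0 => i _; apply: expectation_ge0 => w; exact: tau_ge0.
Qed.

Let T_lty : (Tquant P X X' f g < +oo)%E ->
  (forall i, L1P (fun w => tau i w)) /\
  Tquant P X X' f g = (a^-1 * \sum_(i < N) \int[P]_w (tau i w))%:E.
Proof.
by apply: scaled_sum_expectation_lty => //; rewrite invr_gt0.
Qed.

(** Common end of both arguments: [d1] stands for [delta1] or [delta1']. The analytic input is
    requested only when [d1] is finite, as the integrability it rests on comes from that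
    finiteness. *)
Lemma stein_distance_bound (F F1 : R -> R) (A : R) (d1 : \bar R) :
  measurable_fun [set: R] F -> measurable_fun [set: R] F1 ->
  (forall x, `|F x| <= A) -> (forall x, `|F1 x| <= A) ->
  (forall x y, `|F x - F y| <= A * `|x - y|) ->
  (0 <= d1)%E ->
  ((d1 < +oo)%E -> (Tquant P X X' f g < +oo)%E /\ exists eps r : R,
    [/\ forall c, 0 < c ->
      `|2^-1 * (\sum_(i < N) \int[P]_w (logis c (g (X w)) * RD (F \o f) i w * ID f i w))
      - \int[P]_w (logis c (g (X w)) * F1 (f (X w)) * \sum_(i < N) Delta1 i (X w))| <= eps,
      d1 = r%:E &
      a^-1 * (A * \sum_(i < N) \int[P]_w (tau i w) + eps) <= A * r]) ->
  (`|\int[Q]_w (F (f (Y w)) * f (Y w) - F1 (f (Y w)))|%:E <=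
   (A / `|b|)%:E * (d1 + delta2 Q Y Delta1 + delta3 Q Y f b Delta2))%E.
Proof.
move=> mF mF1 FA F1A FL d10 H.
have A0 := le_trans (normr_ge0 _) (FA 0).
have iV : Q.-integrable [set: TY] (EFin \o (fun w => \sum_(i < N) Delta2 i (Y w) - (1 - b) * f (Y w))).
  apply: L1B; first exact: iS2.
  exact: (L1Z Q (1 - b) (fun w => f (Y w)) iW).
have v2 := mean_deviation_le_stddev Q _ iS1.
have v3 := mean_deviation_le_stddev Q _ iV.
have d20 : (0 <= delta2 Q Y Delta1)%E.
  by apply: le_trans v2; rewrite lee_fin E_ge0.
have d30 : (0 <= delta3 Q Y f b Delta2)%E.
  by apply: le_trans v3; rewrite lee_fin E_ge0.
(* With [A = 0] an infinite error would be multiplied to 0, so this case cannot rest on a trivial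
   bound; there [F] and [F1] vanish. *)
have [A00|Apos] := eqVneq A 0.
  have F0 x : F x = 0 by apply/eqP; rewrite -normr_le0 -A00.
  have F10 x : F1 x = 0 by apply/eqP; rewrite -normr_le0 -A00.
  rewrite A00 mul0r mul0e lee_fin.
  rewrite (@eq_E _ _ _ Q _ (fun=> 0)); last by move=> w; rewrite F0 F10 mul0r subr0.
  by rewrite E_cst normr0.
have C0 : 0 < A / `|b| by rewrite divr_gt0 ?normr_gt0// lt0r Apos.
have [d1fin|] := ltP d1 +oo%E; last first.
  rewrite leye_eq => /eqP ->.
  rewrite addye; last by rewrite -ltNye (lt_le_trans _ d20)// ltNyr.
  rewrite addye; last by rewrite -ltNye (lt_le_trans _ d30)// ltNyr.
  by rewrite gt0_muley ?lte_fin// leey.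
have [Tfin [eps [r [Feps -> rE]]]] := H d1fin.
have [itau _] := T_lty Tfin.
apply: (normalized_bound A b _ r _ _ _ _ A0 b0 v2 v3).
have := gibbs_stein_bound P Q X X' Y f g indX lawX' indXX' ih lawY Delta1 Delta2 iW EW D1 D2
  iS1 iS2 itau F F1 A eps mF mF1 FA F1A FL Feps.
rewrite -bE => /le_trans; apply.
by rewrite -[r + _ + _]addrA [leRHS]mulrDr lerD.
Qed.

Lemma wasserstein_test_bound (F F1 : R -> R) (A : R) :
  measurable_fun [set: R] F -> measurable_fun [set: R] F1 ->
  (forall x, `|F x| <= A) -> (forall x, `|F1 x| <= A) ->
  (forall x y, `|F x - F y| <= A * `|x - y|) ->
  (forall x y, `|F x - F y - F1 x * (x - y)| <= A * (x - y) ^+ 2) ->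
  (`|\int[Q]_w (F (f (Y w)) * f (Y w) - F1 (f (Y w)))|%:E <=
   (A / `|b|)%:E * (delta1 P X X' f g + delta2 Q Y Delta1 + delta3 Q Y f b Delta2))%E.
Proof.
move=> mF mF1 FA F1A FL FQ.
pose q i w := expR (g (X w)) * RD f i w ^+ 2 * `|ID f i w|.
have mq i : measurable_fun [set: T] (q i).
  apply: (measurable_on_pair P X X' (fun p => expR (g p.1) *
    resample_diff f p.1 p.2 i ^+ 2 * `|interp_diff f p.1 p.2 i|)).
  apply: measurable_funM; last exact: mnorm.
  by apply: measurable_funM => //; apply: measurable_funX; exact: mRD.
have q0 i w : 0 <= q i w by rewrite mulr_ge0// mulr_ge0 ?expR_ge0// sqr_ge0.
have s0 : (0 <= (a^-1)%:E * \sum_(i < N) 'E_P[q i])%E.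
  rewrite mule_ge0 ?lee_fin ?invr_ge0 ?(ltW a0)//.
  by apply: sume_ge0 => i _; exact: expectation_ge0.
apply: stein_distance_bound => //; first exact: adde_ge0.
move=> fin.
have sfin : ((a^-1)%:E * \sum_(i < N) 'E_P[q i] < +oo)%E.
  by apply: le_lt_trans fin; rewrite leeDl.
have Tfin : (Tquant P X X' f g < +oo)%E.
  by apply: le_lt_trans fin; rewrite leeDr.
split => //.
have [|iq qE] := scaled_sum_expectation_lty P N a^-1 q _ mq q0 sfin.
  by rewrite invr_gt0.
have [_ TE] := T_lty Tfin.
exists (A * \sum_(i < N) \int[P]_w q i w).
exists (a^-1 * (\sum_(i < N) \int[P]_w q i w) + a^-1 * \sum_(i < N) \int[P]_w (tau i w)).
split.
- move=> c c0.
  exact: (quadratic_taylor_error P X X' f g Delta1 D1 F F1 A mF mF1 FL F1A c c0 iq FQ).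
- by rewrite EFinD -qE -TE.
- by rewrite -!mulrDr mulrCA addrC.
Qed.

Lemma kolmogorov_test_bound (F F1 M : R -> R) (A : R)
    (D : 'I_N -> N.-tuple R -> N.-tuple R -> R) (c : 'I_N -> N.-tuple R -> R) :
  measurable_fun [set: R] F -> measurable_fun [set: R] F1 ->
  (forall x, `|F x| <= A) -> (forall x, `|F1 x| <= A) ->
  (forall x y, `|F x - F y| <= A * `|x - y|) ->
  (forall x y, x <= y -> M x <= M y) -> (forall x, `|M x| <= A) ->
  (forall x y, `|F x - F y - F1 x * (x - y)| <= (x - y) * (M x - M y)) ->
  (forall i, sym_dominating P X X' f i (D i)) ->
  (forall i, is_cond_exp P X
     (fun w => D i (X w) (X' w) * resample_diff f (X w) (X' w) i) (c i)) ->
  (`|\int[Q]_w (F (f (Y w)) * f (Y w) - F1 (f (Y w)))|%:E <=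
   (A / `|b|)%:E * (delta1' P X X' f g D c + delta2 Q Y Delta1 + delta3 Q Y f b Delta2))%E.
Proof.
move=> mF mF1 FA F1A FL Mm MA FM symD condD.
pose q0 i w := expR (g (X w)) * expR `|RD g i w| * D i (X w) (X' w) *
  `|RD f i w| * `|RD g i w|.
pose q i w := expR (g (X w)) * expR `|RD g i w| * `|D i (X w) (X' w)| *
  `|RD f i w| * `|RD g i w|.
pose s w := expR (g (X w)) * `|\sum_(i < N) c i (X w)|.
have mDp i : measurable_fun [set: N.-tuple R * N.-tuple R] (fun p => D i p.1 p.2).
  by have [] := symD i.
have mexpRD i : measurable_fun [set: N.-tuple R * N.-tuple R]
    (fun p => expR (g p.1) * expR `|resample_diff g p.1 p.2 i|).
  by apply: measurable_funM => //; apply: mexp; apply: mnorm; exact: mRD.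
have mq0 i : measurable_fun [set: T] (q0 i).
  apply: (measurable_on_pair P X X' (fun p => expR (g p.1) *
    expR `|resample_diff g p.1 p.2 i| * D i p.1 p.2 * `|resample_diff f p.1 p.2 i| *
    `|resample_diff g p.1 p.2 i|)).
  apply: measurable_funM; last by apply: mnorm; exact: mRD.
  apply: measurable_funM; last by apply: mnorm; exact: mRD.
  exact: measurable_funM.
have mq i : measurable_fun [set: T] (q i).
  apply: (measurable_on_pair P X X' (fun p => expR (g p.1) *
    expR `|resample_diff g p.1 p.2 i| * `|D i p.1 p.2| * `|resample_diff f p.1 p.2 i| *
    `|resample_diff g p.1 p.2 i|)).
  apply: measurable_funM; last by apply: mnorm; exact: mRD.
  apply: measurable_funM; last by apply: mnorm; exact: mRD.
  by apply: measurable_funM => //; exact: mnorm.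
have mc i : measurable_fun [set: N.-tuple R] (c i) by have [] := condD i.
have ms : measurable_fun [set: T] s.
  have mX : measurable_fun [set: T] X by exact: measurable_funPT.
  apply: measurable_funM; first by apply: measurableT_comp => //; exact: (measurableT_comp mg mX).
  apply: measurableT_comp => //; apply: measurable_sum => i.
  exact: (measurableT_comp (mc i) mX).
have q_ge0 i w : 0 <= q i w by rewrite !mulr_ge0 ?expR_ge0.
have s_ge0 w : 0 <= s w by rewrite mulr_ge0 ?expR_ge0.
(* The dominating function is nonnegative only almost everywhere. *)
have qq0 i : ('E_P[q0 i] = 'E_P[q i])%E.
  rewrite unlock; apply: ae_eq_integral => //.
  - exact/measurable_EFinP.
  - exact/measurable_EFinP.
  - have [_ _ _ dD] := symD i; move: dD; apply: filterS => w dDw _.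
    rewrite /q0 /q (_ : `|D i (X w) (X' w)| = D i (X w) (X' w))//.
    by rewrite ger0_norm// (le_trans _ dDw).
have dE : delta1' P X X' f g D c = ((a^-1)%:E * (\sum_(i < N) 'E_P[q i]) +
    (a^-1)%:E * 'E_P[s] + Tquant P X X' f g)%E.
  rewrite /delta1'; congr (_ * _ + _ + _)%E; apply: eq_bigr => i _.
  by rewrite -qq0.
have t1 : (0 <= (a^-1)%:E * \sum_(i < N) 'E_P[q i])%E.
  rewrite mule_ge0 ?lee_fin ?invr_ge0 ?(ltW a0)//.
  by apply: sume_ge0 => i _; exact: expectation_ge0.
have t2 : (0 <= (a^-1)%:E * 'E_P[s])%E.
  rewrite mule_ge0 ?lee_fin ?invr_ge0 ?(ltW a0)//.
  exact: expectation_ge0.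
rewrite dE.
apply: stein_distance_bound => //; first by rewrite !adde_ge0.
move=> fin.
have f1 : ((a^-1)%:E * \sum_(i < N) 'E_P[q i] < +oo)%E.
  by apply: le_lt_trans fin; rewrite -addeA leeDl// adde_ge0.
have f2 : ((a^-1)%:E * 'E_P[s] < +oo)%E.
  by apply: le_lt_trans fin; rewrite addeAC leeDr// adde_ge0.
have Tfin : (Tquant P X X' f g < +oo)%E.
  by apply: le_lt_trans fin; rewrite leeDr// adde_ge0.
split => //.
have ai0 : 0 < a^-1 by rewrite invr_gt0.
have [iq qE] := scaled_sum_expectation_lty P N a^-1 q ai0 mq q_ge0 f1.
have [is' sE] := scaled_expectation_lty P a^-1 s ai0 ms s_ge0 f2.
have [_ TE] := T_lty Tfin.
exists (A * (\int[P]_w s w + \sum_(i < N) \int[P]_w q i w)).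
exists (a^-1 * (\sum_(i < N) \int[P]_w q i w) + a^-1 * (\int[P]_w s w) +
  a^-1 * \sum_(i < N) \int[P]_w (tau i w)).
split.
- move=> c' c'0.
  exact: (monotone_taylor_error P X X' f g indX lawX' indXX' Delta1 D1 F F1 A mF mF1 FL F1A
    c' c'0 M A D c Mm MA FM symD condD is' iq).
- by rewrite !EFinD -qE -sE -TE.
- move: (\int[P]_w s w) (\sum_(i < N) \int[P]_w q i w) (\sum_(i < N) \int[P]_w (tau i w)) => x y z.
  by rewrite le_eqVlt; apply/orP; left; apply/eqP; ring.
Qed.

End gibbs_distances.

Lemma stein_equation_E {R : realType} {d : measure_display} {T : measurableType d}
    (P : probability T R) (u : T -> R) (F F1 k : R -> R) (m A : R) :
  measurable_fun [set: R] F -> (forall x, `|F x| <= A) ->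
  (forall x, F1 x = x * F x + (k x - m)) ->
  P.-integrable [set: T] (EFin \o u) -> P.-integrable [set: T] (EFin \o (k \o u)) ->
  `|\int[P]_w (F (u w) * u w - F1 (u w))| = `|\int[P]_w k (u w) - m|.
Proof.
move=> mF FA SE iu iku; have mu := L1_measurable P _ iu.
have -> : \int[P]_w (F (u w) * u w - F1 (u w)) = \int[P]_w (m - k (u w)).
  by apply: eq_E => w; rewrite SE [u w * _]mulrC; ring.
by rewrite EB ?E_cst//; [rewrite distrC|exact: L1_cst].
Qed.

Theorem theorem2p1 (R : realType) :
  exists2 C : R, 0 < C &
  forall (N : nat), (0 < N)%N ->
  forall (d dY dZ : measure_display)
    (T : measurableType d) (TY : measurableType dY) (TZ : measurableType dZ)
    (P : probability T R) (Q : probability TY R) (S : probability TZ R)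
    (X X' : {RV P >-> N.-tuple R}) (Y : {RV Q >-> N.-tuple R})
    (Z : {RV S >-> R})
    (f g : {mfun N.-tuple R >-> R}),
  (* X has independent coordinates, and X' is an independent copy of X *)
  mutually_independent P (fun i w => tnth (X w) i) ->
  (forall A, measurable A -> distribution P X' A = distribution P X A) ->
  independent_RV2 P X X' ->
  (* h(X) = exp(g(X)) has a finite mean, and Y has the h-weighted law of X *)
  P.-integrable [set: T] (fun w => (expR (g (X w)))%:E) ->
  (forall A, measurable A ->
    distribution Q Y A =
    \int[distribution P X]_(y in A) (expR (g y) / weight_mean P X g)%:E)%E ->
  (forall A, measurable A -> distribution S Z A = normal_prob 0 1 A) ->
  let W : {RV Q >-> R} := f \o Y in
  Q.-integrable [set: TY] (EFin \o W) ->
  ('E_Q[W] = 0)%E ->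
  forall Delta1 Delta2 : 'I_N -> N.-tuple R -> R,
  (forall i, Delta_spec P X X' f f i (Delta1 i)) ->
  (forall i, Delta_spec P X X' f g i (Delta2 i)) ->
  Q.-integrable [set: TY] (fun w => (\sum_(i < N) Delta1 i (Y w))%:E) ->
  Q.-integrable [set: TY] (fun w => (\sum_(i < N) Delta2 i (Y w))%:E) ->
  let b := bquant Q Y Delta1 in
  b != 0 ->
  ((dWass W Z <= (C / `|b|)%:E *
      (delta1 P X X' f g + delta2 Q Y Delta1 + delta3 Q Y f b Delta2))%E
   /\
   forall (D : 'I_N -> N.-tuple R -> N.-tuple R -> R)
     (c : 'I_N -> N.-tuple R -> R),
   (forall i, sym_dominating P X X' f i (D i)) ->
   (forall i, is_cond_exp P X
      (fun w => D i (X w) (X' w) * resample_diff f (X w) (X' w) i) (c i)) ->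
   (dKol W Z <= (C / `|b|)%:E *
      (delta1' P X X' f g D c + delta2 Q Y Delta1 + delta3 Q Y f b Delta2))%E).
Proof.
have [A A0 steinL] := @stein_lipschitz R.
have leAC : A <= A + 3 by rewrite lerDl.
have le3C : 3 <= A + 3 by rewrite lerDr ltW.
have le2C : 2 <= A + 3 by apply: le_trans le3C; rewrite ler_nat.
(* [A] bounds the Stein solutions of Lipschitz functions, and 3 those of half-lines, where [F], [F1]
   and the monotone [M] are bounded by 3, 2 and 2. *)
exists (A + 3); first by rewrite addr_gt0.
move=> N _ d dY dZ T TY TZ P Q S X X' Y Z f g indX lawX' indXX' ih lawY lawZ W iW EW0.
move=> Delta1 Delta2 D1 D2 iS1 iS2 b b0.
have iW' : Q.-integrable [set: TY] (EFin \o (f \o Y)) by exact: iW.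
have EW : \int[Q]_w f (Y w) = 0.
  by have := EW0; rewrite expectation_real// => -[].
have mW : measurable_fun [set: TY] (f \o Y) by exact: (L1_measurable Q _ iW').
split.
- apply: ge_ereal_sup => _ [psi /wass_test_lipschitz psiL <-].
  have cpsi : continuous psi.
    by apply: (lipschitz_continuous psi 1) => x y; rewrite mul1r.
  have mpsi : measurable_fun [set: R] psi by exact: continuous_measurable_fun.
  have psiK t : `|psi t| <= `|t| + `|psi 0|.
    have := psiL t 0; rewrite subr0 => h.
    by rewrite -[psi t](subrK (psi 0)) (le_trans (ler_normD _ _))// lerD2r.
  have ipsi : Q.-integrable [set: TY] (EFin \o (psi \o (f \o Y))).
    apply: (L1_dom Q _ (fun w => `|f (Y w)| + `|psi 0|)).
    - exact: measurableT_comp.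
    - by move=> w; exact: psiK.
    - by apply: L1D; [exact: (L1_norm Q _ iW')|exact: L1_cst].
  have [iZ EZ] := normal_law_E S Z psi lawZ mpsi
    (integrable_linear_std_normal_pdf psi _ mpsi psiK).
  have [F [F1 [cF cF1 FA FL SE]]] := steinL psi psiL.
  have mF : measurable_fun [set: R] F by exact: continuous_measurable_fun.
  have mF1 : measurable_fun [set: R] F1 by exact: continuous_measurable_fun.
  have FC x : `|F x| <= A + 3 by have [h _] := FA x; exact: le_trans h leAC.
  have F1C x : `|F1 x| <= A + 3 by have [_ h] := FA x; exact: le_trans h leAC.
  rewrite [X in (`|X - _|)%E](expectation_real Q (psi \o (f \o Y)) ipsi).
  rewrite [X in (`|_ - X|)%E](expectation_real S (psi \o Z) iZ) -EFinB abse_EFin EZ.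
  rewrite -(stein_equation_E Q _ F F1 psi _ (A + 3) mF FC SE iW' ipsi).
  apply: (wasserstein_test_bound P Q X X' Y f g indX lawX' indXX' ih lawY Delta1 Delta2 iW' EW
    D1 D2 iS1 iS2 b0 F F1) => // x y; have [h1 h2] := FL x y.
  + by apply: le_trans h1 _; rewrite ler_wpM2r.
  + by apply: le_trans h2 _; rewrite ler_wpM2r// sqr_ge0.
- move=> D c symD condD; apply: ge_ereal_sup => _ [x _ <-].
  have [F [F1 [mF mF1 FA Fmono [FL FQ SE]]]] := stein_indicator x.
  pose H t : R := (t <= x)%R%:R.
  have FC t : `|F t| <= A + 3 by have [h _ _] := FA t; exact: le_trans h le3C.
  have F1C t : `|F1 t| <= A + 3 by have [_ h _] := FA t; exact: le_trans h le2C.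
  have HE : H = \1_`]-oo, x].
    by apply/funext => t; rewrite /H indicE mem_setE in_itv.
  have mH : measurable_fun [set: R] H by rewrite HE; exact: measurable_indic.
  have H1 t : `|H t| <= 1 by rewrite /H normr_nat lern1 leq_b1.
  have iH : Q.-integrable [set: TY] (EFin \o (H \o (f \o Y))).
    by apply: (L1_bounded Q _ 1) => [|w]; [exact: measurableT_comp|exact: H1].
  have cdfW : cdf W x = (\int[Q]_w H (f (Y w)))%:E.
    rewrite -(expectation_real Q (H \o (f \o Y)) iH) unlock.
    have -> : H \o (f \o Y) = \1_((f \o Y) @^-1` `]-oo, x]) by rewrite HE.
    by rewrite integral_indic ?setIT//; rewrite -[X in measurable X]setTI; exact: mW.
  have cdfZ : cdf Z x = (\int[@lebesgue_measure R]_(t in `]-oo, x]) normal_pdf 0 1 t)%:E.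
    rewrite /cdf lawZ// /normal_prob /Rintegral fineK//.
    apply: integrable_fin_num => //.
    by apply: (integrableS measurableT) => //; exact: integrable_normal_pdf.
  rewrite cdfW cdfZ -EFinB abse_EFin.
  rewrite -(stein_equation_E Q _ F F1 H _ (A + 3) mF FC SE iW' iH).
  (* [t * F t] increases and [H] decreases, so the two moduli in the remainder of [stein_indicator]
     have matching signs and collapse into one increment of [M]. *)
  pose M t := t * F t - H t.
  have Hmono s t : s <= t -> H t <= H s.
    by move=> st; rewrite /H ler_nat; case: (leP t x) => // tx; rewrite (le_trans st tx).
  have Mmono s t : s <= t -> M s <= M t.
    by move=> st; rewrite lerB ?Fmono ?Hmono.
  apply: (kolmogorov_test_bound P Q X X' Y f g indX lawX' indXX' ih lawY Delta1 Delta2 iW' EW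
    D1 D2 iS1 iS2 b0 F F1 M) => //.
  + by move=> s t; apply: le_trans (FL s t) _; rewrite ler_wpM2r.
  + move=> t; apply: le_trans le2C; rewrite (le_trans (ler_normB _ _))//.
    by have [_ _ h] := FA t; rewrite -[leRHS]/(1 + 1)%R lerD.
  + have sym s t : s <= t ->
        `|s - t| * (`|s * F s - t * F t| + `|H s - H t|) = (s - t) * (M s - M t).
      move=> st; rewrite ler0_norm ?subr_le0// ler0_norm ?subr_le0 ?Fmono//.
      by rewrite ger0_norm ?subr_ge0 ?Hmono// /M; ring.
    move=> s t; apply: le_trans (FQ s t) _.
    have [st|/ltW ts] := leP s t; first by rewrite -sym.
    rewrite distrC [`|s * F s - _|]distrC [`|_%:R - _|]distrC (sym _ _ ts).
    by rewrite le_eqVlt; apply/orP; left; apply/eqP; ring.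
Qed.
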